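(* Let $(A,G,\delta)$ be a C*-dynamical system with $G$ a compact group. Assume that there is a subgroup $\mathcal{S}$ of $\mathrm{Aut}_{\delta}(A)$ which acts minimally on $A$. If $B$ is a C*-subalgebra of $A$ with $A^{G}\subset B\subset A$ such that $B$ is globally invariant under $G$ (i.e. under all $\delta_g$, $g\in G$) and globally invariant under $\mathcal{S}$, then $B=A^{G^{B}}$. Conversely, if $G_{0}\subset G$ is a closed, normal subgroup, then $B=A^{G_{0}}$ is a $G$-invariant and $\mathcal{S}$-invariant C*-subalgebra such that $A^{G}\subset B\subset A$.
   Context: A C*-dynamical system $(A,G,\delta)$ with $G$ compact consists of a C*-algebra $A$, a compact group $G$ and a homomorphism $g\mapsto\delta_g$ of $G$ into the group $\mathrm{Aut}(A)$ of $*$-automorphisms of $A$ such that $g\mapsto\delta_g(a)$ is norm continuous for every $a\in A$. For a subgroup $K\subset G$, $A^{K}=\{a\in A \mid \delta_g(a)=a \text{ for all } g\in K\}$; in particular $A^G$ is the fixed point algebra of $\delta$. $\mathrm{Aut}_\delta(A)$ is the subgroup of $\mathrm{Aut}(A)$ consisting of all automorphisms commuting with $\delta_g$ for every $g\in G$. For a $G$-invariant C*-subalgebra $B\subset A$ containing $A^G$, put $G^{B}=\{g\in G\mid \delta_g(b)=b \text{ for all } b\in B\}$; it is a closed normal subgroup of $G$. A subgroup $\mathcal{S}\subset \mathrm{Aut}(A)$ acts minimally on $A$ (is minimal) if $\mathcal{H}^{\mathcal{S}}(A)=\{A\}$, where $\mathcal{H}^{\mathcal{S}}(A)$ is the set of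 all nonzero hereditary C*-subalgebras of $A$ that are globally $\mathcal{S}$-invariant. *)

(* Defs.v *)
From HB Require Import structures.
From mathcomp Require Import all_boot all_order all_algebra.
From mathcomp Require Import all_classical all_reals all_analysis.
From mathcomp.real_closed Require Import complex.
Set Implicit Arguments.
Unset Strict Implicit.
Unset Printing Implicit Defensive.
Import Order.TTheory GRing.Theory Num.Theory.
Import numFieldNormedType.Exports.
Local Open Scope classical_set_scope.
Local Open Scope ring_scope.

(* A C*-algebra need not have a unit, so its product is not the one of a
   [pzRingType]: it is the product [(a * b)%g] of a semigroup structure on a
   complex Banach space, required below to be bilinear.  The norm of a
   [normedModType R[i]] takes its values in the nonnegative reals of [R[i]]. *)

(* Common parent of [cstarAlgType] and [topologicalGroupType], needed by the
   inheritance mechanism.  It relates the product and the topology in no way. *)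
HB.structure Definition PreTopologicalSemigroup :=
  {T of Topological T & Semigroup T}.

HB.mixin Record CompleteNormedModule_isCStarAlgebra (R : realType) A
    of CompleteNormedModule R[i] A & Semigroup A := {
  cmulDl : forall a b c : A, ((a + b)%R * c)%g = (a * c)%g + (b * c)%g ;
  cmulDr : forall a b c : A, (a * (b + c)%R)%g = (a * b)%g + (a * c)%g ;
  cscalerAl : forall (k : R[i]) (a b : A), k *: (a * b)%g = ((k *: a)%R * b)%g ;
  cscalerAr : forall (k : R[i]) (a b : A), k *: (a * b)%g = (a * (k *: b)%R)%g ;
  cnormM : forall a b : A, `|(a * b)%g| <= `|a| * `|b| ;
  star : A -> A ;
  starK : involutive star ;
  starD : {morph star : a b / a + b} ;
  starZ : forall (k : R[i]) (a : A), star (k *: a) = k^* *: star a ;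
  starM : forall a b : A, star (a * b)%g = (star b * star a)%g ;
  cstar_identity : forall a : A, `|(star a * a)%g| = `|a| ^+ 2
}.

#[short(type="cstarAlgType")]
HB.structure Definition CStarAlgebra (R : realType) :=
  {A of CompleteNormedModule R[i] A & Semigroup A
      & CompleteNormedModule_isCStarAlgebra R A}.

Section Subalgebras.
Variables (R : realType) (A : cstarAlgType R).
Implicit Types (a b : A) (B : set A).

Definition cstar_subalgebra B : Prop :=
  [/\ closed B, submod_closed (mem B), mulg_closed (mem B)
    & forall a, B a -> B (star a)].

(* The positive cone of a C*-algebra; [cpositive (b - a)] is the order a <= b. *)
Definition cpositive a : Prop := exists b, a = (star b * b)%g.

Definition hereditary_cstar_subalgebra B : Prop :=
  cstar_subalgebra B /\
  (forall a b, B b -> cpositive a -> cpositive (b - a) -> B a).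

End Subalgebras.

Section StarAutomorphisms.
Variables (R : realType) (A : cstarAlgType R).

Definition is_star_aut (f : A -> A) : Prop :=
  [/\ bijective f,
      linear f,
      {morph f : a b / (a * b)%g}
    & {morph f : a / star a}].

(* No continuity is required: a *-automorphism is automatically isometric. *)
Record starAut : Type := StarAut {
  starAut_fun :> A -> A ;
  starAutP : is_star_aut starAut_fun }.

HB.instance Definition _ := gen_eqMixin starAut.
HB.instance Definition _ := gen_choiceMixin starAut.

Lemma starAut_ext (s t : starAut) : s =1 t -> s = t.
Proof.
case: s t => [f fP] [g gP] /= /funext fg.
by rewrite fg in fP *; congr StarAut; exact: Prop_irrelevance.
Qed.

Lemma is_star_aut_id : is_star_aut id.
Proof. by split=> //; exists id. Qed.

Lemma is_star_aut_comp (f g : A -> A) :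
  is_star_aut f -> is_star_aut g -> is_star_aut (f \o g).
Proof.
move=> [fb fl fM fS] [gb gl gM gS]; split.
- exact: bij_comp.
- by move=> k a b /=; rewrite gl fl.
- by move=> a b /=; rewrite gM fM.
- by move=> a /=; rewrite gS fS.
Qed.

Lemma is_star_aut_can (f g : A -> A) :
  is_star_aut f -> cancel f g -> cancel g f -> is_star_aut g.
Proof.
move=> [fb fl fM fS] fK gK; have fI := can_inj fK; split.
- by exists f.
- by move=> k a b; apply: fI; rewrite fl !gK.
- by move=> a b; apply: fI; rewrite fM !gK.
- by move=> a; apply: fI; rewrite fS !gK.
Qed.

Lemma starAut_inv_subproof (s : starAut) :
  exists g : A -> A, cancel s g /\ cancel g s.
Proof. by case: (starAutP s) => -[g sK gK] _ _ _; exists g. Qed.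

Definition starAut_one := StarAut is_star_aut_id.

Definition starAut_mul (s t : starAut) :=
  StarAut (is_star_aut_comp (starAutP s) (starAutP t)).

Definition starAut_inv (s : starAut) :=
  let: exist _ (conj sK gK) := cid (starAut_inv_subproof s) in
  StarAut (is_star_aut_can (starAutP s) sK gK).

Lemma starAut_mulA : associative starAut_mul.
Proof. by move=> s t u; exact: starAut_ext. Qed.

Lemma starAut_mul1g : left_id starAut_one starAut_mul.
Proof. by move=> s; exact: starAut_ext. Qed.

Lemma starAut_mulg1 : right_id starAut_one starAut_mul.
Proof. by move=> s; exact: starAut_ext. Qed.

Lemma starAut_mulVg : left_inverse starAut_one starAut_inv starAut_mul.
Proof.
move=> s; apply: starAut_ext => a.
by rewrite /= /starAut_inv; case: cid => g [sK gK] /=; rewrite sK.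
Qed.

Lemma starAut_mulgV : right_inverse starAut_one starAut_inv starAut_mul.
Proof.
move=> s; apply: starAut_ext => a.
by rewrite /= /starAut_inv; case: cid => g [sK gK] /=; rewrite gK.
Qed.

HB.instance Definition _ := isGroup.Build starAut
  starAut_mulA starAut_mul1g starAut_mulg1 starAut_mulVg starAut_mulgV.

End StarAutomorphisms.

HB.mixin Record Group_isTopologicalGroup G of Topological G & Group G := {
  mulg_continuous : continuous (fun xy : G * G => (xy.1 * xy.2)%g) ;
  invg_continuous : continuous (fun x : G => (x^-1)%g)
}.

#[short(type="topologicalGroupType")]
HB.structure Definition TopologicalGroup :=
  {G of Topological G & Group G & Group_isTopologicalGroup G}.

Definition subgroup (G : groupType) (H : set G) : Prop :=
  group_closed (mem H).

Definition normal_subgroup (G : groupType) (H : set G) : Prop :=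
  subgroup H /\ (forall x y : G, H x -> H (x ^ y)%g).

Section Dynamics.
Variables (R : realType) (A : cstarAlgType R).

Definition globally_invariant (T : set (starAut A)) (B : set A) : Prop :=
  forall s, T s -> s @` B = B.

Definition hereditary_invariant (T : set (starAut A)) : set (set A) :=
  [set B | [/\ hereditary_cstar_subalgebra B, B <> [set 0]
             & globally_invariant T B]].

(* An equality of families, so that it forces [A] to be nonzero. *)
Definition acts_minimally (T : set (starAut A)) : Prop :=
  hereditary_invariant T = [set setT].

Variables (G : topologicalGroupType) (delta : {multiplicative G -> starAut A}).

Definition pointwise_norm_continuous : Prop :=
  forall a : A, continuous (fun g : G => delta g a).

Definition fixed_algebra (K : set G) : set A :=
  [set a | forall g, K g -> delta g a = a].

Definition fixing_subgroup (B : set A) : set G :=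
  [set g | forall b, B b -> delta g b = b].

Definition aut_commuting : set (starAut A) :=
  [set s | forall g, commute s (delta g)].

End Dynamics.

(* Main.v *)
(** Let M be the uniform closure in C(G, A) of the span of the functions
    g |-> delta_g(b) a with b in B and a in A, and V the algebra of the functions v
    with v a in M for every a in A.  If w_1, ..., w_n are independent modulo V and
    the function w_1 y_1 + ... + w_n y_n is in M, then all the y_i vanish: in a
    shortest relation two of the coefficients would be related by an operator on a
    right ideal of A whose resolvents are everywhere given by elements of A, because
    minimality of S makes the ideals involved dense; no such operator exists.
    Hence the coefficients of the G-finite elements of B are in V.  By Peter-Weyl
    these elements are dense in B, so V separates the points of G / G^B, and by
    Stone-Weierstrass g |-> delta_g(a) c is in M for a fixed by G^B and c in A.
    For c in A^G, applying delta_g^-1 and averaging over G gives a c in B, and A^G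
    contains an approximate unit of A, again by minimality. *)
Require Import Defs.
From HB Require Import structures.
From mathcomp Require Import all_boot all_order all_algebra.
From mathcomp Require Import all_classical all_reals all_analysis.
From mathcomp.real_closed Require Import complex.
From mathcomp Require Import ring lra.
Set Implicit Arguments.
Unset Strict Implicit.
Unset Printing Implicit Defensive.
Import Order.TTheory GRing.Theory Num.Theory.
Import numFieldNormedType.Exports.
Local Open Scope classical_set_scope.
Local Open Scope ring_scope.
Local Notation "x %:C" := (real_complex _ x) (format "x %:C") : ring_scope.

(** For a closed [S]-invariant right ideal [I != 0], the [a] with [a] and [star a] in [I] form a
    hereditary subalgebra; this is how minimality forces [I = A]. Such ideals arise as closures of
    the sets of values of one coefficient, [M] being stable under [S], right multiplication by [A]
    and left multiplication by [A^G]. The obstacle is that the operator [T p = q] tying two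
    coefficients comes without a bound and with a domain that is only dense. But a dense right ideal
    stable under [A^G] contains every [e] in [A^G] with a local unit there: [e e' = e] for some [e']
    in [A^G]. So [tau = T e] exists in [A], and [T] is left multiplication by [tau] on the [y] with
    [e y = y]. For complex [c] the operator [T - c] is injective, since [q = c p] gives a relation
    between the fewer functions [w_1 + c w_2, w_3, ...], and its range is again a dense right ideal;
    so [(T - c)^-1 e] is in [A] too. A resolvent at every [c] contradicts Gelfand-Mazur.

    Means over [G] are limits of averages of translates, and functional calculus is reduced to
    square roots and inverses. *)

Local Notation Re := complex.Re.
Local Notation Im := complex.Im.

(** * Real-valued norms of elements and of scalars *)

Section RealNorm.
Variables (R : realType) (A : cstarAlgType R).
Implicit Types (a b c x y : A) (k : R[i]).

(** The norm of [A] takes its values among the nonnegative reals of [R[i]]; passing to the real part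
    loses nothing and makes linear arithmetic over [R] available. *)
Definition nm a : R := Re `|a|.
Definition cm k : R := Re `|k|.

Lemma normE a : `|a| = (nm a)%:C.
Proof. by rewrite RRe_real // normr_real. Qed.

Lemma cnormE k : `|k| = (cm k)%:C.
Proof. by rewrite RRe_real // normr_real. Qed.

Lemma nm_ge0 a : 0 <= nm a.
Proof. by rewrite -lecR -normE normr_ge0. Qed.

Lemma cm_ge0 k : 0 <= cm k.
Proof. by rewrite -lecR -cnormE normr_ge0. Qed.

Lemma nm0 : nm 0 = 0.
Proof. by rewrite /nm normr0 raddf0. Qed.

Lemma nm_eq0 a : (nm a == 0) = (a == 0).
Proof. by rewrite -(normr_eq0 a) normE fmorph_eq0. Qed.

Lemma nmD a b : nm (a + b) <= nm a + nm b.
Proof. by rewrite -lecR rmorphD /= -!normE ler_normD. Qed.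

Lemma nmN a : nm (- a) = nm a.
Proof. by rewrite /nm normrN. Qed.

Lemma nmB a b : nm (a - b) <= nm a + nm b.
Proof. by rewrite -(nmN b) nmD. Qed.

Lemma nmBC a b : nm (a - b) = nm (b - a).
Proof. by rewrite -nmN opprB. Qed.

Lemma nm_triangle b a c : nm (a - c) <= nm (a - b) + nm (b - c).
Proof. by apply: le_trans (nmD _ _); rewrite addrA subrK. Qed.

Lemma nm_le b a : nm a <= nm (a - b) + nm b.
Proof. by apply: le_trans (nmD _ _); rewrite subrK. Qed.

Lemma nmZ k a : nm (k *: a) = cm k * nm a.
Proof. by apply: complexI; rewrite rmorphM /= -!normE normrZ cnormE. Qed.

Lemma nmM a b : nm (a * b)%g <= nm a * nm b.
Proof. by rewrite -lecR rmorphM /= -!normE cnormM. Qed.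

Lemma nm_cstar a : nm (star a * a)%g = nm a ^+ 2.
Proof. by apply: complexI; rewrite rmorphXn /= -!normE cstar_identity. Qed.

Lemma nm_sum I (r : seq I) (P : pred I) (F : I -> A) :
  nm (\sum_(i <- r | P i) F i) <= \sum_(i <- r | P i) nm (F i).
Proof.
elim/big_ind2: _ => //; first by rewrite nm0.
by move=> x1 x2 y1 y2 h1 h2; apply: le_trans (nmD _ _) _; rewrite lerD.
Qed.

Lemma cmM k l : cm (k * l) = cm k * cm l.
Proof. by apply: complexI; rewrite rmorphM /= -!cnormE normrM. Qed.

Lemma cmD k l : cm (k + l) <= cm k + cm l.
Proof. by rewrite -lecR rmorphD /= -!cnormE ler_normD. Qed.

Lemma cmN k : cm (- k) = cm k.
Proof. by rewrite /cm normrN. Qed.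

Lemma cmC k : cm k^* = cm k.
Proof. by rewrite /cm norm_conjC. Qed.

Lemma cm_eq0 k : (cm k == 0) = (k == 0).
Proof. by rewrite -(normr_eq0 k) cnormE fmorph_eq0. Qed.

Lemma cm0 : cm 0 = 0. Proof. by apply/eqP; rewrite cm_eq0. Qed.

Lemma cm1 : cm 1 = 1. Proof. by rewrite /cm normr1. Qed.

Lemma cmV k : cm k^-1 = (cm k)^-1.
Proof. by apply: complexI; rewrite fmorphV /= -!cnormE normfV. Qed.

Lemma cmX k n : cm (k ^+ n) = cm k ^+ n.
Proof. by elim: n => [|n IH]; rewrite ?expr0 ?cm1 // !exprS cmM IH. Qed.

Lemma cm_conjM k : (cm k ^+ 2)%:C = k^* * k.
Proof. by rewrite rmorphXn /= -cnormE normCK mulrC. Qed.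

Lemma cm_real (r : R) : cm r%:C = `|r|.
Proof.
apply: complexI; rewrite -cnormE; case: (leP 0 r) => h.
  by rewrite (ger0_norm h) ger0_norm ?ler0c.
by rewrite (ltr0_norm h) ltr0_norm ?rmorphN // ltcR.
Qed.

Lemma cm_i : cm 'i%C = 1.
Proof.
by apply/eqP; rewrite -(@eqrXn2 _ 2) ?cm_ge0 // -cmX sqr_i cmN cm1 expr1n.
Qed.

Lemma cm_ReIm k : cm k <= `|Re k| + `|Im k|.
Proof.
rewrite {1}[k]complexE; apply: le_trans (cmD _ _) _; rewrite cmM !cm_real.
by rewrite cm_i mul1r.
Qed.

Lemma Re_le_cm k : `|Re k| <= cm k.
Proof. by rewrite -lecR -cnormE normc_ge_Re. Qed.

Lemma Im_le_cm k : `|Im k| <= cm k.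
Proof.
have := Re_le_cm (k * 'i%C); rewrite ReiNIm normrN => /le_trans; apply.
by rewrite cmM cm_i mulr1.
Qed.

Lemma conj_realC (r : R) : (r%:C)^* = r%:C :> R[i].
Proof. by apply: (@conj_Creal R[i]); apply/complex_realP; exists r. Qed.

Lemma cnatE n : (n%:R : R[i]) = (n%:R : R)%:C.
Proof. by rewrite rmorph_nat. Qed.

End RealNorm.

(** * The norm topology and completeness with explicit error bounds *)

Section Topology.
Variables (R : realType) (A : cstarAlgType R).
Implicit Types (a b : A) (B : set A).

Lemma ltc_cm (e : R[i]) : 0 < e -> 0 < Re e /\ e = (Re e)%:C.
Proof.
by move=> e0; rewrite RRe_real ?gtr0_real //; rewrite -ltcR RRe_real ?gtr0_real.
Qed.

Lemma nbhs_nmP a (P : set A) :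
  nbhs a P <-> exists2 e : R, 0 < e & forall b, nm (a - b) < e -> P b.
Proof.
rewrite -nbhs_ballE; split.
  move=> [e /= e0 eP]; have [r0 er] := ltc_cm e0; exists (Re e) => // b ab.
  by apply: eP; rewrite -ball_normE /ball_ /= normE er ltcR.
move=> [e e0 eP]; exists e%:C => /=; first by rewrite ltcR.
by move=> b; rewrite -ball_normE /ball_ /= normE ltcR => /eP.
Qed.

Lemma closed_nmP B :
  closed B <->
  forall a, (forall e : R, 0 < e -> exists2 b, B b & nm (a - b) < e) -> B a.
Proof.
split.
  move=> cB a ha; apply: cB => U /nbhs_nmP[e e0 eU].
  by have [b Bb ab] := ha _ e0; exists b; split=> //; exact: eU.
move=> hB a ha; apply: hB => e e0.
have [|b [Bb ab]] := ha [set b | nm (a - b) < e]; last by exists b.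
by apply/nbhs_nmP; exists e.
Qed.

Lemma continuous_nmP (T : topologicalType) (f : T -> A) (t : T) :
  {for t, continuous f} <->
  forall e : R, 0 < e -> \forall s \near t, nm (f t - f s) < e.
Proof.
split.
  move=> cf e e0; apply: (cf [set b | nm (f t - b) < e]).
  by apply/nbhs_nmP; exists e.
move=> h U /nbhs_nmP[e e0 eU].
by apply: filterS (h _ e0) => s; exact: eU.
Qed.

(** A Cauchy sequence comes with its own error bound [d], and the same [d n] bounds the distance to
    the limit, so that later estimates can quote it directly. *)
Lemma nm_complete (u : nat -> A) (d : nat -> R) :
  (forall m n, nm (u m - u n) <= d m + d n) ->
  (forall e : R, 0 < e -> exists N, forall n, (N <= n)%N -> d n <= e) ->
  exists a, forall n, nm (a - u n) <= d n.
Proof.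
move=> hu hd.
have cu : cvg (u @ \oo).
  apply: cauchy_cvg; apply/cauchy_ballP => e e0; have [r0 er] := ltc_cm e0.
  have [N hN] := hd (Re e / 3%:R) (divr_gt0 r0 (ltr0n _ 3)).
  have hb m n : (N <= m)%N -> (N <= n)%N -> ball (u m) e (u n).
    move=> Nm Nn; rewrite -ball_normE /ball_ /= normE er ltcR.
    apply: le_lt_trans (hu m n) _.
    apply: le_lt_trans (lerD (hN _ Nm) (hN _ Nn)) _; lra.
  exists (u @` [set n | (N <= n)%N], u @` [set n | (N <= n)%N]).
    by split; exists N => // n Nn /=; exists n.
  by move=> [_ _] /= [[m Nm <-] [n Nn <-]]; exact: hb.
pose a := lim (u @ \oo); have la : u @ \oo --> a by exact: cu.
exists a => n; apply/ler_addgt0Pr => e e0.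
have e2 : 0 < e / 2%:R by rewrite divr_gt0 // ltr0n.
have [N hN] := hd _ e2.
have : nbhs a [set b | nm (a - b) < e / 2%:R] by apply/nbhs_nmP; exists (e / 2%:R).
move=> /la [M _ hM].
have h1 := hM (maxn M N) (leq_maxl _ _).
have h2 := hN _ (leq_maxr M N).
move: h1 => /= h1.
apply: le_trans (nm_triangle (u (maxn M N)) _ _) _.
have := hu (maxn M N) n; lra.
Qed.

End Topology.

(** The intervals of centre [u n] and radius [d n] meet pairwise, so the supremum of their left ends
    lies in all of them. *)
Lemma real_complete (R : realType) (u d : nat -> R) :
  (forall m n, `|u m - u n| <= d m + d n) ->
  exists x, forall n, `|x - u n| <= d n.
Proof.
move=> hu; pose S := [set u n - d n | n in [set: nat]].
have ub n : ubound S (u n + d n).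
  by move=> _ [m _ <-]; have := hu m n; rewrite ler_distl; lra.
exists (sup S) => n; rewrite ler_distl; apply/andP; split.
  by apply: ub_le_sup; [exists (u 0%N + d 0%N)|exists n].
by apply: ge_sup; [exists (u n - d n), n|].
Qed.

(** * Bilinearity of the product and isometry of the involution *)

Section CStarBasics.
Variables (R : realType) (A : cstarAlgType R).
Implicit Types (a b c x y : A) (k : R[i]).

Lemma cmul0l a : (0 * a)%g = 0 :> A.
Proof. by apply: (addrI (0 * a)%g); rewrite -cmulDl !addr0. Qed.

Lemma cmul0r a : (a * 0)%g = 0 :> A.
Proof. by apply: (addrI (a * 0)%g); rewrite -cmulDr !addr0. Qed.

Lemma cmulNl a b : (- a * b)%g = - (a * b)%g.
Proof. by apply: (addrI (a * b)%g); rewrite -cmulDl !subrr cmul0l. Qed.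

Lemma cmulNr a b : (a * - b)%g = - (a * b)%g.
Proof. by apply: (addrI (a * b)%g); rewrite -cmulDr !subrr cmul0r. Qed.

Lemma cmulBl a b c : ((a - b)%R * c)%g = (a * c)%g - (b * c)%g.
Proof. by rewrite cmulDl cmulNl. Qed.

Lemma cmulBr a b c : (a * (b - c)%R)%g = (a * b)%g - (a * c)%g.
Proof. by rewrite cmulDr cmulNr. Qed.

Lemma csuml I (r : seq I) (P : pred I) (F : I -> A) a :
  ((\sum_(i <- r | P i) F i)%R * a)%g = \sum_(i <- r | P i) (F i * a)%g.
Proof. by elim/big_rec2: _ => [|i y1 y2 _ <-]; rewrite ?cmul0l ?cmulDl. Qed.

Lemma csumr I (r : seq I) (P : pred I) (F : I -> A) a :
  (a * (\sum_(i <- r | P i) F i)%R)%g = \sum_(i <- r | P i) (a * F i)%g.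
Proof. by elim/big_rec2: _ => [|i y1 y2 _ <-]; rewrite ?cmul0r ?cmulDr. Qed.

Lemma star0 : star 0 = 0 :> A.
Proof. by apply: (addrI (star (0 : A))); rewrite -starD !addr0. Qed.

Lemma starN a : star (- a) = - star a.
Proof. by apply: (addrI (star a)); rewrite -starD !subrr star0. Qed.

Lemma starB a b : star (a - b) = star a - star b.
Proof. by rewrite starD starN. Qed.

Lemma nm_star a : nm (star a) = nm a.
Proof.
suff h b : nm b <= nm (star b) by apply/le_anti; rewrite h -{2}(starK a) h.
have [->|b0] := eqVneq b 0; first by rewrite star0.
rewrite -(@ler_pM2r _ (nm b)) ?lt0r ?nm_eq0 ?b0 ?nm_ge0 //.
by rewrite -expr2 -nm_cstar nmM.
Qed.

End CStarBasics.

(** * The unitization and its C*-norm *)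

Definition unitz (R : realType) (A : cstarAlgType R) : Type := (R[i]^o * A)%type.

HB.instance Definition _ (R : realType) (A : cstarAlgType R) :=
  GRing.Lmodule.on (unitz A).
HB.instance Definition _ (R : realType) (A : cstarAlgType R) :=
  Choice.on (unitz A).

Section UnitzRing.
Variables (R : realType) (A : cstarAlgType R).
Implicit Types (u v w : unitz A).

Definition unitz_one : unitz A := (1, 0).
Definition unitz_mul u v : unitz A :=
  (u.1 * v.1, u.1 *: v.2 + v.1 *: u.2 + (u.2 * v.2)%g).

Lemma unitz_mulA : associative unitz_mul.
Proof.
move=> [k a] [l b] [m c]; congr pair; first exact: mulrA.
rewrite /= !scalerDr !cmulDl !cmulDr -!cscalerAl -!cscalerAr !scalerA mulgA.
rewrite (mulrC m k) (mulrC m l).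
by rewrite (AC (4*3) (1*(2*4*6)*(3*5*7))).
Qed.

Lemma unitz_mul1 : left_id unitz_one unitz_mul.
Proof.
by move=> [k a]; congr pair; rewrite /= ?mul1r // scaler0 cmul0l scale1r !addr0.
Qed.

Lemma unitz_mulr1 : right_id unitz_one unitz_mul.
Proof.
by move=> [k a]; congr pair; rewrite /= ?mulr1 // scaler0 cmul0r scale1r add0r addr0.
Qed.

Lemma unitz_mulDl : left_distributive unitz_mul +%R.
Proof.
move=> [k a] [l b] [m c]; congr pair; first exact: mulrDl.
by rewrite /= scalerDl scalerDr cmulDl (AC (2*2*2) (1*3*5*(2*4*6))).
Qed.

Lemma unitz_mulDr : right_distributive unitz_mul +%R.
Proof.
move=> [k a] [l b] [m c]; congr pair; first exact: mulrDr.
by rewrite /= scalerDl scalerDr cmulDr (AC (2*2*2) (1*3*5*(2*4*6))).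
Qed.

Lemma unitz_1neq0 : unitz_one != 0.
Proof. by apply/eqP => -[] /eqP; rewrite oner_eq0. Qed.

End UnitzRing.

HB.instance Definition _ (R : realType) (A : cstarAlgType R) :=
  GRing.Zmodule_isNzRing.Build (unitz A)
    (@unitz_mulA R A) (@unitz_mul1 R A) (@unitz_mulr1 R A)
    (@unitz_mulDl R A) (@unitz_mulDr R A) (@unitz_1neq0 R A).

Section UnitzAlgebra.
Variables (R : realType) (A : cstarAlgType R).
Implicit Types (u v w : unitz A) (k : R[i]) (a b y : A).

Lemma unitz_scaleAl k u v : k *: (u * v) = (k *: u) * v.
Proof.
congr pair; first exact: mulrA.
by rewrite /= !scalerDr cscalerAl !scalerA (mulrC v.1).
Qed.

HB.instance Definition _ :=
  GRing.Lmodule_isLalgebra.Build R[i] (unitz A) unitz_scaleAl.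

Lemma unitz_scaleAr k u v : k *: (u * v) = u * (k *: v).
Proof.
congr pair; first exact: mulrCA.
by rewrite /= !scalerDr cscalerAr !scalerA (mulrC u.1).
Qed.

HB.instance Definition _ :=
  GRing.Lalgebra_isAlgebra.Build R[i] (unitz A) unitz_scaleAr.

Definition ustar u : unitz A := (u.1^*, star u.2).
Definition uin a : unitz A := (0, a).
(** The product [u y], which is again in [A] since [A] is the kernel of the character
    [u |-> u.1]. *)
Definition act u y : A := u.1 *: y + (u.2 * y)%g.

Lemma ustarK : involutive ustar.
Proof. by move=> [k a]; rewrite /ustar /= conjCK starK. Qed.

Lemma ustarD u v : ustar (u + v) = ustar u + ustar v.
Proof. by rewrite /ustar /= rmorphD starD. Qed.

Lemma ustarZ k u : ustar (k *: u) = k^* *: ustar u.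
Proof. by rewrite /ustar /= starZ rmorphM. Qed.

Lemma ustarN u : ustar (- u) = - ustar u.
Proof. by rewrite /ustar /= rmorphN starN. Qed.

Lemma ustarB u v : ustar (u - v) = ustar u - ustar v.
Proof. by rewrite ustarD ustarN. Qed.

Lemma ustarM u v : ustar (u * v) = ustar v * ustar u.
Proof.
congr pair; first by rewrite /= rmorphM mulrC.
by rewrite /= !starD !starZ starM (addrC (_ *: _)).
Qed.

Lemma ustar1 : ustar 1 = 1.
Proof. by rewrite /ustar /= rmorph1 star0. Qed.

Lemma uinD a b : uin (a + b) = uin a + uin b.
Proof. by congr pair; rewrite /= addr0. Qed.

Lemma uinZ k a : uin (k *: a) = k *: uin a.
Proof. by congr pair; rewrite /= scaler0. Qed.

Lemma uinN a : uin (- a) = - uin a.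
Proof. by congr pair; rewrite /= oppr0. Qed.

Lemma uinB a b : uin (a - b) = uin a - uin b.
Proof. by rewrite uinD uinN. Qed.

Lemma uinM a b : uin (a * b)%g = uin a * uin b.
Proof. by congr pair; rewrite /= ?mul0r // !scale0r !add0r. Qed.

Lemma uin_star a : uin (star a) = ustar (uin a).
Proof. by rewrite /ustar /= rmorph0. Qed.

Lemma uin_inj : injective uin. Proof. by move=> a b []. Qed.

Lemma uin0 : uin 0 = 0. Proof. by []. Qed.

Lemma uinE u : u.1 = 0 -> u = uin u.2.
Proof. by case: u => k a /= ->. Qed.

Lemma uin_act u y : uin (act u y) = u * uin y.
Proof. by congr pair; rewrite /= ?mulr0 // scale0r addr0. Qed.

Lemma actM u v y : act (u * v) y = act u (act v y).
Proof. by apply: uin_inj; rewrite !uin_act mulrA. Qed.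

Lemma actD u v y : act (u + v) y = act u y + act v y.
Proof. by apply: uin_inj; rewrite uinD !uin_act mulrDl. Qed.

Lemma actN u y : act (- u) y = - act u y.
Proof. by apply: uin_inj; rewrite uinN !uin_act mulNr. Qed.

Lemma actB u v y : act (u - v) y = act u y - act v y.
Proof. by rewrite actD actN. Qed.

Lemma actZ k u y : act (k *: u) y = k *: act u y.
Proof. by apply: uin_inj; rewrite uinZ !uin_act scalerAl. Qed.

Lemma act1 y : act 1 y = y.
Proof. by apply: uin_inj; rewrite uin_act mul1r. Qed.

Lemma actDr u x y : act u (x + y) = act u x + act u y.
Proof. by apply: uin_inj; rewrite uinD !uin_act uinD mulrDr. Qed.

Lemma act_uin a y : act (uin a) y = (a * y)%g.
Proof. by rewrite /act /= scale0r add0r. Qed.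

(* The larger of [|u.1|] and the norm of [u] as a left multiplier of [A]: a
   C*-norm even when [A] already has a unit. *)
Definition bnd u (C : R) : Prop :=
  [/\ 0 <= C, cm u.1 <= C & forall y, nm (act u y) <= C * nm y].

Definition nu u : R := inf [set C | bnd u C].

Lemma bnd_pair u : bnd u (cm u.1 + nm u.2).
Proof.
split; rewrite ?addr_ge0 ?cm_ge0 ?nm_ge0 ?lerDl ?nm_ge0 // => y.
by apply: le_trans (nmD _ _) _; rewrite nmZ mulrDl lerD2l nmM.
Qed.

Lemma nu_le u C : bnd u C -> nu u <= C.
Proof. by move=> h; apply: ge_inf => //; exists 0 => D []. Qed.

Lemma le_nu u (c : R) : (forall C, bnd u C -> c <= C) -> c <= nu u.
Proof. by move=> h; apply: lb_le_inf => //; exists (cm u.1 + nm u.2); exact: bnd_pair. Qed.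

Lemma nuP u : bnd u (nu u).
Proof.
split=> [||y]; try by apply: le_nu => C [].
have [->|y0] := eqVneq y 0.
  by rewrite /act scaler0 cmul0r addr0 !nm0 mulr0.
have yp : 0 < nm y by rewrite lt0r nm_eq0 y0 nm_ge0.
by rewrite -ler_pdivrMr //; apply: le_nu => C [_ _]; rewrite ler_pdivrMr.
Qed.

Lemma nu_ge0 u : 0 <= nu u. Proof. by case: (nuP u). Qed.

Lemma nu_act u y : nm (act u y) <= nu u * nm y. Proof. by case: (nuP u). Qed.

Lemma nu_cm u : cm u.1 <= nu u. Proof. by case: (nuP u). Qed.

Lemma nu_pair u : nu u <= cm u.1 + nm u.2. Proof. exact/nu_le/bnd_pair. Qed.

Lemma nuD u v : nu (u + v) <= nu u + nu v.
Proof.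
apply: nu_le; split; first by rewrite addr_ge0 ?nu_ge0.
  by apply: le_trans (cmD _ _) _; rewrite lerD ?nu_cm.
by move=> y; rewrite actD mulrDl; apply: le_trans (nmD _ _) _; rewrite lerD ?nu_act.
Qed.

Lemma nuM u v : nu (u * v) <= nu u * nu v.
Proof.
apply: nu_le; split; first by rewrite mulr_ge0 ?nu_ge0.
  by rewrite /= cmM ler_pM ?nu_cm ?cm_ge0.
move=> y; rewrite actM; apply: le_trans (nu_act _ _) _.
by rewrite -mulrA ler_wpM2l ?nu_ge0 ?nu_act.
Qed.

Lemma nuZ_le k u : nu (k *: u) <= cm k * nu u.
Proof.
apply: nu_le; split; first by rewrite mulr_ge0 ?nu_ge0 ?cm_ge0.
  by rewrite /= cmM ler_wpM2l ?nu_cm ?cm_ge0.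
by move=> y; rewrite actZ nmZ -mulrA ler_wpM2l ?cm_ge0 ?nu_act.
Qed.

Lemma nu0 : nu 0 = 0.
Proof.
apply/le_anti; rewrite nu_ge0 andbT.
by apply: le_trans (nu_pair _) _; rewrite /= cm0 nm0 addr0.
Qed.

Lemma nuZ k u : nu (k *: u) = cm k * nu u.
Proof.
have [->|k0] := eqVneq k 0; first by rewrite scale0r cm0 mul0r nu0.
apply/le_anti; rewrite nuZ_le /=.
have := nuZ_le k^-1 (k *: u); rewrite scalerA mulVf // scale1r cmV.
by rewrite ler_pdivlMl // lt0r cm_eq0 k0 cm_ge0.
Qed.

Lemma nuN u : nu (- u) = nu u.
Proof. by rewrite -scaleN1r nuZ cmN cm1 mul1r. Qed.

Lemma nuB u v : nu (u - v) <= nu u + nu v.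
Proof. by rewrite -(nuN v) nuD. Qed.

Lemma nuBC u v : nu (u - v) = nu (v - u).
Proof. by rewrite -nuN opprB. Qed.

Lemma nu_triangle v u w : nu (u - w) <= nu (u - v) + nu (v - w).
Proof. by apply: le_trans (nuD _ _); rewrite addrA subrK. Qed.

Lemma nu1 : nu 1 = 1.
Proof.
apply/le_anti/andP; split.
  by apply: le_trans (nu_pair _) _; rewrite /= cm1 nm0 addr0.
by apply: le_trans (nu_cm _); rewrite /= cm1.
Qed.

Lemma nu_uin a : nu (uin a) = nm a.
Proof.
apply/le_anti/andP; split.
  by apply: le_trans (nu_pair _) _; rewrite /= cm0 add0r.
have [->|a0] := eqVneq a 0; first by rewrite nm0 nu_ge0.
have ap : 0 < nm a by rewrite lt0r nm_eq0 a0 nm_ge0.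
rewrite -(@ler_pM2r _ (nm a)) //; have := nu_act (uin a) (star a).
by rewrite act_uin nm_star -{1}(starK a) nm_cstar nm_star expr2.
Qed.

Lemma nu_eq0 u : (nu u == 0) = (u == 0).
Proof.
apply/eqP/eqP => [h|->]; last exact: nu0.
have := nu_cm u; rewrite h => k0.
have {}k0 : u.1 = 0 by apply/eqP; rewrite -cm_eq0 eq_le k0 cm_ge0.
by move: h; rewrite (uinE k0) nu_uin => /eqP; rewrite nm_eq0 => /eqP ->.
Qed.

(** Removing the scalar part costs at most another [nu u], hence the factor 2. With [nu_pair] this
    makes [nu] equivalent to the norm of the pair, whence completeness. *)
Lemma nm_le_nu u : nm u.2 <= 2%:R * nu u.
Proof.
have -> : nm u.2 = nu (u - u.1 *: 1).
  rewrite -nu_uin; congr nu; congr pair; first by rewrite /= [_ *: _]mulr1 subrr.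
  by rewrite /= -[X in _ *: X]/(0 : A) scaler0 subr0.
apply: le_trans (nuB _ _) _; rewrite nuZ nu1 mulr1.
by have := nu_cm u; lra.
Qed.

(** The square of the norm of [u y] is the norm of [y^* u^* u y], at most
    [nu (ustar u * u) * nm y ^+ 2]: the multiplier norm inherits the C*-inequality from [A]. *)
Lemma nu_cstar_le u (C : R) : 0 <= C -> nu (ustar u * u) <= C ^+ 2 -> nu u <= C.
Proof.
move=> C0 h; apply: nu_le; split=> // [|y].
  rewrite -(@ler_pXn2r _ 2) ?nnegrE ?cm_ge0 //; apply: le_trans h.
  by apply: le_trans (nu_cm _); rewrite /= cmM cmC expr2.
rewrite -(@ler_pXn2r _ 2) ?nnegrE ?nm_ge0 ?mulr_ge0 ?nm_ge0 //.
rewrite -nm_cstar.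
have -> : (star (act u y) * act u y)%g = (star y * act (ustar u * u)%R y)%g.
  apply: uin_inj; rewrite !uinM !uin_star !uin_act ustarM.
  by rewrite !mulrA.
apply: le_trans (nmM _ _) _; rewrite nm_star exprMn.
rewrite [leRHS]mulrC expr2 -mulrA ler_wpM2l ?nm_ge0 // mulrC.
by apply: le_trans (nu_act _ _) _; rewrite ler_wpM2r ?nm_ge0.
Qed.

Lemma nu_star u : nu (ustar u) = nu u.
Proof.
suff h v : nu v <= nu (ustar v) by apply/le_anti; rewrite h -{2}(ustarK u) h.
have [->|v0] := eqVneq v 0; first by rewrite nu0 nu_ge0.
have vp : 0 < nu v by rewrite lt0r nu_eq0 v0 nu_ge0.
have : nu v <= Num.sqrt (nu (ustar v) * nu v).
  by apply: nu_cstar_le; rewrite ?sqrtr_ge0 // sqr_sqrtr ?mulr_ge0 ?nu_ge0 // nuM.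
rewrite -(@ler_pXn2r _ 2) ?nnegrE ?sqrtr_ge0 ?nu_ge0 // sqr_sqrtr ?mulr_ge0 ?nu_ge0 //.
by rewrite expr2 ler_pM2r.
Qed.

Lemma nu_cstar u : nu (ustar u * u) = nu u ^+ 2.
Proof.
apply/le_anti/andP; split; first by rewrite expr2 -{1}(nu_star u) nuM.
rewrite -[leRHS]sqr_sqrtr ?nu_ge0 // ler_pXn2r ?nnegrE ?sqrtr_ge0 ?nu_ge0 //.
by apply: nu_cstar_le; rewrite ?sqrtr_ge0 ?sqr_sqrtr ?nu_ge0.
Qed.

Lemma nu_complete (s : nat -> unitz A) (d : nat -> R) :
  (forall m n, nu (s m - s n) <= d m + d n) ->
  (forall e : R, 0 < e -> exists N, forall n, (N <= n)%N -> d n <= e) ->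
  exists u, forall n, nu (u - s n) <= 4%:R * d n.
Proof.
move=> hs hd.
have hk m n : cm ((s m).1 - (s n).1) <= d m + d n.
  by apply: le_trans (hs m n); exact: (nu_cm (s m - s n)).
have [x hx] : exists x, forall n, `|x - Re (s n).1| <= d n.
  apply: real_complete => m n; rewrite -raddfB; exact: le_trans (Re_le_cm _) _.
have [y hy] : exists x, forall n, `|x - Im (s n).1| <= d n.
  apply: real_complete => m n; rewrite -raddfB; exact: le_trans (Im_le_cm _) _.
have [a ha] : exists a, forall n, nm (a - (s n).2) <= 2%:R * d n.
  apply: nm_complete => [m n|e e0].
    rewrite -mulrDr; apply: le_trans (ler_wpM2l _ (hs m n)) => //.
    exact: (nm_le_nu (s m - s n)).
  have [N hN] := hd (e / 2%:R) (divr_gt0 e0 (ltr0n _ 2)).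
  by exists N => n /hN; lra.
(* The factor 4: one [d n] for each of the real and imaginary parts of the scalar, two for the
   component in [A]. *)
exists ((x +i* y)%C, a) => n; apply: le_trans (nu_pair _) _ => /=.
have := ha n; have := hx n; have := hy n.
have := cm_ReIm ((x +i* y)%C - (s n).1); rewrite !raddfB /=; lra.
Qed.

End UnitzAlgebra.

(** * The scalar iteration that controls square roots *)

Section SqrtSequence.
Variable R : realType.

(* The square-root iteration [y |-> (x + y^2) / 2] at [x = 1]; it dominates the
   same iteration at every [x] of norm at most [1]. *)
Fixpoint sqrt_seq (n : nat) : R :=
  if n is m.+1 then (1 + sqrt_seq m ^+ 2) / 2%:R else 0.

Lemma sqrt_seq_bounds n : 0 <= sqrt_seq n <= 1.
Proof.
elim: n => [|n /andP[h0 h1]] /=; first by rewrite lexx ler01.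
by apply/andP; split; nra.
Qed.

Lemma sqrt_seqS n : sqrt_seq n <= sqrt_seq n.+1.
Proof. by have /andP[h0 h1] := sqrt_seq_bounds n => /=; nra. Qed.

(** In terms of the gap [d = 1 - sqrt_seq n] the recursion is [d |-> d - d^2 / 2], which decays like
    [2 / n]. *)
Lemma sqrt_seq_gap n : (1 - sqrt_seq n) * (n%:R + 2%:R) <= 2%:R.
Proof.
elim: n => [|n IH]; first by rewrite subr0 add0r mul1r.
have /andP[h0 h1] := sqrt_seq_bounds n; rewrite -natr1 /=.
have n0 : 0 <= n%:R :> R by [].
set d := 1 - sqrt_seq n in IH; have -> : sqrt_seq n = 1 - d by rewrite /d; lra.
have d0 : 0 <= d by rewrite /d; lra.
have d1 : d <= 1 by rewrite /d; lra.
have : 0 <= (2%:R - d * (n%:R + 2%:R)) * (1 - d / 2%:R) by apply: mulr_ge0; lra.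
by nra.
Qed.

Lemma sqrt_seq_lim (e : R) : 0 < e ->
  exists N, forall n, (N <= n)%N -> 1 - sqrt_seq n <= e.
Proof.
move=> e0; exists (Num.truncn (2%:R / e)) => n hn.
have hb : 2%:R / e < n%:R + 1.
  rewrite natr1; apply: lt_le_trans (Num.Theory.truncnS_gt _) _ => //.
  by rewrite ler_nat ltnS.
have := sqrt_seq_gap n; have /andP[h0 h1] := sqrt_seq_bounds n.
rewrite ltr_pdivrMr // in hb.
have n0 : 0 <= n%:R :> R by [].
by nra.
Qed.

End SqrtSequence.

(** * Positive elements and their square roots *)

Section PositiveElements.
Variables (R : realType) (A : cstarAlgType R).
Local Notation U := (unitz A).
Implicit Types (u v w h k p q z : U) (r C : R).

Definition uclosed (Q : U -> Prop) : Prop :=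
  forall v, (forall e : R, 0 < e -> exists2 w, Q w & nu (v - w) <= e) -> Q v.

(** Stands in for functional calculus: what is built from [h] by polynomials and limits lies in
    every such [Q] that contains [h]. Commutants and fixed-point algebras of automorphisms are the
    instances used. *)
Definition usubalg (Q : U -> Prop) : Prop :=
  [/\ uclosed Q, Q 1, forall x y, Q x -> Q y -> Q (x + y),
      forall c x, Q x -> Q (c *: x) & forall x y, Q x -> Q y -> Q (x * y)].

Lemma nu_small u : (forall e : R, 0 < e -> nu u <= e) -> u = 0.
Proof.
move=> h; apply/eqP; rewrite -nu_eq0 eq_le nu_ge0 andbT.
by apply/ler_addgt0Pr => e /h; rewrite add0r.
Qed.

Lemma cm_half : cm (2%:R^-1 : R[i]) = 2%:R^-1.
Proof. by rewrite cmV cnatE cm_real normr_nat. Qed.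

Lemma halfD u : 2%:R^-1 *: u + 2%:R^-1 *: u = u :> U.
Proof.
have h : 2%:R^-1 + 2%:R^-1 = 1 :> R[i] by rewrite [RHS]splitr div1r.
by rewrite -scalerDl h scale1r.
Qed.

Lemma nu_half (u : U) : nu (2%:R^-1 *: u) = nu u / 2%:R.
Proof. by rewrite nuZ cm_half mulrC. Qed.

Lemma subr_sq (x y : U) : x * x - y * y = x * (x - y) + (x - y) * y.
Proof. by rewrite mulrBr mulrBl addrA subrK. Qed.

(** The iteration [v |-> (x + v^2) / 2] from 0 has increments dominated by those of [sqrt_seq], so
    it converges even for [nu x = 1]. Its fixed point makes [1 - y] a square root of [1 - x]. *)
Lemma usqrt (x : U) : nu x <= 1 -> exists y,
  y + y = x + y * y /\
  forall Q, uclosed Q -> Q 0 -> (forall v, Q v -> Q (2%:R^-1 *: (x + v * v))) -> Q y.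
Proof.
move=> x1; pose t := @sqrt_seq R.
pose Y := fix Y n := if n is m.+1 then 2%:R^-1 *: (x + Y m * Y m) else 0 : U.
have Yt n : nu (Y n) <= t n.
  elim: n => [|n IH] /=; first by rewrite nu0.
  rewrite nu_half ler_pM2r ?invr_gt0 ?ltr0n //; apply: le_trans (nuD _ _) _.
  apply: lerD => //; apply: le_trans (nuM _ _) _.
  by rewrite expr2 ler_pM ?nu_ge0.
have YS n : nu (Y n.+1 - Y n) <= t n.+1 - t n.
  elim: n => [|n IH].
    by rewrite !subr0 /= mulr0 addr0 nu_half expr0n addr0 ler_pM2r ?invr_gt0 ?ltr0n.
  have -> : Y n.+2 - Y n.+1 = 2%:R^-1 *: (Y n.+1 * (Y n.+1 - Y n) + (Y n.+1 - Y n) * Y n).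
    by rewrite -subr_sq -scalerBr opprD addrACA subrr add0r.
  have -> : t n.+2 - t n.+1 = (t n.+1 * (t n.+1 - t n) + (t n.+1 - t n) * t n) / 2%:R.
    have -> : t n.+2 - t n.+1 = (1 + t n.+1 ^+ 2) / 2%:R - (1 + t n ^+ 2) / 2%:R by [].
    by field.
  rewrite nu_half ler_pM2r ?invr_gt0 ?ltr0n //; apply: le_trans (nuD _ _) _.
  have h0 : 0 <= t n.+1 - t n by rewrite subr_ge0 sqrt_seqS.
  by apply: lerD; apply: le_trans (nuM _ _) _; rewrite ler_pM ?nu_ge0.
have Ymn m n : (m <= n)%N -> nu (Y n - Y m) <= t n - t m.
  elim: n => [|n IH]; first by rewrite leqn0 => /eqP ->; rewrite !subrr nu0.
  rewrite leq_eqVlt => /predU1P[->|]; first by rewrite !subrr nu0.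
  rewrite ltnS => /IH h; apply: le_trans (nu_triangle (Y n) _ _) _.
  by have := YS n; lra.
pose d n := 1 - t n.
have d0 n : 0 <= d n by have /andP[_] := sqrt_seq_bounds R n; rewrite /d /t; lra.
have [||y hy] := @nu_complete R A Y d.
- move=> m n; have [mn|/ltnW nm] := leqP m n.
    by rewrite nuBC; have := Ymn _ _ mn; have := d0 n; rewrite /d; lra.
  by have := Ymn _ _ nm; have := d0 m; rewrite /d; lra.
- exact: sqrt_seq_lim.
have yd (e : R) : 0 < e -> exists2 n, nu (y - Y n) <= e & nu (y - Y n.+1) <= e.
  move=> e0; have [N hN] := sqrt_seq_lim (divr_gt0 e0 (ltr0n R 4)).
  have := hN N (leqnn _); have := hN _ (leqnSn N) => h1 h2.
  by exists N; apply: le_trans (hy _) _; rewrite /d /t; lra.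
exists y; split.
  apply: subr0_eq; apply: nu_small => e e0.
  have y0 := nu_ge0 y.
  pose K := 3%:R + nu y; have K0 : 0 < K by rewrite /K; lra.
  have [n h1 h2] := yd (e / K) (divr_gt0 e0 K0).
  have -> : y + y - (x + y * y) = (y - Y n.+1) + (y - Y n.+1) - (y * y - Y n * Y n).
    rewrite addrACA -opprD [Y n.+1 + _]halfD -!addrA; congr (_ + (_ + _)).
    by rewrite -opprD -addrA; congr (- (_ + _)); rewrite addrC subrK.
  apply: le_trans (nuB _ _) _; rewrite subr_sq.
  have h3 := nuD (y - Y n.+1) (y - Y n.+1).
  have h4 := nuD (y * (y - Y n)) ((y - Y n) * Y n).
  have h5 : nu (y * (y - Y n)) <= nu y * (e / K).
    by apply: le_trans (nuM _ _) _; rewrite ler_wpM2l.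
  have h6 : nu ((y - Y n) * Y n) <= e / K.
    apply: le_trans (nuM _ _) _; rewrite -[leRHS]mulr1 ler_pM ?nu_ge0 //.
    by apply: le_trans (Yt n) _; have /andP[] := sqrt_seq_bounds R n.
  have : K * (e / K) = e by rewrite mulrCA divff ?mulr1 // gt_eqF.
  rewrite {1}/K; lra.
move=> Q Qc Q0 QS; apply: Qc => e /yd[n h _]; exists (Y n) => //.
by elim: n {h} => //= n IH; exact: QS.
Qed.

Lemma uclosed_eq (f g : U -> U) (K : R) :
  (forall x y, nu (f x - f y) <= K * nu (x - y)) ->
  (forall x y, nu (g x - g y) <= K * nu (x - y)) -> uclosed (fun v => f v = g v).
Proof.
move=> hf hg v hv; apply: subr0_eq; apply: nu_small => e e0.
pose L := 2%:R * `|K| + 1; have K0 : 0 <= `|K| by []. 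
have L0 : 0 < L by rewrite /L; lra.
have [w fg vw] := hv (e / L) (divr_gt0 e0 L0).
have -> : f v - g v = (f v - f w) - (g v - g w) by rewrite fg opprB addrA subrK.
apply: le_trans (nuB _ _) _; have := hf v w; have := hg v w.
have h : K * nu (v - w) <= `|K| * (e / L).
  by apply: le_trans (ler_wpM2r (nu_ge0 _) (ler_norm K)) _; rewrite ler_wpM2l.
have : L * (e / L) = e by rewrite mulrCA divff ?mulr1 // gt_eqF.
rewrite {1}/L; have : 0 < e / L by rewrite divr_gt0.
lra.
Qed.

Lemma usubalg_comm v : usubalg (fun y => v * y = y * v).
Proof.
split.
- apply: (@uclosed_eq (fun y => v * y) (fun y => y * v) (nu v)) => x y.
    by rewrite -mulrBr nuM.
  by rewrite -mulrBl mulrC nuM.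
- by rewrite mul1r mulr1.
- by move=> x y hx hy; rewrite mulrDl mulrDr hx hy.
- by move=> c x hx; rewrite -scalerAr -scalerAl hx.
- by move=> x y hx hy; rewrite mulrA hx -mulrA hy mulrA.
Qed.

Definition rs r : U := r%:C *: 1.

Lemma rsD r C : rs (r + C) = rs r + rs C.
Proof. by rewrite /rs rmorphD scalerDl. Qed.

Lemma rsB r C : rs (r - C) = rs r - rs C.
Proof. by rewrite /rs rmorphB scalerBl. Qed.

Lemma rsM r u : rs r * u = r%:C *: u.
Proof. by rewrite /rs -scalerAl mul1r. Qed.

Lemma rsMr r u : u * rs r = r%:C *: u.
Proof. by rewrite /rs -scalerAr mulr1. Qed.

Lemma rsC r u : rs r * u = u * rs r.
Proof. by rewrite rsM rsMr. Qed.

Lemma nu_rs r : nu (rs r) = `|r|.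
Proof. by rewrite /rs nuZ nu1 mulr1 cm_real. Qed.

Lemma rs1 : rs 1 = 1. Proof. exact: scale1r. Qed.

Lemma rs0 : rs 0 = 0. Proof. exact: scale0r. Qed.

Lemma nu_rZ r u : nu (r%:C *: u) = `|r| * nu u.
Proof. by rewrite nuZ cm_real. Qed.

Definition sa u : Prop := ustar u = u.

Lemma saD u v : sa u -> sa v -> sa (u + v).
Proof. by rewrite /sa ustarD => -> ->. Qed.

Lemma saN u : sa u -> sa (- u).
Proof. by rewrite /sa ustarN => ->. Qed.

Lemma saB u v : sa u -> sa v -> sa (u - v).
Proof. by move=> hu hv; apply/saD/saN. Qed.

Lemma saZ r u : sa u -> sa (r%:C *: u).
Proof. by rewrite /sa ustarZ conj_realC => ->. Qed.

Lemma sa1 : sa 1. Proof. exact: ustar1. Qed.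

Lemma sa_rs r : sa (rs r). Proof. exact/saZ/sa1. Qed.

Lemma saM u v : sa u -> sa v -> u * v = v * u -> sa (u * v).
Proof. by rewrite /sa ustarM => -> ->. Qed.

Lemma half_realC : (2%:R^-1 : R[i]) = (2%:R^-1 : R)%:C.
Proof. by rewrite fmorphV /= rmorph_nat. Qed.

(** Positivity without a spectrum: for self-adjoint [h] the inequality says that the spectrum lies
    in [[0, 2 C]]. In this form sums of positive elements are visibly positive. *)
Definition pos h : Prop := sa h /\ exists C, nu (rs C - h) <= C.

Lemma pos_wit h : pos h -> exists C, [/\ 0 < C, nu h <= C + C & nu (rs C - h) <= C].
Proof.
move=> [_ [C hC]]; have C0 : 0 <= C by apply: le_trans hC; exact: nu_ge0.
have hC1 : nu (rs (C + 1) - h) <= C + 1.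
  rewrite rsD addrAC; apply: le_trans (nuD _ _) _.
  by rewrite nu_rs normr1 lerD2r.
exists (C + 1); split=> //; first lra.
rewrite -(subKr (rs (C + 1)) h); apply: le_trans (nuB _ _) _.
by rewrite nu_rs ger0_norm; lra.
Qed.

Lemma pos_sa h : pos h -> sa h. Proof. by case. Qed.

Lemma posZ r h : 0 <= r -> pos h -> pos (r%:C *: h).
Proof.
move=> r0 [hs [C hC]]; split; first exact: saZ.
exists (r * C); rewrite /rs rmorphM -scalerA -scalerBr nu_rZ ger0_norm //.
by rewrite ler_wpM2l.
Qed.

Lemma posD p q : pos p -> pos q -> pos (p + q).
Proof.
move=> [ps [C hC]] [qs [D hD]]; split; first exact: saD.
exists (C + D); rewrite rsD opprD addrACA; apply: le_trans (nuD _ _) _.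
exact: lerD.
Qed.

Lemma pos0 : pos 0.
Proof. by split; [rewrite /sa -(scale0r (1 : U)) ustarZ rmorph0 !scale0r|exists 0; rewrite rs0 subr0 nu0]. Qed.

(* [1 - (1 - k)]: the fixed point [y] of the iteration at [1 - h] gives [(1 - y)^2 = h]. *)
Lemma pos_sqrt h : pos h ->
  exists k, [/\ k * k = h, pos k & forall Q, usubalg Q -> Q h -> Q k].
Proof.
move=> ph; have [C [C0 _ hC]] := pos_wit ph; have hs := pos_sa ph.
pose g := C^-1%:C *: h; have Ci0 : 0 < C^-1 by rewrite invr_gt0.
have CC : C * C^-1 = 1 by rewrite divff // gt_eqF.
have hg : h = C%:C *: g by rewrite /g scalerA -rmorphM CC scale1r.
have g1 : nu (1 - g) <= 1.
  have -> : 1 - g = C^-1%:C *: (rs C - h).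
    by rewrite scalerBr /rs scalerA -rmorphM mulrC CC scale1r.
  by rewrite nu_rZ gtr0_norm // ler_pdivrMl // mulr1.
have [y [hy Qy]] := usqrt g1.
have yy : (1 - y) * (1 - y) = g.
  have -> : (1 - y) * (1 - y) = 1 - (y + y) + y * y.
    rewrite mulrBr mulr1 mulrBl mul1r opprB opprD -!addrA; congr (_ + (_ + _)).
    exact: addrC.
  by rewrite hy opprD addrA subrK subKr.
have sy : sa y.
  apply: Qy => [|| v hv].
  - apply: (@uclosed_eq (@ustar R A) id 1) => a b; rewrite mul1r //.
    by rewrite -ustarB nu_star.
  - by case: pos0.
  - rewrite half_realC; apply/saZ/saD; last exact: saM.
    by apply/saB/saZ => //; exact: sa1.
have ny : nu y <= 1.
  apply: (Qy (fun v => nu v <= 1)) => [v hv||v hv].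
  - apply/ler_addgt0Pr => e e0; have [w w1 vw] := hv e e0.
    rewrite -(subrK w v); apply: le_trans (nuD _ _) _; lra.
  - by rewrite nu0.
  - rewrite nu_half; have := nuD (1 - g) (v * v); have := nuM v v.
    by have := nu_ge0 v; nra.
pose c := Num.sqrt C; have c0 : 0 <= c by rewrite sqrtr_ge0.
have cc : c * c = C by rewrite -expr2 sqr_sqrtr // ltW.
exists (c%:C *: (1 - y)); split.
- by rewrite -scalerAl -scalerAr scalerA -rmorphM cc yy -hg.
- apply: posZ => //; split; first by apply: saB => //; exact: sa1.
  by exists 1; rewrite rs1 subKr.
- move=> Q [Qc Q1 QD QZ QM] Qh; apply: (QZ).
  have QN v : Q v -> Q (- v) by rewrite -scaleN1r; exact: QZ.
  apply: (QD) => //; apply: (QN); apply: (Qy) => // [|v Qv].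
    by rewrite -(scale0r 1); exact: QZ.
  by apply: (QZ); apply: (QD); [apply: (QD) => //; apply/QN/QZ|exact: QM].
Qed.

Lemma conj_i : ('i%C : R[i])^* = - 'i%C.
Proof. by rewrite complexiE conjCi. Qed.

Lemma mul_ii : 'i%C * 'i%C = - 1 :> R[i].
Proof. by rewrite -expr2 sqr_i. Qed.

(* With [w = z + i k] one has [w^* w = c], and [z] is the real part of [w]. *)
Lemma sq_sum_le z k r :
  sa z -> sa k -> z * k = k * z -> z * z + k * k = rs r -> nu z ^+ 2 <= r.
Proof.
move=> zs ks zk zzkk; pose w := z + 'i%C *: k.
have ws : ustar w = z - 'i%C *: k.
  by rewrite ustarD ustarZ conj_i zs ks scaleNr.
have ww : ustar w * w = rs r.
  rewrite ws -zzkk mulrDr !mulrBl -!scalerAr -!scalerAl zk scalerA.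
  by rewrite mul_ii scaleN1r opprK addrA subrK.
have : nu z <= nu w.
  have -> : z = 2%:R^-1 *: (w + ustar w).
    by rewrite ws /w addrACA subrr addr0 scalerDr halfD.
  rewrite nu_half; have := nuD w (ustar w); rewrite nu_star; lra.
rewrite -(@ler_pXn2r _ 2) ?nnegrE ?nu_ge0 // => /le_trans; apply.
rewrite -nu_cstar ww nu_rs ger0_norm //.
have : 0 <= nu (ustar w * w) by exact: nu_ge0.
have := nu_cstar w; rewrite ww nu_rs => hw _.
rewrite leNgt; apply/negP => r0.
have : (ustar w * w).1 = r%:C by rewrite ww; exact: mulr1.
rewrite /= -cm_conjM => /complexI h; have := sqr_ge0 (cm w.1); lra.
Qed.

(** [C - h^2] is positive with [C] itself as the constant in [pos], so it has a root [k], which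
    commutes with [h]; then [k^2 + h^2 = C] bounds [k] by [sq_sum_le]. *)
Lemma pos_sq_bound h C : sa h -> nu h ^+ 2 <= C -> nu (rs C - h * h) <= C.
Proof.
move=> hs hC; have hhs : sa (h * h) by exact: saM.
have [k [kk kp kQ]] : exists k, [/\ k * k = rs C - h * h, pos k &
    forall Q, usubalg Q -> Q (rs C - h * h) -> Q k].
  apply: pos_sqrt; split; first by apply: saB => //; exact: sa_rs.
  by exists C; rewrite subKr; apply: le_trans (nuM _ _) _; rewrite -expr2.
have hk : h * k = k * h.
  apply: (kQ _ (usubalg_comm h)).
  by rewrite mulrBr mulrBl -rsC mulrA.
have := @sq_sum_le k h C (pos_sa kp) hs (esym hk); rewrite kk subrK => /(_ erefl).
by move=> hk2; apply: le_trans hk2; rewrite -kk expr2 nuM.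
Qed.

Lemma pos_sq h : sa h -> pos (h * h).
Proof.
by move=> hs; split; [exact: saM|exists (nu h ^+ 2); exact: pos_sq_bound].
Qed.

Lemma pos_cap h C : sa h -> nu h <= C -> pos (rs C - h).
Proof.
move=> hs hC; split; first by apply: saB => //; exact: sa_rs.
by exists C; rewrite subKr.
Qed.

(** With commuting self-adjoint roots, [p = z^2] and [C - p = k^2], the order bound becomes a norm
    bound by [sq_sum_le]. *)
Lemma pos_leP p C : pos p -> pos (rs C - p) -> nu p <= C.
Proof.
move=> pp pC; have [z [zz zp zQ]] := pos_sqrt pp.
have [k [kk kp kQ]] := pos_sqrt pC.
have zk : z * k = k * z.
  apply: (kQ _ (usubalg_comm z)); rewrite mulrBr mulrBl -rsC; congr (_ - _).
  by rewrite -zz mulrA.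
have := @sq_sum_le z k C (pos_sa zp) (pos_sa kp) zk.
rewrite zz kk addrCA subrr addr0 => /(_ erefl); apply: le_trans.
by rewrite -zz expr2 nuM.
Qed.

Lemma pos_mono p q : pos p -> pos q -> nu p <= nu (p + q).
Proof.
move=> pp pq; apply: pos_leP => //.
have -> : rs (nu (p + q)) - p = rs (nu (p + q)) - (p + q) + q.
  by rewrite opprD addrA subrK.
apply: posD => //.
by apply: pos_cap => //; exact/pos_sa/posD.
Qed.

Lemma pos_bound p C : pos p -> nu p <= C -> nu (rs C - p) <= C.
Proof.
move=> pp pC; have [z [zz zp _]] := pos_sqrt pp; rewrite -zz.
apply: pos_sq_bound (pos_sa zp) _; rewrite -nu_cstar (pos_sa zp) zz //.
Qed.

Lemma pos_comm p q : pos p -> pos q -> p * q = q * p -> pos (p * q).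
Proof.
move=> pp pq pqC; have [z [zz zp zQ]] := pos_sqrt pp.
have [k [kk kp kQ]] := pos_sqrt pq.
have zq : q * z = z * q by apply: (zQ _ (usubalg_comm q)).
have kz : z * k = k * z by apply: (kQ _ (usubalg_comm z)).
have -> : p * q = (z * k) * (z * k) by rewrite -(mulrA z) (mulrA k z) -kz -(mulrA z k) kk mulrA zz.
by apply: pos_sq; apply: saM => //; exact: pos_sa.
Qed.

End PositiveElements.

Lemma expr_small (R : realType) (t e : R) : 0 <= t < 1 -> 0 < e ->
  exists N, forall n, (N <= n)%N -> t ^+ n <= e.
Proof.
move=> /andP[t0 t1] e0.
have : (GRing.exp t : R^nat) @ \oo --> (0 : R) by apply: cvg_expr; rewrite ger0_norm.
move=> /cvgrPdist_le/(_ e e0)[N _ hN]; exists N => n /hN.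
by rewrite sub0r normrN ger0_norm // exprn_ge0.
Qed.

(** * Inverses, and positivity of [ustar x * x] *)

Section Inverses.
Variables (R : realType) (A : cstarAlgType R).
Local Notation U := (unitz A).
Implicit Types (u v w h k p q x y z g : U) (r C : R).

Definition uinv u v : Prop := u * v = 1 /\ v * u = 1.

Lemma uinv_comm u g v : uinv u g -> u * v = v * u -> g * v = v * g.
Proof.
move=> [ug gu] uv.
by rewrite -[LHS]mulr1 -ug -mulrA (mulrA v) -uv -(mulrA u) mulrA gu mul1r.
Qed.

Lemma uinv_sa u g : uinv u g -> sa u -> sa g.
Proof.
move=> [ug gu] us; rewrite /sa -[LHS]mul1r -gu -mulrA -{1}us -ustarM gu ustar1.
by rewrite mulr1.
Qed.

Lemma neumann w : nu w < 1 -> exists v, uinv (1 - w) v.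
Proof.
set t := nu w => t1; have t0 : 0 <= t by exact: nu_ge0.
have c0 : 0 < 1 - t by lra.
pose s := fix s n := if n is m.+1 then 1 + w * s m else 0 : U.
have sb n : nu (s n) <= (1 - t)^-1.
  elim: n => [|n IH] /=; first by rewrite nu0 invr_ge0 ltW.
  apply: le_trans (nuD _ _) _; rewrite nu1.
  have := nuM w (s n); rewrite -/t.
  have : t * nu (s n) <= t * (1 - t)^-1 by rewrite ler_wpM2l.
  have : (1 - t) * (1 - t)^-1 = 1 by rewrite mulfV // gt_eqF.
  rewrite mulrBl mul1r; lra.
have sd (m k : nat) : nu (s (m + k)%N - s m) <= t ^+ m * (1 - t)^-1.
  elim: m => [|m IH]; first by rewrite subr0 add0n mul1r.
  rewrite addSn /= opprD addrACA subrr add0r -mulrBr exprS -mulrA.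
  by apply: le_trans (nuM _ _) _; rewrite ler_wpM2l.
pose d n := t ^+ n * (1 - t)^-1.
have d0 n : 0 <= d n by rewrite mulr_ge0 ?exprn_ge0 // invr_ge0 ltW.
have dlim (e : R) : 0 < e -> exists N, forall n, (N <= n)%N -> d n <= e.
  move=> e0; have [||N hN] := @expr_small R t (e * (1 - t)).
  - by rewrite t0.
  - exact: mulr_gt0.
  by exists N => n /hN; rewrite /d ler_pdivrMr.
have [||v hv] := @nu_complete R A s d => //.
  move=> m n; have [mn|/ltnW nm] := leqP m n.
    by rewrite nuBC -(subnKC mn); apply: le_trans (sd _ _) _; rewrite lerDl.
  by rewrite -(subnKC nm); apply: le_trans (sd _ _) _; rewrite lerDr.
have hlim (e : R) : 0 < e ->
    exists n, nu (v - s n) <= e /\ nu (v - s n.+1) <= e.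
  move=> e0; have [N hN] := dlim _ (divr_gt0 e0 (ltr0n R 4)).
  have := hN N (leqnn _); have := hN _ (leqnSn N).
  by exists N; split; apply: le_trans (hv _) _; lra.
have wv : w * v = v * w.
  have [cl c1 cD cZ cM] := usubalg_comm w.
  apply: cl => e /hlim[n [hn _]]; exists (s n) => //.
  elim: n {hn} => [|n IH] /=; first by rewrite mulr0 mul0r.
  by apply: cD => //; apply: cM.
have fix_v : v = 1 + w * v.
  apply: subr0_eq; apply: nu_small => e e0.
  have [n [h1 h2]] := hlim _ (divr_gt0 e0 (ltr0n R 2)).
  have -> : v - (1 + w * v) = (v - s n.+1) - w * (v - s n).
    by rewrite mulrBr /= opprB !opprD !addrA subrK.
  apply: le_trans (nuB _ _) _; have := nuM w (v - s n); rewrite -/t.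
  have : t * nu (v - s n) <= 1 * nu (v - s n) by rewrite ler_wpM2r ?nu_ge0 // ltW.
  lra.
exists v; have h1 : (1 - w) * v = 1 by rewrite mulrBl mul1r {1}fix_v addrK.
by split=> //; rewrite mulrBr mulr1 -wv -[X in X - _]mul1r -mulrBl.
Qed.

Lemma uinvZ (c : R[i]) u v : c != 0 -> uinv u v -> uinv (c *: u) (c^-1 *: v).
Proof.
by move=> c0 [uv vu]; split; rewrite -scalerAl -scalerAr scalerA ?mulfV ?mulVf // scale1r.
Qed.

(** If [D] witnesses the positivity of [h], then [C + h = (C + D)(1 - w)] with
    [w = (D - h) / (C + D)] of norm at most [D / (C + D) < 1]. *)
Lemma uinv_pos C h : 0 < C -> pos h -> exists g, uinv (rs A C + h) g.
Proof.
move=> C0 ph; have [D [D0 _ hD]] := pos_wit ph.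
have CD : 0 < C + D by lra.
have CD1 : (C + D) * (C + D)^-1 = 1 by rewrite mulfV // gt_eqF.
pose w := (C + D)^-1%:C *: (rs A D - h).
have [|v hv] := @neumann w.
  rewrite /w nu_rZ ger0_norm ?invr_ge0 ?ltW // ltr_pdivrMl // mulr1.
  by apply: le_lt_trans hD _; lra.
exists ((C + D)%:C^-1 *: v).
have -> : rs A C + h = (C + D)%:C *: (1 - w).
  rewrite scalerBr /w scalerA -rmorphM CD1 scale1r -/(rs A _) rsD.
  by rewrite opprB addrA addrAC addrK.
by apply: uinvZ => //; rewrite fmorph_eq0 gt_eqF.
Qed.

Lemma pos_uinv u g : pos u -> uinv u g -> pos g.
Proof.
move=> pu ug; have [k [kk kp kQ]] := pos_sqrt pu.
have gk : g * k = k * g.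
  by apply: (uinv_comm ug); rewrite -kk mulrA.
have -> : g = (g * k) * (g * k).
  by rewrite mulrA -(mulrA g k g) -gk mulrA -mulrA kk -mulrA (proj2 ug) mulr1.
by apply/pos_sq/saM => //; [exact: uinv_sa ug (pos_sa pu)|exact: pos_sa].
Qed.

(** For [b] the adjoint [a'] of [a], this writes [2 (a a' + a' a)] as the sum of the squares of the
    self-adjoint elements [a + a'] and [i (a - a')]. *)
Lemma polarization (a b : U) :
  (a + b) * (a + b) - (a - b) * (a - b) = a * (b + b) + (b + b) * a.
Proof.
have e : a + b - (a - b) = b + b by rewrite opprB addrC addrA subrK.
rewrite subr_sq e mulrDl [_ * (a - b)]mulrBr -addrA; congr (_ + _).
have -> : b * (b + b) = (b + b) * b by rewrite mulrDl mulrDr.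
by rewrite addrC subrK.
Qed.

Lemma sa_nu_sq z : sa z -> nu (z * z) = nu z ^+ 2.
Proof. by move=> zs; rewrite -nu_cstar zs. Qed.

(** If [g] inverts [1 - z^2] and [C > nu g], then [(1 - z^2)(C - g) = C (1 - z^2) - 1] is positive,
    so [z^2 <= 1 - 1/C], against [nu (z^2) = 1]. *)
Lemma norm_in_spectrum z g : sa z -> nu z = 1 -> ~ uinv (1 - z * z) g.
Proof.
move=> zs z1 hg.
have zz1 : nu (z * z) = 1 by rewrite sa_nu_sq // z1 expr1n.
have pz : pos (1 - z * z).
  by rewrite -(rs1 A); apply: pos_cap; [exact/pos_sa/pos_sq|rewrite zz1].
have pg := pos_uinv pz hg.
pose C := nu g + 1; have C0 : 0 < C by have := nu_ge0 g; rewrite /C; lra.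
have pC : pos (rs A C - g) by apply: pos_cap; [exact: pos_sa|rewrite /C lerDl].
have : pos ((1 - z * z) * (rs A C - g)).
  by apply: pos_comm => //; rewrite [LHS]mulrBr [RHS]mulrBl -rsC (proj1 hg) (proj2 hg).
rewrite mulrBr rsMr (proj1 hg) => pp.
have : nu (z * z) <= 1 - C^-1.
  apply: pos_leP; first exact: pos_sq.
  have -> : rs A (1 - C^-1) - z * z = C^-1%:C *: (C%:C *: (1 - z * z) - 1).
    rewrite scalerBr scalerA -rmorphM mulVf ?gt_eqF // scale1r rsB rs1.
    by rewrite addrAC.
  by apply: posZ => //; rewrite invr_ge0 ltW.
have Ci : 0 < C^-1 by rewrite invr_gt0.
by rewrite zz1; lra.
Qed.

(** For [t != 0] these two products say that [(1 - y g x) / t] inverts [t + y x]: the nonzero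
    spectra of [x y] and [y x] agree. *)
Lemma uinv_swap t x y g : uinv (rs A t + x * y) g ->
  (rs A t + y * x) * (y * g * x) = y * x /\ (y * g * x) * (rs A t + y * x) = y * x.
Proof.
move=> [hg gh].
have h1 : (rs A t + y * x) * y = y * (rs A t + x * y).
  by rewrite mulrDl mulrDr rsC mulrA.
have h2 : x * (rs A t + y * x) = (rs A t + x * y) * x.
  by rewrite mulrDl mulrDr rsC mulrA.
split.
  by rewrite mulrA (mulrA _ y g) h1 -(mulrA y) hg mulr1.
by rewrite -mulrA h2 mulrA -(mulrA y g) gh mulr1.
Qed.

Lemma sa_sq_eq0 q : sa q -> q * q = 0 -> q = 0.
Proof.
move=> qs qq; apply/eqP; rewrite -nu_eq0 -sqrf_eq0 -sa_nu_sq // qq nu0 //.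
Qed.

(* If the negative part of [x^* x] were nonzero, [y := x (|p| - p)] would have
   [y^* y <= 0], hence [y y^* >= 0], although the two have the same nonzero
   spectrum. *)
Lemma pos_star_mul x : pos (ustar x * x).
Proof.
set p := ustar x * x; have ps : sa p by rewrite /sa ustarM ustarK.
have [m [mm mp mQ]] := pos_sqrt (pos_sq ps).
have pm : p * m = m * p by apply: (mQ _ (usubalg_comm p)); rewrite mulrA.
have [s [ss sp sQ]] := pos_sqrt mp.
pose q := m - p; have qs : sa q by apply: saB => //; exact: pos_sa.
have mq : m * q = q * m by rewrite mulrBr mulrBl pm.
have sq : q * s = s * q by apply: (sQ _ (usubalg_comm q)).
have pq : p * q = - (m * q) by rewrite mulrBr -mm pm mulrBr opprB mm.
pose y := x * q; pose k := s * q.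
have ks : sa k by apply: saM => //; exact: pos_sa.
have yy : ustar y * y = - (k * k).
  rewrite ustarM qs -mulrA (mulrA _ x q) -/p pq mulrN; congr (- _).
  have -> : k * k = m * (q * q).
    by rewrite /k -mulrA (mulrA q s q) sq -(mulrA s q q) mulrA ss.
  by rewrite (mulrA q m q) -mq -mulrA.
have pyy : pos (y * ustar y).
  have -> : y * ustar y = (2%:R^-1 : R)%:C *: ((y + ustar y) * (y + ustar y)
      + ('i%C *: (y - ustar y)) * ('i%C *: (y - ustar y)) + (k * k + k * k)).
    have -> : k * k = - (ustar y * y) by rewrite yy opprK.
    rewrite -scalerAl -scalerAr scalerA mul_ii scaleN1r.
    rewrite polarization mulrDr mulrDl.
    by rewrite -opprD addrK scalerDr -half_realC halfD.
  apply: posZ; first by rewrite invr_ge0.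
  apply: posD; last by apply: posD; exact: pos_sq.
  apply: posD; apply: pos_sq; first by rewrite /sa ustarD ustarK addrC.
  by rewrite /sa ustarZ conj_i ustarB ustarK scaleNr -scalerN opprB.
(* Otherwise take [t = nu k ^+ 2]. As [y y^*] is positive, [t + y y^*] is invertible, hence so is
   [t + y^* y = t - k^2]; this is impossible since [k / nu k] is self-adjoint of norm 1. *)
have k0 : k = 0.
  apply/eqP; rewrite -nu_eq0; apply: contraT => k0.
  have kp : 0 < nu k by rewrite lt0r k0 nu_ge0.
  pose t := nu k ^+ 2; have t0 : 0 < t by rewrite exprn_gt0.
  have [g [hg gh]] := uinv_pos t0 pyy.
  have hinv : uinv (rs A t - k * k) (t^-1%:C *: (1 - ustar y * g * y)).
    have hD : rs A t - k * k = rs A t + ustar y * y by rewrite yy.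
    have tt : t^-1%:C *: rs A t = 1.
      by rewrite /rs scalerA -rmorphM mulVf ?gt_eqF // scale1r.
    rewrite hD; split; rewrite -?scalerAl -?scalerAr -[RHS]tt; congr (_ *: _).
      rewrite mulrBr mulr1; apply/eqP; rewrite subr_eq; apply/eqP; congr (_ + _).
      by rewrite (proj1 (uinv_swap (conj hg gh))).
    rewrite mulrBl mul1r; apply/eqP; rewrite subr_eq; apply/eqP; congr (_ + _).
    by rewrite (proj2 (uinv_swap (conj hg gh))).
  pose z := (nu k)^-1%:C *: k.
  have zs : sa z by exact: saZ.
  have z1 : nu z = 1.
    by rewrite nu_rZ ger0_norm ?invr_ge0 ?nu_ge0 // mulVf.
  have := uinvZ (_ : t^-1%:C != 0) hinv.
  rewrite fmorph_eq0 invr_eq0 (gt_eqF t0) => /(_ isT) h.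
  exfalso; apply: (norm_in_spectrum zs z1 (g := _)).
  have -> : 1 - z * z = t^-1%:C *: (rs A t - k * k); last exact: h.
  rewrite scalerBr /rs scalerA -rmorphM mulVf ?gt_eqF // scale1r.
  by rewrite /z -scalerAl -scalerAr scalerA -rmorphM -expr2 exprVn.
have y0 : y = 0.
  apply/eqP; rewrite -nu_eq0 -sqrf_eq0 -nu_cstar yy k0 mul0r oppr0 nu0 //.
have q0 : q = 0.
  apply: sa_sq_eq0 => //; have pq0 : p * q = 0 by rewrite /p -mulrA -/y y0 mulr0.
  have mq0 : m * q = 0 by rewrite -[m * q]opprK -pq pq0 oppr0.
  by rewrite {1}/q mulrBl pq0 mq0 subrr.
by rewrite -[p](subKr m) -/q q0 subr0.
Qed.

Lemma nu_sq_le x p : pos p -> nu x ^+ 2 <= nu (ustar x * x + p).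
Proof. by move=> pp; rewrite -nu_cstar; apply: pos_mono => //; exact: pos_star_mul. Qed.

(* [C^-1 b <= 1] in the form of the contraction [C (C + b)^-1]. *)
Lemma cutoff C b g : 0 < C -> pos b -> uinv (rs A C + b) g ->
  [/\ pos g, g * b = b * g, C%:C *: g = 1 - b * g, nu (C%:C *: g) <= 1
    & nu ((C%:C *: g) * b * (C%:C *: g)) <= C].
Proof.
move=> C0 pb hg.
have pCb : pos (rs A C + b).
  apply: posD => //; rewrite -(addr0 (rs A C)) -(oppr0); apply: pos_cap; last by rewrite nu0 ltW.
  by case: (pos0 A).
have pg := pos_uinv pCb hg.
have gb : g * b = b * g.
  by apply: (uinv_comm hg); rewrite mulrDl mulrDr rsC.
have Cg : C%:C *: g = 1 - b * g.
  by rewrite -(proj1 hg) mulrDl rsM addrK.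
have pbg : pos (b * g) by apply: pos_comm.
have pCg : pos (C%:C *: g) by apply: posZ => //; exact: ltW.
have n1 : nu (C%:C *: g) <= 1.
  by rewrite -(nu1 A) -(subrK (b * g) 1) -Cg; exact: pos_mono.
have n2 : nu (b * g) <= 1.
  by rewrite -(nu1 A) -(subrK (b * g) 1) -Cg addrC; exact: pos_mono.
split=> //.
have -> : (C%:C *: g) * b * (C%:C *: g) = C%:C *: ((C%:C *: g) * (b * g)).
  by rewrite -!scalerAl -!scalerAr mulrA.
rewrite nu_rZ gtr0_norm // -[leRHS]mulr1; apply: ler_wpM2l; first exact: ltW.
by apply: le_trans (nuM _ _) _; rewrite -[leRHS]mulr1 ler_pM ?nu_ge0.
Qed.

End Inverses.

(** * Automorphisms are isometric and extend to the unitization *)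

Section Automorphisms.
Variables (R : realType) (A : cstarAlgType R).
Local Notation U := (unitz A).
Implicit Types (f : starAut A) (a b : A) (u v : U).

Lemma sautD f a b : f (a + b) = f a + f b.
Proof. by case: (starAutP f) => _ l _ _; have := l 1 a b; rewrite !scale1r. Qed.

Lemma saut0 f : f 0 = 0.
Proof. by apply: (addrI (f 0)); rewrite -sautD !addr0. Qed.

Lemma sautZ f (k : R[i]) a : f (k *: a) = k *: f a.
Proof. by case: (starAutP f) => _ l _ _; have := l k a 0; rewrite saut0 !addr0. Qed.

Lemma sautN f a : f (- a) = - f a.
Proof. by apply: (addrI (f a)); rewrite -sautD !subrr saut0. Qed.

Lemma sautB f a b : f (a - b) = f a - f b.
Proof. by rewrite sautD sautN. Qed.

Lemma sautM f a b : f (a * b)%g = (f a * f b)%g.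
Proof. by case: (starAutP f). Qed.

Lemma saut_star f a : f (star a) = star (f a).
Proof. by case: (starAutP f). Qed.

Lemma saut_sum f I (s : seq I) (P : pred I) (F : I -> A) :
  f (\sum_(i <- s | P i) F i) = \sum_(i <- s | P i) f (F i).
Proof. by elim/big_rec2: _ => [|i y1 y2 _ <-]; rewrite ?saut0 ?sautD. Qed.

Lemma saut_mulE f (g : starAut A) a : (f * g)%g a = f (g a). Proof. by []. Qed.

Lemma saut_VK f a : (f^-1)%g (f a) = a.
Proof. by rewrite -saut_mulE mulVg. Qed.

Lemma saut_KV f a : f ((f^-1)%g a) = a.
Proof. by rewrite -saut_mulE mulgV. Qed.

Definition uext f u : U := (u.1, f u.2).

Lemma uextD f u v : uext f (u + v) = uext f u + uext f v.
Proof. by congr pair; exact: sautD. Qed.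

Lemma uextM f u v : uext f (u * v) = uext f u * uext f v.
Proof. by congr pair; rewrite /= !sautD !sautZ sautM. Qed.

Lemma uextZ f (k : R[i]) u : uext f (k *: u) = k *: uext f u.
Proof. by congr pair; exact: sautZ. Qed.

Lemma uext1 f : uext f 1 = 1.
Proof. by congr pair; exact: saut0. Qed.

Lemma uextB f u v : uext f (u - v) = uext f u - uext f v.
Proof. by congr pair; exact: sautB. Qed.

Lemma uext_star f u : uext f (ustar u) = ustar (uext f u).
Proof. by congr pair; exact: saut_star. Qed.

Lemma uext_in f a : uext f (uin a) = uin (f a). Proof. by []. Qed.

(** For self-adjoint [h], the identity [h^2 + k^2 = nu h ^+ 2] with commuting [k] is preserved by
    [f], and [sq_sum_le] then bounds the image of [h]. The general case follows from the
    C*-identity. *)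
Lemma nu_uext_le f u : nu (uext f u) <= nu u.
Proof.
rewrite -(@ler_pXn2r _ 2) ?nnegrE ?nu_ge0 // -!nu_cstar -uext_star -uextM.
have : sa (ustar u * u) by rewrite /sa ustarM ustarK.
move: (ustar u * u) => h hs; rewrite -(@ler_pXn2r _ 2) ?nnegrE ?nu_ge0 //.
have [k [kk kp kQ]] : exists k, [/\ k * k = rs A (nu h ^+ 2) - h * h, pos k &
    forall Q, usubalg Q -> Q (rs A (nu h ^+ 2) - h * h) -> Q k].
  apply: pos_sqrt; apply: pos_cap; first exact: saM.
  by rewrite -sa_nu_sq.
have hk : h * k = k * h.
  by apply: (kQ _ (usubalg_comm h)); rewrite mulrBr mulrBl -rsC mulrA.
apply: (@sq_sum_le _ _ _ (uext f k)).
- by rewrite /sa -uext_star hs.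
- by rewrite /sa -uext_star (pos_sa kp).
- by rewrite -!uextM hk.
- by rewrite -!uextM -uextD kk addrC subrK uextZ uext1.
Qed.

Lemma saut_VE f u : uext (f^-1)%g (uext f u) = u.
Proof. by case: u => k a; rewrite /uext /= saut_VK. Qed.

Lemma nu_uext f u : nu (uext f u) = nu u.
Proof. by apply/le_anti; rewrite nu_uext_le -{1}(saut_VE f u) nu_uext_le. Qed.

Lemma nm_saut f a : nm (f a) = nm a.
Proof. by rewrite -!nu_uin -uext_in nu_uext. Qed.

Lemma usubalg_fix f : usubalg (fun u => uext f u = u).
Proof.
split.
- apply: (@uclosed_eq _ _ (uext f) id 1) => x y; rewrite mul1r //.
  by rewrite -uextB nu_uext.
- exact: uext1.
- by move=> x y hx hy; rewrite uextD hx hy.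
- by move=> c x hx; rewrite uextZ hx.
- by move=> x y hx hy; rewrite uextM hx hy.
Qed.

Lemma uinv_fix f u g : uinv u g -> uext f u = u -> uext f g = g.
Proof.
move=> [ug gu] uf; rewrite -[LHS]mul1r -gu -mulrA -{1}uf -uextM ug uext1.
by rewrite mulr1.
Qed.

End Automorphisms.

Lemma subgroupP (gT : groupType) (S : set gT) : subgroup S <->
  [/\ S 1%g, forall x y, S x -> S y -> S (x * y)%g & forall x, S x -> S x^-1%g].
Proof.
split=> [[S1 SD]|[S1 SM SV]].
  have SV x : S x -> S x^-1%g.
    by move=> Sx; rewrite -[x^-1%g]mul1g; apply/set_mem/SD => //; exact/mem_set.
  split=> //; first exact: set_mem S1.
  move=> x y Sx Sy; rewrite -[y]invgK; apply/set_mem/SD; apply/mem_set => //.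
  exact: SV.
split; first exact/mem_set.
by move=> x y /set_mem Sx /set_mem Sy; apply/mem_set/SM/SV.
Qed.

(** * Consequences of minimality: dense ideals, approximate and local units *)

Section Ideals.
Variables (R : realType) (A : cstarAlgType R).
Implicit Types (a b c x y : A) (B I : set A) (s t : starAut A).

Lemma cstar_subalgebraP B :
  cstar_subalgebra B <->
  [/\ closed B, B 0 /\ (forall a b, B a -> B b -> B (a + b)),
      forall (k : R[i]) a, B a -> B (k *: a),
      forall a b, B a -> B b -> B (a * b)%g & forall a, B a -> B (star a)].
Proof.
split=> [[cB [B0 BL] BM Bs]|[cB [B0 BD] BZ BM Bs]].
  have {}B0 := set_mem B0; split=> //.
  - split=> // a b Ba Bb; rewrite -[a]scale1r; apply/set_mem/BL; exact/mem_set.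
  - move=> k a Ba; rewrite -[_ *: _]addr0; apply/set_mem/BL; exact/mem_set.
  - by move=> a b Ba Bb; apply/set_mem/BM; exact/mem_set.
split=> //; first split; first exact/mem_set.
  by move=> k a b /set_mem Ba /set_mem Bb; apply/mem_set/BD/Bb/BZ.
by move=> a b /set_mem Ba /set_mem Bb; apply/mem_set/BM.
Qed.

Lemma globally_invariantP (S : set (starAut A)) B : subgroup S ->
  (globally_invariant S B <-> forall s a, S s -> B a -> B (s a)).
Proof.
move=> /subgroupP[_ _ SV]; split=> [h s a Ss Ba|h s Ss].
  by rewrite -(h s Ss); exists a.
apply/seteqP; split=> [_ [a Ba <-]|a Ba]; first exact: h.
by exists ((s^-1)%g a); [apply: h => //; exact: SV|exact: saut_KV].
Qed.

Lemma pos_uin_mul x : pos (uin (star x * x)%g).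
Proof. by rewrite uinM uin_star; exact: pos_star_mul. Qed.

Definition right_ideal I : Prop :=
  [/\ I 0, forall a b, I a -> I b -> I (a + b), forall (k : R[i]) a, I a -> I (k *: a)
    & forall a b, I a -> I (a * b)%g].

Variable S : set (starAut A).
Hypotheses (Sgroup : subgroup S) (Smin : acts_minimally S).

(** The set [B] of the proof is hereditary: if [a = x^* x <= b] with [b] in [I], then
    [b (C + b)^-1 x^*] is in [I] and tends to [x^*] as [C] goes to 0. It is nonzero because it
    contains [r r^*]. *)
Lemma minimal_closed_ideal I :
  right_ideal I -> closed I -> (forall s a, S s -> I a -> I (s a)) ->
  (exists2 a, I a & a != 0) -> forall a, I a.
Proof.
move=> [I0 ID IZ IM] cI IS [r Ir r0].
pose B : set A := [set a | I a /\ I (star a)].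
suff hB : hereditary_invariant S B.
  have {}hB : B = setT by move: hB; rewrite Smin.
  by move=> a; have [] : B a by rewrite hB.
have aB : cstar_subalgebra B.
    apply/cstar_subalgebraP; split.
    - apply/closed_nmP => a ha; split; move/closed_nmP: (cI); apply=> e /ha[b [Ib Ibs] ab].
        by exists b.
      by exists (star b) => //; rewrite -starB nm_star.
    - by split=> [|a b [? ?] [? ?]]; split; rewrite ?star0 ?starD //; exact: ID.
    - by move=> k a [? ?]; split; rewrite ?starZ //; exact: IZ.
    - by move=> a b [? ?] [? ?]; split; rewrite ?starM //; exact: IM.
    - by move=> a [? ?]; split; rewrite ?starK.
  split.
  + split=> // a b [Ib _] [x ax] [y bay].
    have pb : uin b = ustar (uin x) * uin x + ustar (uin y) * uin y.
      by rewrite -!uin_star -!uinM -uinD -ax -bay addrC subrK.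
    have posb : pos (uin b).
      by rewrite pb; apply: posD; exact: pos_star_mul.
    have Ixs : I (star x).
      (* For [u = C g = 1 - b g], the square of the norm of [u (star x)] is at most
         [nu (u b u) <= C], hence this choice of [C]. *)
      move/closed_nmP: (cI); apply=> e e0; pose C := (e / 2%:R) ^+ 2.
      have e2 : 0 < e / 2%:R by rewrite divr_gt0 // ltr0n.
      have C0 : 0 < C by rewrite exprn_gt0.
      have [g hg] := uinv_pos C0 posb.
      have [pg gb Cg n1 n2] := cutoff C0 posb hg.
      exists (b * act g (star x))%g; first exact: IM.
      apply: le_lt_trans (_ : e / 2%:R < e); last by rewrite ltr_pdivrMr // ltr_pMr // ltr1n.
      rewrite -(@ler_pXn2r _ 2) ?nnegrE ?nm_ge0 ?(ltW e2) // -/C.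
      rewrite -nu_uin uinB uinM uin_act mulrA -[uin (star x)]mul1r -mulrA.
      rewrite mul1r -[X in X - _]mul1r mulrA -mulrBl -Cg.
      rewrite -nu_star ustarM -uin_star starK (pos_sa (posZ (ltW C0) pg)).
      apply: le_trans n2; set u := C%:C *: g in Cg n1 *.
      have su : ustar u = u by exact/pos_sa/posZ/pg/ltW.
      have -> : u * uin b * u = ustar (uin x * u) * (uin x * u)
          + ustar (uin y * u) * (uin y * u).
        by rewrite pb !ustarM su mulrDr mulrDl !mulrA.
      exact/nu_sq_le/pos_star_mul.
    have sa : star a = a by rewrite ax starM starK.
    by rewrite /B /= sa ax; split; exact: IM.
  + move=> B0; have : B (r * star r)%g.
      by split; rewrite ?starM ?starK; exact: IM.
    rewrite B0 /= => /eqP; rewrite -nm_eq0 -[r in (r * _)%g]starK nm_cstar.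
    by rewrite nm_star sqrf_eq0 nm_eq0 (negbTE r0).
  + apply/globally_invariantP => // s a Ss [Ia Ias].
    by split; rewrite -?saut_star; exact: IS.
Qed.

Lemma minimal_ideal_dense I :
  right_ideal I -> (forall s a, S s -> I a -> I (s a)) ->
  (exists2 a, I a & a != 0) ->
  forall a (e : R), 0 < e -> exists2 x, I x & nm (a - x) < e.
Proof.
move=> [I0 ID IZ IM] IS [r Ir r0].
pose J : set A := [set a | forall e : R, 0 < e -> exists2 x, I x & nm (a - x) < e].
have IJ a : I a -> J a by move=> Ia e e0; exists a => //; rewrite subrr nm0.
suff hJ : forall a, J a by move=> a e; exact: hJ.
apply: minimal_closed_ideal; last by exists r => //; exact: IJ.
- split; first exact: IJ.
  + move=> a b Ja Jb e e0; have e2 : 0 < e / 2%:R by rewrite divr_gt0 // ltr0n.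
    have [x Ix ax] := Ja _ e2; have [y Iy byy] := Jb _ e2.
    exists (x + y); first exact: ID.
    by rewrite opprD addrACA; apply: le_lt_trans (nmD _ _) _; lra.
  + move=> k a Ja e e0; have k0 := cm_ge0 k.
    have k1 : 0 < cm k + 1 by lra.
    have [x Ix ax] := Ja _ (divr_gt0 e0 k1); exists (k *: x); first exact: IZ.
    rewrite -scalerBr nmZ; move: ax; rewrite ltr_pdivlMr //.
    by have := nm_ge0 (a - x); nra.
  + move=> a b Ja e e0; have k0 := nm_ge0 b.
    have k1 : 0 < nm b + 1 by lra.
    have [x Ix ax] := Ja _ (divr_gt0 e0 k1); exists (x * b)%g; first exact: IM.
    rewrite -cmulBl; apply: le_lt_trans (nmM _ _) _; move: ax; rewrite ltr_pdivlMr //.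
    by have := nm_ge0 (a - x); nra.
- apply/closed_nmP => a ha e e0; have e2 : 0 < e / 2%:R by rewrite divr_gt0 // ltr0n.
  have [b Jb ab] := ha _ e2; have [x Ix bx] := Jb _ e2; exists x => //.
  by apply: le_lt_trans (nm_triangle b _ _) _; lra.
- move=> s a Ss Ja e e0; have [x Ix ax] := Ja _ e0.
  by exists (s x); [exact: IS|rewrite -sautB nm_saut].
Qed.

Variable T : set (starAut A).
Hypothesis ST : forall s t, S s -> T t -> commute s t.

Definition fixed_by : set A := [set a | forall t, T t -> t a = a].

Lemma fixed_byS s a : S s -> fixed_by a -> fixed_by (s a).
Proof. by move=> Ss Fa t Tt; rewrite -saut_mulE -(ST Ss Tt) saut_mulE Fa. Qed.

Lemma fixed_by_subalg : cstar_subalgebra fixed_by.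
Proof.
apply/cstar_subalgebraP; split.
- apply/closed_nmP => a ha t Tt; apply/eqP; rewrite -subr_eq0 -nm_eq0 eq_le nm_ge0 andbT.
  apply/ler_addgt0Pr => e e0; rewrite add0r.
  have [b Fb ab] := ha _ (divr_gt0 e0 (ltr0n R 2)).
  apply: le_trans (nm_triangle b _ _) _; rewrite -{1}(Fb t Tt) -sautB nm_saut.
  by rewrite (nmBC b); lra.
- by split=> [|a b Fa Fb] t Tt; rewrite ?saut0 ?sautD ?Fa ?Fb.
- by move=> k a Fa t Tt; rewrite sautZ Fa.
- by move=> a b Fa Fb t Tt; rewrite sautM Fa ?Fb.
- by move=> a Fa t Tt; rewrite saut_star Fa.
Qed.

Hypothesis F_neq0 : exists2 c, fixed_by c & c != 0.

Inductive fixed_gen : set A :=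
| Fixed_gen0 : fixed_gen 0
| Fixed_genD c a x : fixed_by c -> fixed_gen x -> fixed_gen ((c * a)%g + x).

(* The elements of [A^T A] are dominated by positive elements of [A^T]. *)
Lemma fixed_gen_bound x : fixed_gen x -> exists b (K : R),
  [/\ fixed_by b, pos (uin b), 0 <= K
    & forall u : unitz A, nu (u * uin x) ^+ 2 <= K * nu (u * uin b * ustar u)].
Proof.
have /cstar_subalgebraP[_ [F0 FD] FZ FM Fs] := fixed_by_subalg.
elim=> [|c a {}x Fc _ [b [K [Fb pb K0 hb]]]].
  exists 0, 0; rewrite uin0; split=> //; first exact: pos0.
  by move=> u; rewrite mulr0 mul0r nu0 expr2 mulr0; exact: lexx.
pose b' := (c * star c)%g; have pb' : pos (uin b').
  by rewrite /b' -{1}(starK c); exact: pos_uin_mul.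
have hc u : nu (u * uin (c * a)%g) ^+ 2 <= nm a ^+ 2 * nu (u * uin b' * ustar u).
  rewrite uinM mulrA.
  have := nuM (u * uin c) (uin a); rewrite nu_uin => h.
  have -> : nu (u * uin b' * ustar u) = nu (u * uin c) ^+ 2.
    by rewrite -[in RHS]nu_star -nu_cstar ustarK ustarM /b' uinM uin_star !mulrA.
  rewrite mulrC -exprMn ler_pXn2r ?nnegrE ?nu_ge0 // mulr_ge0 ?nu_ge0 ?nm_ge0 //.
pose L := nm a ^+ 2 + K.
(* The factor 2 is that of [(p + q)^2 <= 2 p^2 + 2 q^2]; both squares are bounded through the same
   conjugate of [b' + b]. *)
exists (b' + b), (2%:R * L); split.
- by apply: FD => //; apply: FM => //; exact: Fs.
- by rewrite uinD; exact: posD.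
- by rewrite mulr_ge0 // addr_ge0 // sqr_ge0.
move=> u; have pconj p : pos p -> pos (u * p * ustar u).
  move=> pp; have [k [<- kp _]] := pos_sqrt pp.
  have -> : u * (k * k) * ustar u = ustar (k * ustar u) * (k * ustar u).
    by rewrite ustarM ustarK (pos_sa kp) !mulrA.
  exact: pos_star_mul.
have e1 : u * uin (b' + b) * ustar u = u * uin b' * ustar u + u * uin b * ustar u.
  by rewrite uinD mulrDr mulrDl.
have m1 : nu (u * uin b' * ustar u) <= nu (u * uin (b' + b) * ustar u).
  by rewrite e1; apply: pos_mono; exact: pconj.
have m2 : nu (u * uin b * ustar u) <= nu (u * uin (b' + b) * ustar u).
  by rewrite e1 addrC; apply: pos_mono; exact: pconj.
have h1 := hc u; have h2 := hb u.
have a0 : 0 <= nm a ^+ 2 by exact: sqr_ge0.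
have h3 := ler_wpM2l a0 m1; have h4 := ler_wpM2l K0 m2.
have h5 : nu (u * uin ((c * a)%g + x)) <= nu (u * uin (c * a)%g) + nu (u * uin x).
  by rewrite uinD mulrDr nuD.
have := nu_ge0 (u * uin ((c * a)%g + x)).
rewrite /L mulrDr mulrDl; move: h1 h2 h3 h4 h5.
have := nu_ge0 (u * uin (c * a)%g); have := nu_ge0 (u * uin x).
move: (nu (u * uin (c * a)%g)) (nu (u * uin x)) (nu (u * uin ((c * a)%g + x))).
by move=> p q r *; have := sqr_ge0 (p - q); nra.
Qed.

(** The right ideal [A^T A] is dense by minimality, so [a] is close to some [x] in it. If [b] in
    [A^T] dominates [x] as in [fixed_gen_bound], then [c = (C + b)^-1 b] is in [A^T], and
    [1 - c = C (C + b)^-1] is a contraction that makes [x] small. *)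
Lemma fixed_approx_unit a (e : R) : 0 < e ->
  exists2 c, fixed_by c & nm (a - (c * a)%g) <= e.
Proof.
move=> e0; have /cstar_subalgebraP[_ [F0 FD] FZ FM Fs] := fixed_by_subalg.
have genD x y : fixed_gen x -> fixed_gen y -> fixed_gen (x + y).
  move=> + gy; elim=> [|c b z Fc _ IH]; first by rewrite add0r.
  by rewrite -addrA; apply: Fixed_genD.
have [x gx ax] : exists2 x, fixed_gen x & nm (a - x) < e / 2%:R.
  apply: minimal_ideal_dense (divr_gt0 e0 (ltr0n R 2)).
  - split; [exact: Fixed_gen0|exact: genD| |].
    + move=> k y; elim=> [|c b z Fc _ IH]; first by rewrite scaler0; exact: Fixed_gen0.
      by rewrite scalerDr cscalerAr; exact: Fixed_genD.
    + move=> y d; elim=> [|c b z Fc _ IH]; first by rewrite cmul0l; exact: Fixed_gen0.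
      by rewrite cmulDl -mulgA; exact: Fixed_genD.
  - move=> s y Ss; elim=> [|c b z Fc _ IH]; first by rewrite saut0; exact: Fixed_gen0.
    by rewrite sautD sautM; apply: Fixed_genD => //; exact: fixed_byS.
  - have [c Fc c0] := F_neq0; exists (c * star c)%g.
      by rewrite -[(c * _)%g]addr0; apply: Fixed_genD => //; exact: Fixed_gen0.
    by rewrite -nm_eq0 -{1}(starK c) nm_cstar nm_star sqrf_eq0 nm_eq0.
have [b [K [Fb pb K0 hb]]] := fixed_gen_bound gx.
have K1 : 0 < K + 1 by lra.
pose C := (e / 2%:R) ^+ 2 / (K + 1).
have C0 : 0 < C by rewrite divr_gt0 // exprn_gt0 // divr_gt0 // ltr0n.
have [g hg] := uinv_pos C0 pb.
have [pg gb Cg n1 n2] := cutoff C0 pb hg.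
have su : ustar (C%:C *: g) = C%:C *: g by exact/pos_sa/posZ/pg/ltW.
exists (act g b) => [t Tt|].
  apply: uin_inj; rewrite -uext_in uin_act uextM uext_in Fb //.
  by rewrite (uinv_fix hg) // uextD uextZ uext1 uext_in Fb.
have -> : nm (a - (act g b * a)%g) = nu ((C%:C *: g) * uin a).
  by rewrite Cg -gb -nu_uin uinB uinM uin_act mulrBl mul1r.
rewrite -[a](subrK x) uinD mulrDr; apply: le_trans (nuD _ _) _.
have h1 : nu (C%:C *: g * uin (a - x)) <= e / 2%:R.
  apply: le_trans (nuM _ _) _; rewrite nu_uin -[leRHS]mul1r.
  by rewrite ler_pM ?nu_ge0 ?nm_ge0 // ltW.
have h2 : nu (C%:C *: g * uin x) <= e / 2%:R.
  have e2 : 0 <= e / 2%:R by rewrite ltW // divr_gt0 // ltr0n.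
  rewrite -(@ler_pXn2r _ 2) ?nnegrE ?nu_ge0 //.
  apply: le_trans (hb _) _; rewrite su.
  apply: le_trans (ler_wpM2l K0 n2) _; rewrite /C mulrA ler_pdivrMr // mulrC.
  by rewrite ler_wpM2l ?sqr_ge0 // lerDl.
by lra.
Qed.

Lemma sqrt_fixed (m : unitz A) k : (forall Q, usubalg Q -> Q k -> Q m) ->
  (forall t, T t -> uext t k = k) -> forall t, T t -> uext t m = m.
Proof. by move=> mQ kf t Tt; apply: (mQ _ (usubalg_fix t)); exact: kf. Qed.

Lemma pos_scalar (p : unitz A) : pos p -> exists2 r : R, 0 <= r & p.1 = r%:C.
Proof.
move=> /pos_sqrt[k [<- [ks _] _]]; exists (cm k.1 ^+ 2); first exact: sqr_ge0.
by rewrite cm_conjM; congr (_ * _); rewrite -{1}ks.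
Qed.

Lemma commuting_sqr_eq (x y : unitz A) : y * x = x * y -> x * x = y * y ->
  (x - y) * (x + y) = 0 /\ (x + y) * (x - y) = 0.
Proof.
move=> yx xx; split; first by rewrite mulrBl !mulrDr xx yx (addrC (x * y)) subrr.
by rewrite mulrDl !mulrBr xx yx addrA subrK subrr.
Qed.

(* [m] is the modulus of [k := a - 1/2]; since it has the scalar part [1/2], the
   elements [m + k] and [1 - (m - k)] lie in [A]. *)
Lemma cut_half a : fixed_by a -> sa (uin a) ->
  exists (m : unitz A) e f, let k := uin a - rs A 2%:R^-1 in
  [/\ pos m, m * m = k * k, uin e = m + k, uin f = 1 - (m - k)
    & [/\ fixed_by e, fixed_by f, sa (uin f), uin f * uin e = uin e
        & uin e * uin f = uin e]].
Proof.
move=> Fa as_; set k := uin a - _; have ks : sa k by apply: saB => //; exact: sa_rs.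
have [m [mm mp mQ]] := pos_sqrt (pos_sq ks).
have mk : k * m = m * k by apply: (mQ _ (usubalg_comm k)); rewrite mulrA.
have kf t : T t -> uext t k = k.
  by move=> Tt; rewrite uextB uext_in Fa // uextZ uext1.
have mf : forall t, T t -> uext t m = m.
  by apply: sqrt_fixed mQ _ => t Tt; rewrite uextM kf.
have k1 : k.1 = - (2%:R^-1)%:C by rewrite /k /= [_ *: _]mulr1 sub0r.
have m1 : m.1 = (2%:R^-1)%:C.
  have [r r0 mr] := pos_scalar mp; rewrite mr.
  have : m.1 * m.1 = k.1 * k.1 := congr1 fst mm.
  rewrite mr k1 mulrNN -!rmorphM => /complexI rr; congr (_%:C).
  have : (r - 2%:R^-1) * (r + 2%:R^-1) = 0 by rewrite -subr_sqr !expr2 rr subrr.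
  move/eqP; rewrite mulf_eq0 => /orP[|] /eqP; lra.
have h2 : (2%:R^-1)%:C + (2%:R^-1)%:C = 1 :> R[i].
  by rewrite -half_realC [RHS]splitr div1r.
have eE : uin (m + k).2 = m + k.
  by symmetry; apply: uinE; change (m.1 + k.1 = 0); rewrite m1 k1 subrr.
have fE : uin (1 - (m - k)).2 = 1 - (m - k).
  symmetry; apply: uinE; change (1 - (m.1 - k.1) = 0).
  by rewrite m1 k1 opprK h2 subrr.
exists m, (m + k).2, (1 - (m - k)).2; split=> //; split.
- by move=> t Tt; apply: uin_inj; rewrite -uext_in eE uextD mf ?kf.
- by move=> t Tt; apply: uin_inj; rewrite -uext_in fE uextB (uextB t m) uext1 mf ?kf.
- by rewrite fE; apply: saB; [exact: sa1|apply: saB => //; exact: pos_sa].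
  by rewrite fE eE mulrBl mul1r (proj1 (commuting_sqr_eq mk mm)) subr0.
by rewrite fE eE mulrBr mulr1 (proj2 (commuting_sqr_eq mk mm)) subr0.
Qed.

(** As functions of [a], positive of norm 1: [e0 = max(0, 2 a - 1)] and [e1 = min(1, 2 a)] by
    [cut_half], which applied to [e1] yields [e = max(0, 2 e1 - 1)] and [e' = min(1, 2 e1)]. Where
    [e0] does not vanish [e1 = 1], so [e = 1]; and [e0 != 0] because [nm a > 1/2]. *)
Lemma fixed_local_units : exists e' e e0,
  [/\ fixed_by e', fixed_by e & fixed_by e0] /\
  [/\ (e * e')%g = e, (e * e0)%g = e0 & e0 != 0].
Proof.
have /cstar_subalgebraP[_ _ FZ FM Fs] := fixed_by_subalg.
have [c Fc c0] := F_neq0; pose N := nm (star c * c)%g.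
have N0 : 0 < N by rewrite /N nm_cstar exprn_gt0 // lt0r nm_eq0 c0 nm_ge0.
pose a := N^-1%:C *: (star c * c)%g.
have pa : pos (uin a).
  by rewrite uinZ; apply: posZ; [rewrite invr_ge0 ltW|exact: pos_uin_mul].
have na : nm a = 1.
  by rewrite nmZ cm_real ger0_norm ?invr_ge0 ?(ltW N0) // mulVf // gt_eqF.
have Fa : fixed_by a by apply: FZ; apply: FM => //; exact: Fs.
have [m [e0 [e1 [mp mm e0E e1E [Fe0 Fe1 se1 e10 _]]]]] := cut_half Fa (pos_sa pa).
have [m2 [e [e' [m2p mm2 eE e'E [Fe Fe' _ _ ee']]]]] := cut_half Fe1 se1.
exists e', e, e0; split=> //; split.
- by apply: uin_inj; rewrite uinM.
- apply: uin_inj; rewrite uinM eE.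
  set x := uin e0 in e10 *; set k := uin e1 - _ in mm2 *.
  have hk : k * x = (2%:R^-1)%:C *: x.
    rewrite /k mulrBl e10 rsM -{1}[x]halfD half_realC addrK //.
  (* On [x] the element [k] acts as 1/2, hence so does its modulus: [(1/2 + m2)(m2 - 1/2) x = (k^2 -
     1/4) x = 0], and the first factor is invertible. *)
  have hm : m2 * x = (2%:R^-1)%:C *: x.
    have [g [_ gh]] := @uinv_pos R A 2%:R^-1 m2 (ltac:(by rewrite invr_gt0 ltr0n)) m2p.
    apply: subr0_eq; rewrite -[LHS]mul1r -gh -mulrA.
    suff -> : (rs A 2%:R^-1 + m2) * (m2 * x - (2%:R^-1)%:C *: x) = 0 by rewrite mulr0.
    rewrite mulrDl !mulrBr (mulrA m2 m2) mm2 -mulrA hk -!scalerAr hk !rsM.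
    by rewrite addrC addrA subrK subrr.
  by rewrite mulrDl hm hk -half_realC halfD.
- apply/eqP => e00; have : nu (uin a) <= 2%:R^-1.
    apply: pos_leP => //; move: e0E; rewrite e00 => /esym/eqP.
    by rewrite addr_eq0 opprB => /eqP <-.
  by rewrite nu_uin na; lra.
Qed.

End Ideals.

(** * Gelfand-Mazur for a left multiplier with a resolvent at every scalar *)

Section SpectrumNonempty.
Variables (R : realType) (A : cstarAlgType R).
Local Notation U := (unitz A).
Variables (Y : set A) (tau : A) (sigma : R[i] -> A).
Hypotheses (YD : forall x y, Y x -> Y y -> Y (x + y))
  (YZ : forall (k : R[i]) y, Y y -> Y (k *: y))
  (Ytau : forall y, Y y -> Y (tau * y)%g)
  (Ysigma : forall c y, Y y -> Y (sigma c * y)%g)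
  (tau_sigma : forall c y, Y y ->
     (tau * (sigma c * y))%g = y + c *: (sigma c * y)%g)
  (sigma_tau : forall c y, Y y ->
     (sigma c * (tau * y))%g = y + c *: (sigma c * y)%g).
Implicit Types (X Z : U) (c l : R[i]) (y : A) (K r : R).

Definition bdY X K : Prop := forall y, Y y -> nm (act X y) <= K * nm y.

Definition stableY X : Prop := forall y, Y y -> Y (act X y).

Local Opaque act.

(** A [2 ^ k]-th root of -1: it turns the [2 ^ k]-th roots of [l ^ (2 ^ k)] into those of
    [- l ^ (2 ^ k)], and the two sets together are the [2 ^ (k + 1)]-th roots of
    [l ^ (2 ^ (k + 1))]. *)
Fixpoint rootN1 (k : nat) : R[i] := if k is m.+1 then sqrtC (rootN1 m) else -1.

Lemma rootN1_exp k : rootN1 k ^+ (2 ^ k) = -1.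
Proof. by elim: k => [|k IH]; rewrite ?expr1 // expnS exprM sqrtCK. Qed.

Lemma cm_rootN1 k : cm (rootN1 k) = 1.
Proof.
apply/eqP; rewrite -(@pexpr_eq1 _ _ (2 ^ k)) ?cm_ge0 ?expn_gt0 //.
by rewrite -cmX rootN1_exp cmN cm1.
Qed.

(* The mean of [l' (l' - tau)^-1] over the [2 ^ k]-th roots [l'] of [l ^ (2 ^ k)];
   on [Y] it equals [l^n (l^n - tau^n)^-1] with [n = 2 ^ k]. *)
Fixpoint mean_res (k : nat) l : U :=
  if k is m.+1 then 2%:R^-1 *: (mean_res m l + mean_res m (rootN1 m * l))
  else - l *: uin (sigma l).

Lemma act_mean_resS k l y : act (mean_res k.+1 l) y =
  2%:R^-1 *: (act (mean_res k l) y + act (mean_res k (rootN1 k * l)) y).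
Proof. by rewrite /= actZ actD. Qed.

Lemma act_res l y : act (mean_res 0 l) y = - l *: (sigma l * y)%g.
Proof. by rewrite /= actZ act_uin. Qed.

Lemma mean_res_stable k l : stableY (mean_res k l).
Proof.
elim: k l => [|k IH] l y Yy; first by rewrite act_res; exact/YZ/Ysigma.
by rewrite act_mean_resS; apply/YZ/YD; exact: IH.
Qed.

Local Notation t_ n := (uin tau ^+ n).

Lemma tau_stable n : stableY (t_ n).
Proof.
elim: n => [|n IH] y Yy; first by rewrite act1.
by rewrite exprS actM act_uin; exact/Ytau/IH.
Qed.

Lemma act0 y : act 0 y = 0.
Proof. by apply: uin_inj; rewrite uin_act mul0r. Qed.

Lemma actZr X c y : act X (c *: y) = c *: act X y.
Proof. by apply: uin_inj; rewrite uinZ !uin_act uinZ scalerAr. Qed.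

Lemma actBr X x y : act X (x - y) = act X x - act X y.
Proof. by rewrite actDr -[- y]scaleN1r actZr scaleN1r. Qed.

Lemma scaler_half (y : A) : 2%:R^-1 *: (y + y) = y.
Proof.
have h : 2%:R^-1 + 2%:R^-1 = 1 :> R[i] by rewrite [RHS]splitr div1r.
by rewrite scalerDr -scalerDl h scale1r.
Qed.

Lemma half_scaleB c (x y : A) :
  2%:R^-1 *: (c *: (x - (y + y))) = c *: (2%:R^-1 *: x - y).
Proof. by rewrite scalerA mulrC -scalerA scalerBr scaler_half. Qed.

Lemma mean_resP k l y : Y y ->
  act (t_ (2 ^ k)) (act (mean_res k l) y)
    = l ^+ (2 ^ k) *: (act (mean_res k l) y - y) /\
  act (mean_res k l) (act (t_ (2 ^ k)) y)
    = l ^+ (2 ^ k) *: (act (mean_res k l) y - y).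
Proof.
elim: k l y => [|k IH] l y Yy.
  rewrite !expr1 !act_res !act_uin; split.
    rewrite -cscalerAr tau_sigma // scaleNr -scalerN opprD; congr (_ *: _).
    by rewrite addrC scaleNr.
  rewrite sigma_tau // scaleNr -scalerN opprD; congr (_ *: _).
  by rewrite addrC scaleNr.
set n := (2 ^ k)%N; have en : (2 ^ k.+1 = n + n)%N by rewrite expnS mul2n addnn.
pose l' := rootN1 k * l; have el' : l' ^+ n = - l ^+ n.
  by rewrite exprMn rootN1_exp mulN1r.
pose G := act (mean_res k l); pose G' := act (mean_res k l').
have Yt z : Y z -> Y (act (t_ n) z) by exact: tau_stable.
have h1 z : Y z -> act (t_ n) (G z) = l ^+ n *: (G z - z) by move=> Yz; case: (IH l z Yz).
have h2 z : Y z -> G (act (t_ n) z) = l ^+ n *: (G z - z) by move=> Yz; case: (IH l z Yz).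
have h3 z : Y z -> act (t_ n) (G' z) = - l ^+ n *: (G' z - z).
  by move=> Yz; case: (IH l' z Yz); rewrite el'.
have h4 z : Y z -> G' (act (t_ n) z) = - l ^+ n *: (G' z - z).
  by move=> Yz; case: (IH l' z Yz); rewrite el'.
have k1 z : Y z -> act (t_ n) (act (t_ n) (G z)) =
    (l ^+ n * l ^+ n) *: (G z - z) - l ^+ n *: act (t_ n) z.
  by move=> Yz; rewrite h1 // actZr actBr h1 // scalerBr scalerA.
have k3 z : Y z -> act (t_ n) (act (t_ n) (G' z)) =
    (l ^+ n * l ^+ n) *: (G' z - z) + l ^+ n *: act (t_ n) z.
  move=> Yz; rewrite h3 // actZr actBr h3 // scalerBr scalerA mulrNN.
  by rewrite -scalerN scaleNr scalerN opprK.
have e2 z : G z - z + (G' z - z) = G z + G' z - (z + z).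
  by rewrite opprD addrACA.
have k2 z : Y z -> G (act (t_ n) (act (t_ n) z)) =
    (l ^+ n * l ^+ n) *: (G z - z) - l ^+ n *: act (t_ n) z.
  by move=> Yz; rewrite h2 ?h2 //; [rewrite scalerBr scalerA|exact: Yt].
have k4 z : Y z -> G' (act (t_ n) (act (t_ n) z)) =
    (l ^+ n * l ^+ n) *: (G' z - z) + l ^+ n *: act (t_ n) z.
  move=> Yz; rewrite h4 ?h4 //; last exact: Yt.
  by rewrite scalerBr scalerA mulrNN scaleNr opprK.
have sum z w : (l ^+ n * l ^+ n) *: (G z - z) - w + ((l ^+ n * l ^+ n) *: (G' z - z) + w)
    = (l ^+ n * l ^+ n) *: (G z + G' z - (z + z)).
  by rewrite addrACA addNr addr0 -scalerDr e2.
have fin z : 2%:R^-1 *: ((l ^+ n * l ^+ n) *: (G z + G' z - (z + z)))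
    = l ^+ (n + n) *: (2%:R^-1 *: (G z + G' z) - z).
  by rewrite exprD half_scaleB.
rewrite !act_mean_resS -/G -/G' en exprD actM; split.
  rewrite (actZr (t_ n)) (actZr (t_ n)) (actDr (t_ n) (G y)).
  by rewrite (actDr (t_ n) (act (t_ n) (G y))) k1 // k3 // sum fin.
by rewrite actM k2 // k4 // sum fin.
Qed.

Lemma bdY_D X Z K r : bdY X K -> bdY Z r -> bdY (X + Z) (K + r).
Proof.
move=> hX hZ y Yy; rewrite actD mulrDl; apply: le_trans (nmD _ _) _.
by rewrite lerD ?hX ?hZ.
Qed.

Lemma bdY_half X K : bdY X (K + K) -> bdY (2%:R^-1 *: X) K.
Proof.
move=> hX y Yy; rewrite actZ nmZ cm_half.
by have := hX y Yy; rewrite mulrDl; lra.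
Qed.

Lemma mean_res_bd (P K : R) : (forall l, cm l <= P -> bdY (mean_res 0 l) K) ->
  forall k l, cm l <= P -> bdY (mean_res k l) K.
Proof.
move=> h; elim=> [|k IH] l lP; first exact: h.
by apply: bdY_half; apply: bdY_D; apply: IH; rewrite // cmM cm_rootN1 mul1r.
Qed.

Lemma mean_res_lip (P L : R) :
  (forall l m, cm l <= P -> cm m <= P ->
     bdY (mean_res 0 l - mean_res 0 m) (L * cm (l - m))) ->
  forall k l m, cm l <= P -> cm m <= P ->
     bdY (mean_res k l - mean_res k m) (L * cm (l - m)).
Proof.
move=> h; elim=> [|k IH] l m lP mP; first exact: h.
rewrite [mean_res k.+1 l]/= [mean_res k.+1 m]/= -scalerBr opprD addrACA.
apply: bdY_half; apply: bdY_D; first exact: IH.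
have -> : cm (l - m) = cm (rootN1 k * l - rootN1 k * m).
  by rewrite -mulrBr cmM cm_rootN1 mul1r.
by apply: IH; rewrite cmM cm_rootN1 mul1r.
Qed.

Lemma mean_res0 k : mean_res k 0 = 0.
Proof. by elim: k => [|k IH] /=; rewrite ?oppr0 ?scale0r // mulr0 IH addr0 scaler0. Qed.

Lemma sigma_res c c' y : Y y ->
  (sigma c' * y)%g = (sigma c * y)%g + (c' - c) *: (sigma c * (sigma c' * y))%g.
Proof.
move=> Yy; have := sigma_tau c (Ysigma c' Yy).
rewrite tau_sigma // cmulDr -cscalerAr => h.
apply: (addIr (c *: (sigma c * (sigma c' * y))%g)); rewrite -h scalerBl.
by rewrite -addrA subrK.
Qed.

(** Near each [c] the resolvent identity bounds [sigma c'] on [Y] by twice [nm (sigma c)];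
    compactness of a square containing the disc of radius [P] makes the bound uniform. *)
Lemma sigma_bounded (P : R) : exists2 K : R, 0 <= K &
  forall c, cm c <= P -> forall y, Y y -> nm (sigma c * y)%g <= K * nm y.
Proof.
pose Q : set (R * R) := `[- P, P]%classic `*` `[- P, P]%classic.
have cQ : compact Q by apply: compact_setX; exact: segment_compact.
pose good (K : R) (c : R * R) := 0 <= K /\
  forall y, Y y -> nm (sigma (c.1 +i* c.2)%C * y)%g <= K * nm y.
have := (iffLR (compact_near_coveringP Q)) cQ R (pinfty_nbhs R) good _.
move=> /(_ _)[|M [_ hM]].
  move=> [a b] _; pose K0 := nm (sigma (a +i* b)%C).
  have K00 : 0 <= K0 by exact: nm_ge0.
  (* Then [cm (c' - c) <= 2 d] and [2 d K0 <= 1/2], so that the term in [nm z] can be absorbed. *)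
  pose d := (4%:R * (K0 + 1))^-1.
  have d0 : 0 < d by rewrite invr_gt0 mulr_gt0 // ltr_wpDl.
  have dK : d * (4%:R * (K0 + 1)) = 1 by rewrite mulVf // gt_eqF // mulr_gt0 // ltr_wpDl.
  exists ([set c : R * R | `|a - c.1| < d /\ `|b - c.2| < d], [set K | 2%:R * K0 <= K]).
    split; last by apply: nbhs_pinfty_ge; exact: num_real.
    exists ([set x | `|a - x| < d], [set x | `|b - x| < d]).
      by split; exact: nbhsx_ballx.
    by move=> [x z] [].
  move=> [[a' b'] K] /= [[h1 h2] hK]; split=> /=; first by lra.
  move=> y Yy; pose c := (a +i* b)%C; pose c' := (a' +i* b')%C.
  have hc : cm (c' - c) <= d + d.
    apply: le_trans (cm_ReIm _) _; rewrite !raddfB /= -/c -/c'.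
    by rewrite (distrC a') (distrC b'); lra.
  rewrite -/c'; set z := (sigma c' * y)%g.
  have hz : nm z <= K0 * nm y + (d + d) * (K0 * nm z).
    rewrite {1}/z (sigma_res c c' Yy) -/z; apply: le_trans (nmD _ _) _.
    apply: lerD; first exact: nmM.
    rewrite nmZ ler_pM ?cm_ge0 ?nm_ge0 //; exact: nmM.
  have z0 := nm_ge0 z; have y0 := nm_ge0 y.
  have : 0 <= (K - 2%:R * K0) * nm y by rewrite mulr_ge0 ?subr_ge0.
  have : d * nm z * (4%:R * (K0 + 1)) = nm z by rewrite mulrAC dK mul1r.
  have : 0 <= d * nm z by rewrite mulr_ge0 // ltW.
  rewrite mulrBl; nra.
have Mx : M < `|M| + 1 by have := ler_norm M; lra.
exists (`|M| + 1); first by rewrite addr_ge0.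
move=> c cP y Yy; have [|_ h] := hM _ Mx (Re c, Im c).
  by split; rewrite /= in_itv /= -ler_norml; apply: le_trans cP;
    [exact: Re_le_cm|exact: Im_le_cm].
by have := h y Yy; case: c {cP h}.
Qed.

(** For [n = 2 ^ k] the operators [l^n (l^n - tau^n)^-1] on [Y] are Lipschitz in [l] uniformly in
    [k], being means of rotated resolvents. They vanish at [l = 0] and are close to 1 at
    [l = P > 2 nm tau]; but for large [n] they are nearly idempotent along [[0, P]], so that they
    cannot pass from near 0 to near 1. *)
Lemma resolvent_trivial y : Y y -> y = 0.
Proof.
move=> Yy; apply/eqP; apply: contraT => y0.
have yp : 0 < nm y by rewrite lt0r nm_eq0 y0 nm_ge0.
pose P := 2%:R * nm tau + 1; have t0 := nm_ge0 tau.
have P0 : 0 < P by rewrite /P; lra.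
have [K0 K00 hK0] := sigma_bounded P.
pose K := P * K0; have Kge0 : 0 <= K by rewrite mulr_ge0 // ltW.
pose L := K0 + P * (K0 * K0).
have L0 : 0 <= L by rewrite addr_ge0 ?mulr_ge0 // ltW.
have hK : forall k l, cm l <= P -> bdY (mean_res k l) K.
  apply: mean_res_bd => l lP z Yz; rewrite act_res nmZ cmN /K -mulrA.
  by rewrite ler_pM ?cm_ge0 ?nm_ge0 // hK0.
have hL : forall k l m, cm l <= P -> cm m <= P ->
    bdY (mean_res k l - mean_res k m) (L * cm (l - m)).
  apply: mean_res_lip => l m lP mP z Yz.
  have -> : act (mean_res 0 l - mean_res 0 m) z =
      - ((l - m) *: ((sigma l * z)%g + m *: (sigma m * (sigma l * z))%g)).
    have h : (l - m) *: (sigma m * (sigma l * z))%g = (sigma l * z)%g - (sigma m * z)%g.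
      by apply: (addrI (sigma m * z)%g); rewrite -sigma_res // addrC subrK.
    rewrite actB !act_res scalerDr scalerA (mulrC (l - m)) -scalerA h.
    by rewrite scalerBl scalerBr addrA subrK opprB !scaleNr opprK addrC.
  rewrite nmN nmZ (mulrC L) -mulrA ler_wpM2l ?cm_ge0 //.
  apply: le_trans (nmD _ _) _; rewrite /L mulrDl lerD ?hK0 // nmZ -!mulrA.
  rewrite ler_pM ?cm_ge0 ?nm_ge0 //; apply: le_trans (hK0 m mP _ (Ysigma l Yz)) _.
  by rewrite ler_wpM2l ?hK0.
(* The segment [[0, P]] is cut into [M.+1] steps, over each of which [G] varies by at most 1/16. *)
have [M hM] : exists M : nat, L * P * 16%:R <= M.+1%:R.
  exists (Num.truncn (L * P * 16%:R)); apply: ltW; exact: Num.Theory.truncnS_gt.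
have M0 : 0 < M.+1%:R :> R by rewrite ltr0n.
(* The largest of the ratios [rho j / rho j.+1 = j / (j + 1)] for [j <= M]; its [n]-th power must be
   small. *)
pose th := M%:R / M.+1%:R : R.
have th1 : 0 <= th < 1.
  by rewrite divr_ge0 //= ltr_pdivrMr // mul1r ltr_nat.
have [N1 hN1] : exists N, forall n, (N <= n)%N -> th ^+ n * (K + K * K) <= 32%:R^-1.
  have KK : 0 < K + K * K + 1 by nra.
  have [|N hN] := @expr_small R th (32%:R^-1 / (K + K * K + 1)) th1.
    by rewrite divr_gt0 // invr_gt0.
  exists N => n /hN; rewrite ler_pdivlMr //; apply: le_trans.
  rewrite ler_wpM2l ?exprn_ge0 ?lerDl //; by case/andP: th1.
have [N2 hN2] : exists N, forall n, (N <= n)%N -> 2%:R^-1 ^+ n * K <= 4%:R^-1.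
  have KK : 0 < K + 1 by lra.
  have [||N hN] := @expr_small R 2%:R^-1 (4%:R^-1 / (K + 1)).
  - by apply/andP; split; lra.
  - by rewrite divr_gt0 // invr_gt0.
  exists N => n /hN; rewrite ler_pdivlMr //; apply: le_trans.
  by rewrite ler_wpM2l ?exprn_ge0 ?invr_ge0 ?lerDl.
pose k := maxn N1 N2; pose n := (2 ^ k)%N.
have kn : (k <= n)%N by exact/ltnW/ltn_expl.
have {}hN1 := hN1 n (leq_trans (leq_maxl _ _) kn).
have {}hN2 := hN2 n (leq_trans (leq_maxr _ _) kn).
pose rho (j : nat) : R := P * (j%:R / M.+1%:R).
have rho0 j : 0 <= rho j by rewrite mulr_ge0 ?divr_ge0 // ltW.
have rhoP j : (j <= M.+1)%N -> rho j <= P.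
  move=> jM; rewrite -[leRHS]mulr1 ler_wpM2l ?(ltW P0) // ler_pdivrMr // mul1r.
  by rewrite ler_nat.
have cmrho j : cm (rho j)%:C = rho j by rewrite cm_real ger0_norm.
pose G j := mean_res k (rho j)%:C.
(* The Lipschitz bound first gives 1/2 at [j.+1]. To get back to 1/4, write
   [g = G j.+1 (z - g) + G j.+1 g]: the last term is at most half of [g], and [G j.+1 (z - g)] is
   within 1/16 of [G j (z - g)], which is small by [prod]. *)
have step j : (j < M.+1)%N -> bdY (G j) 4%:R^-1 -> bdY (G j.+1) 4%:R^-1.
  move=> jM hj; pose eps : R := 16%:R^-1.
  have jP : cm (rho j)%:C <= P by rewrite cmrho rhoP // ltnW.
  have jP' : cm (rho j.+1)%:C <= P by rewrite cmrho rhoP.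
  have Gd : bdY (G j.+1 - G j) eps.
    move=> z Yz; apply: le_trans (hL k _ _ jP' jP z Yz) _.
    rewrite ler_wpM2r ?nm_ge0 // -rmorphB cm_real -mulrBr -mulrBl -natrB //.
    rewrite subSnn mul1r ger0_norm; last by rewrite mulr_ge0 ?invr_ge0 // ltW.
    by rewrite mulrA ler_pdivrMr // /eps; lra.
  have Gh : bdY (G j.+1) 2%:R^-1.
    move=> z Yz; rewrite -[G j.+1](subrK (G j)) actD.
    apply: le_trans (nmD _ _) _; have := Gd z Yz; have := hj z Yz.
    by have := nm_ge0 z; rewrite /eps; lra.
  pose q : R := j%:R / j.+1%:R.
  have rq : rho j = q * rho j.+1.
    by rewrite /rho /q [RHS]mulrCA; congr (_ * _); rewrite mulrA divfK // pnatr_eq0.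
  have q0 : 0 <= q by rewrite divr_ge0.
  have qth : q <= th.
    rewrite ler_pdivrMr ?ltr0n // mulrAC ler_pdivlMr // -!natrM ler_nat.
    by rewrite !mulnS (mulnC M) leq_add2r -ltnS.
  (* With [t = tau ^ n], [r = rho j ^ n] and [r' = rho j.+1 ^ n], both sides are formally
     [- r t / ((r - t)(r' - t))] applied to [z]. *)
  have prod z : Y z -> act (G j) (z - act (G j.+1) z) =
      (q%:C) ^+ n *: (act (G j.+1) z - act (G j) (act (G j.+1) z)).
    move=> Yz; have Yz' := mean_res_stable k (rho j.+1)%:C Yz.
    have [h1 _] := mean_resP k (rho j.+1)%:C Yz.
    have [_ h2] := mean_resP k (rho j)%:C Yz'.
    move: h2; rewrite h1 -/(G j) -/(G j.+1) actZr -/n.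
    have rE : (rho j)%:C ^+ n = q%:C ^+ n * (rho j.+1)%:C ^+ n :> R[i].
      by rewrite rq (rmorphM _ q) exprMn.
    rewrite rE => h2.
    have r0 : ((rho j.+1)%:C : R[i]) ^+ n != 0.
      rewrite expf_neq0 // fmorph_eq0 gt_eqF // mulr_gt0 // divr_gt0 //.
    apply: (scalerI r0); rewrite -[z - _]opprB -scaleN1r actZr scalerA mulrC -scalerA.
    by rewrite h2 scaleN1r -scalerN opprB [RHS]scalerA mulrC.
  move=> z Yz; set g := act (G j.+1) z.
  have Yg : Y g by exact: mean_res_stable.
  have Yzg : Y (z - g) by apply: YD => //; rewrite -scaleN1r; exact: YZ.
  have z0 := nm_ge0 z; have g0 := nm_ge0 g.
  have b1 : nm (act (G j) (z - g)) <= 32%:R^-1 * nm z.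
    rewrite prod // -/g nmZ cmX cm_real (ger0_norm q0).
    have : nm (g - act (G j) g) <= (K + K * K) * nm z.
      apply: le_trans (nmB _ _) _; rewrite mulrDl lerD //; first exact: hK.
      apply: le_trans (hK k _ jP g Yg) _; rewrite -mulrA ler_wpM2l //; exact: hK.
    move=> b; have : q ^+ n <= th ^+ n by rewrite lerXn2r ?nnegrE //; case/andP: th1.
    move=> qn; apply: le_trans (ler_pM _ (nm_ge0 _) qn b) _; first exact: exprn_ge0.
    by rewrite mulrA ler_wpM2r.
  have b2 : nm (act (G j.+1 - G j) (z - g)) <= eps * nm (z - g) by exact: Gd.
  have b3 : nm (act (G j.+1) g) <= 2%:R^-1 * nm g by exact: Gh.
  have b4 : nm g <= 2%:R^-1 * nm z by exact: Gh.
  have b5 := nmB z g.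
  have e1 : g = act (G j) (z - g) + act (G j.+1 - G j) (z - g) + act (G j.+1) g.
    by rewrite actB (addrC (act (G j) _)) subrK actBr subrK.
  have b6 := nmD (act (G j) (z - g) + act (G j.+1 - G j) (z - g)) (act (G j.+1) g).
  have b7 := nmD (act (G j) (z - g)) (act (G j.+1 - G j) (z - g)).
  by move: b6; rewrite -e1 /eps in b2 *; lra.
have small j : (j <= M.+1)%N -> bdY (G j) 4%:R^-1.
  elim: j => [_|j IH jM]; last by apply: step => //; exact/IH/ltnW.
  by move=> z Yz; rewrite /G /rho mul0r mulr0 mean_res0 act0 nm0 mulr_ge0 ?invr_ge0 ?nm_ge0.
have s1 := small M.+1 (leqnn _) y Yy.
have rhoE : rho M.+1 = P by rewrite /rho divff ?mulr1 // gt_eqF.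
have [h1 _] := mean_resP k (rho M.+1)%:C Yy.
have hp : cm (rho M.+1)%:C <= P by rewrite cmrho rhoE.
have s2 := hK k _ hp y Yy.
have : nm (act (G M.+1) y - y) <= 4%:R^-1 * nm y.
  have Pn : 0 < P ^+ n by rewrite exprn_gt0.
  rewrite -(ler_pM2l Pn) -[X in X ^+ n * _ <= _](ger0_norm (ltW P0)).
  rewrite -cm_real -cmX -nmZ -rhoE -/n -h1 rhoE.
  apply: le_trans (nu_act _ _) _.
  have nt : nu (t_ n) <= nm tau ^+ n.
    elim: (n) => [|m IH]; first by rewrite nu1.
    rewrite !exprS; apply: le_trans (nuM _ _) _; rewrite nu_uin ler_wpM2l //.
  rewrite rhoE in s2; apply: le_trans (ler_pM (nu_ge0 _) (nm_ge0 _) nt s2) _.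
  have tp : nm tau ^+ n <= (2%:R^-1 * P) ^+ n.
    by rewrite lerXn2r ?nnegrE // /P; lra.
  apply: le_trans (ler_wpM2r _ tp) _; first by rewrite mulr_ge0 ?nm_ge0.
  rewrite exprMn mulrAC mulrC ler_wpM2l ?(ltW Pn) // mulrA.
  by rewrite ler_wpM2r ?nm_ge0.
have := nm_le (act (G M.+1) y) y; rewrite nmBC; lra.
Qed.

End SpectrumNonempty.

(** * Operators between two coefficients are trivial *)

Section PairTrivial.
Variables (R : realType) (A : cstarAlgType R) (S T : set (starAut A)).
Hypotheses (Sgroup : subgroup S) (Smin : acts_minimally S)
  (F_neq0 : exists2 c : A, fixed_by T c & c != 0).
(** The graph of a partial operator [p |-> q], right [A]-linear, left [A^T]-linear and
    [S]-equivariant. [D_graph] makes it single-valued, and [D_eigen] makes the operator minus [k]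
    injective for every [k]. *)
Variable D : A -> A -> Prop.
Hypotheses (DD : forall p q p' q', D p q -> D p' q' -> D (p + p') (q + q'))
  (DZ : forall (k : R[i]) p q, D p q -> D (k *: p) (k *: q))
  (DM : forall p q a, D p q -> D (p * a)%g (q * a)%g)
  (DF : forall c p q, fixed_by T c -> D p q -> D (c * p)%g (c * q)%g)
  (DS : forall s p q, S s -> D p q -> D (s p) (s q))
  (D_graph : forall q, D 0 q -> q = 0)
  (D_eigen : forall (k : R[i]) p, D p (k *: p) -> p = 0).

Definition ract (x : A) (v : unitz A) : A := v.1 *: x + (x * v.2)%g.

Lemma uin_ract x v : uin (ract x v) = uin x * v.
Proof. by congr pair; rewrite /= ?mul0r // scale0r add0r. Qed.

Let DB p q p' q' : D p q -> D p' q' -> D (p - p') (q - q').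
Proof.
by move=> h h'; apply: DD => //; rewrite -[- p']scaleN1r -[- q']scaleN1r; exact: DZ.
Qed.

Let D_inj p q q' : D p q -> D p q' -> q = q'.
Proof. by move=> h h'; apply/subr0_eq/D_graph; rewrite -(subrr p); exact: DB. Qed.

(* A dense right ideal contains the local units of [A^T]. *)
Lemma graph_local_unit (k l : R[i]) e e' : fixed_by T e -> (e * e')%g = e ->
  (exists p q, D p q /\ k *: p + l *: q != 0) ->
  exists p q, D p q /\ k *: p + l *: q = e.
Proof.
move=> Fe ee' [p0 [q0 [D0 n0]]].
pose I : set A := [set x | exists p q, D p q /\ x = k *: p + l *: q].
have D00 : D 0 0 by have := DZ 0 D0; rewrite !scale0r.
have [_ [p [q [Dpq ->]]] hd] : exists2 x, I x & nm (e' - x) < 1.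
  apply: (minimal_ideal_dense Sgroup Smin) => //.
  - split.
    + by exists 0, 0; rewrite !scaler0 addr0.
    + move=> _ _ [p [q [h ->]]] [p' [q' [h' ->]]].
      by exists (p + p'), (q + q'); rewrite !scalerDr addrACA; split=> //; exact: DD.
    + move=> c _ [p [q [h ->]]]; exists (c *: p), (c *: q); split; first exact: DZ.
      by rewrite scalerDr !scalerA mulrC (mulrC c l).
    + move=> _ a [p [q [h ->]]]; exists (p * a)%g, (q * a)%g; split; first exact: DM.
      by rewrite cmulDl -!cscalerAl.
  - move=> s _ Ss [p [q [h ->]]]; exists (s p), (s q); split; first exact: DS.
    by rewrite sautD !sautZ.
  - by exists (k *: p0 + l *: q0) => //; exists p0, q0.
set x := k *: p + l *: q in hd *; set d := e' - x in hd.
(* [e x = e (e' - d) = e (1 - d)], so right multiplication by [v], the inverse of [1 - d] in the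
   unitization, carries [e x] to [e]. *)
have [v [hv _]] : exists v, uinv (1 - uin d) v by apply: neumann; rewrite nu_uin.
exists (ract (e * p)%g v), (ract (e * q)%g v); split.
  by apply: DD; [exact/DZ/DF|exact/DM/DF].
apply: uin_inj; rewrite uinD !uinZ !uin_ract !scalerAl -mulrDl -!uinZ -uinD.
rewrite !cscalerAr -cmulDr -/x -[RHS]mulr1 -hv mulrA; congr (_ * v).
by rewrite mulrBr mulr1 -uinM -uinB /d cmulBr ee' subKr.
Qed.

(* If [D] were not trivial, [tau] and the [sigma c] would be elements of [A] acting on
   [Y] as an operator and its resolvent at every [c], against Gelfand-Mazur. *)
Lemma pair_trivial p q : D p q -> p = 0.
Proof.
move=> Dpq; apply/eqP; apply: contraT => p0; exfalso.
have [e' [e [e0 [[Fe' Fe _] [ee' ee0 e0n]]]]] := fixed_local_units F_neq0.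
have [e1 [tau [Dt e1E]]] : exists p q, D p q /\ 1 *: p + 0 *: q = e.
  apply: (graph_local_unit Fe ee'); exists p, q.
  by rewrite scale1r scale0r addr0.
rewrite scale1r scale0r addr0 in e1E; subst e1.
have hs (c : R[i]) : exists x, D x (e + c *: x).
  have [|x [y [Dxy xy]]] := @graph_local_unit (- c) 1 _ _ Fe ee'.
    exists p, q; split=> //; rewrite scaleNr scale1r addrC subr_eq0.
    by apply: contraNneq p0 => qc; apply/eqP/(@D_eigen c); rewrite -qc.
  by exists x; rewrite -xy scaleNr scale1r addrAC addNr add0r.
have [sigma Ds] := choice hs.
pose Y : set A := [set y | (e * y)%g = y].
have Dty y : Y y -> D y (tau * y)%g by move=> Yy; rewrite -{1}Yy; exact: DM.
have Dsy c y : Y y -> D (sigma c * y)%g (y + c *: (sigma c * y)%g).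
  by move=> Yy; rewrite -{2}Yy cscalerAl -cmulDl; exact: DM.
have Yt y : Y y -> Y (tau * y)%g.
  move=> Yy; rewrite /Y /=; apply: (@D_inj y); last exact: Dty.
  by rewrite -{1}Yy; apply: DF => //; exact: Dty.
(* Both [e * (sigma c * y)] and [sigma c * y] are sent to [y] by the operator minus [c]; [D_eigen]
   identifies them. *)
have Ysg c y : Y y -> Y (sigma c * y)%g.
  move=> Yy; rewrite /Y /=; apply/eqP; rewrite -subr_eq0; apply/eqP/(@D_eigen c).
  have h := DF Fe (Dsy c y Yy); rewrite cmulDr -cscalerAr Yy in h.
  by have := DB h (Dsy c y Yy); rewrite opprD addrACA subrr add0r -scalerBr.
have ts c y : Y y -> (tau * (sigma c * y))%g = y + c *: (sigma c * y)%g.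
  by move=> Yy; apply: (@D_inj (sigma c * y)%g); [exact/Dty/Ysg|exact: Dsy].
have st c y : Y y -> (sigma c * (tau * y))%g = y + c *: (sigma c * y)%g.
  move=> Yy; apply/eqP; rewrite -subr_eq0; apply/eqP/(@D_eigen c).
  have h1 := Dsy c _ (Yt y Yy); have h2 := DZ c (Dsy c y Yy).
  have := DB h1 (DD (Dty y Yy) h2); congr D.
  by rewrite opprD addrACA subrr add0r !scalerBr scalerDr opprD.
have e0Y : Y e0 by [].
suff : e0 = 0 by move/eqP; rewrite (negbTE e0n).
apply: (resolvent_trivial (Y := Y) (tau := tau) (sigma := sigma)) => //.
- by move=> x y Yx Yy; rewrite /Y /= cmulDr Yx Yy.
- by move=> k y Yy; rewrite /Y /= -cscalerAr Yy.
Qed.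

End PairTrivial.

(** * Von Neumann means on a compact group *)

Lemma finite_cover (X : topologicalType) (U : X -> set X) :
  compact [set: X] -> (forall x, nbhs x (U x)) ->
  exists s : seq X, forall y, exists2 x, x \in s & U x y.
Proof.
move=> cX hU.
(* The filter of the finite lists that are large enough: for it, near-covering compactness extracts
   a finite subcover. *)
pose F : set_system (seq X) :=
  [set P : set (seq X) | exists s0 : seq X, forall s, {subset s0 <= s} -> P s].
have FF : Filter F.
  split; first by exists [::].
    move=> P Q [s hs] [t ht]; exists (s ++ t) => r hr; split.
      by apply: hs => x xs; apply: hr; rewrite mem_cat xs.
    by apply: ht => x xt; apply: hr; rewrite mem_cat xt orbT.
  by move=> P Q PQ [s hs]; exists s => t /hs; exact: PQ.
pose P (s : seq X) (y : X) := exists2 x, x \in s & U x y.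
have := (iffLR (compact_near_coveringP [set: X])) cX _ F P FF.
case=> [x _|s hs]; last by exists s => y; exact: hs.
exists (U x, [set s : seq X | x \in s]) => /=.
  by split; [exact: hU|exists [:: x] => s; apply; rewrite mem_head].
by move=> [y s] [/= Uxy xs]; exists x.
Qed.

Section Averages.
Variables (R : realType) (G : topologicalGroupType).
Variables (K : numFieldType) (E : lmodType K) (nrm : E -> R).
Implicit Types (f h : G -> E) (s t : seq G) (g x y : G) (e : R).

(** What averaging requires of a norm, so that real and [A]-valued functions are treated at once.
    Averages only involve the factors [n^-1]; the case [n = 0] yields [nrm 0 = 0]. *)
Definition good_norm : Prop :=
  [/\ forall a b, nrm (a + b) <= nrm a + nrm b, forall a, nrm (- a) = nrm a,
      forall n a, nrm (n%:R^-1 *: a) = n%:R^-1 * nrm a,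
      forall a, nrm a <= 0 -> a = 0
    & forall (u : nat -> E) (d : nat -> R),
        (forall m n, nrm (u m - u n) <= d m + d n) ->
        (forall e : R, 0 < e -> exists N, forall n, (N <= n)%N -> d n <= e) ->
        exists a, forall n, nrm (a - u n) <= d n].

Definition ncont f : Prop :=
  forall x e, 0 < e -> \forall y \near x, nrm (f x - f y) <= e.

Definition avg s f : E := (size s)%:R^-1 *: \sum_(x <- s) f x.

Definition avL s f : G -> E := fun g => avg s (fun x => f (x * g)%g).
Definition avR s f : G -> E := fun g => avg s (fun x => f (g * x)%g).

Definition isL f c : Prop :=
  forall e, 0 < e -> exists2 s, s != [::] & forall g, nrm (avL s f g - c) <= e.
Definition isR f c : Prop :=
  forall e, 0 < e -> exists2 s, s != [::] & forall g, nrm (avR s f g - c) <= e.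

(** Takes the place of the Haar integral: the constant that is uniformly approximated by averages of
    left translates and by averages of right translates. *)
Definition mean f : E := xget 0 [set c | isL f c /\ isR f c].

Definition mean_approx : Prop := forall f, ncont f -> forall e, 0 < e ->
  exists s c, s != [::] /\ forall g, nrm (avL s f g - c) <= e.

Hypothesis gn : good_norm.

Let nrmD a b : nrm (a + b) <= nrm a + nrm b. Proof. by case: gn. Qed.
Let nrmN a : nrm (- a) = nrm a. Proof. by case: gn. Qed.
Let nrmZ n a : nrm (n%:R^-1 *: a) = n%:R^-1 * nrm a. Proof. by case: gn. Qed.

Let nrm0 : nrm 0 = 0.
Proof. by have := nrmZ 0 0; rewrite scaler0 invr0 mul0r. Qed.

Let nrmBC a b : nrm (a - b) = nrm (b - a).
Proof. by rewrite -nrmN opprB. Qed.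

Let nrm_ge0 a : 0 <= nrm a.
Proof. by have := nrmD a (- a); rewrite subrr nrm0 nrmN; lra. Qed.

Let nrm_tri b a c : nrm (a - c) <= nrm (a - b) + nrm (b - c).
Proof. by apply: le_trans (nrmD _ _); rewrite addrA subrK. Qed.

Let nrm_sum (I : Type) (r : seq I) (F : I -> E) :
  nrm (\sum_(i <- r) F i) <= \sum_(i <- r) nrm (F i).
Proof.
elim/big_ind2: _ => //; first by rewrite nrm0.
by move=> x1 x2 y1 y2 h1 h2; apply: le_trans (nrmD _ _) _; rewrite lerD.
Qed.

Let nrm_small a (C : R) : (forall e, 0 < e -> nrm a <= C * e) -> a = 0.
Proof.
case: gn => _ _ _ h0 _ h; apply: h0; apply/ler_addgt0Pr => e e0; rewrite add0r.
have C1 : 0 < `|C| + 1 by rewrite ltr_wpDl.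
apply: le_trans (h (e / (`|C| + 1)) (divr_gt0 e0 C1)) _.
rewrite mulrA ler_pdivrMr // mulrC ler_wpM2l ?(ltW e0) //.
by have := ler_norm C; lra.
Qed.

Lemma size_neq0 s : s != [::] -> ((size s)%:R : K) != 0.
Proof. by case: s => // x s _; rewrite pnatr_eq0. Qed.

Lemma avgD s f h : avg s (fun x => f x + h x) = avg s f + avg s h.
Proof. by rewrite /avg big_split scalerDr. Qed.

Lemma avg_cst s c : s != [::] -> avg s (fun=> c) = c.
Proof.
move=> s0; rewrite /avg big_const_seq count_predT iter_addr_0 -[c *+ _]scaler_nat scalerA.
by rewrite mulVf ?scale1r // size_neq0.
Qed.

Lemma avgB s f c : s != [::] -> avg s f - c = avg s (fun x => f x - c).
Proof. by move=> s0; rewrite avgD (avg_cst (- c)). Qed.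

Lemma avg_le s f e : s != [::] -> (forall x, nrm (f x) <= e) -> nrm (avg s f) <= e.
Proof.
move=> s0 h; rewrite /avg nrmZ ler_pdivrMl; last first.
  by rewrite ltr0n; case: s s0.
apply: le_trans (nrm_sum _ _) _; apply: le_trans (ler_sum _ (fun i _ => h i)) _.
by rewrite big_const_seq count_predT iter_addr_0 mulr_natl.
Qed.

Lemma avg_exch s t (F : G -> G -> E) :
  avg s (fun x => avg t (F x)) = avg t (fun y => avg s (F^~ y)).
Proof.
rewrite /avg -!scaler_sumr exchange_big !scalerA /=.
by congr (_ *: _); exact: mulrC.
Qed.

Lemma allpairs_neq0 s t : s != [::] -> t != [::] ->
  [seq (x * y)%g | x <- s, y <- t] != [::].
Proof. by case: s => // x s _; case: t. Qed.

Lemma avL_pairs s t f g :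
  avL [seq (x * y)%g | x <- s, y <- t] f g = avg t (fun y => avL s f (y * g)%g).
Proof.
rewrite [RHS]avg_exch /avL /avg size_allpairs natrM invfM -scalerA; congr (_ *: _).
rewrite big_allpairs_dep scaler_sumr; apply: eq_bigr => x _; congr (_ *: _).
by apply: eq_bigr => y _; rewrite mulgA.
Qed.

(** Averaging on both sides at once gives an element close to [c] and to [d]. Uniqueness and
    invariance of the mean both rest on this. *)
Lemma isLR_eq f c d : isL f c -> isR f d -> c = d.
Proof.
move=> hL hR; apply: subr0_eq; apply: (nrm_small (C := 2%:R)) => e e0.
have [s s0 hs] := hL e e0; have [t t0 ht] := hR e e0.
pose a := avg t (fun y => avL s f y).
have h1 : nrm (a - c) <= e by rewrite avgB //; apply: avg_le => // y; exact: hs.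
have h2 : nrm (a - d) <= e.
  by rewrite /a avg_exch avgB //; apply: avg_le => // x; exact: ht.
by apply: le_trans (nrm_tri a _ _) _; rewrite (nrmBC c); lra.
Qed.

Lemma avgV s (f : G -> E) : avg [seq (x^-1)%g | x <- s] f = avg s (fun x => f (x^-1)%g).
Proof. by rewrite /avg size_map big_map. Qed.

Lemma isR_inv f c : isR f c -> isL (fun x => f (x^-1)%g) c.
Proof.
move=> hR e e0; have [s s0 hs] := hR e e0; exists [seq (x^-1)%g | x <- s].
  by case: s s0 {hs}.
move=> g; rewrite /avL avgV -(invgK g); have := hs (g^-1)%g; rewrite /avR.
by congr (nrm (avg _ _ - _) <= _); apply/funext => x; rewrite invgM !invgK.
Qed.

Lemma ncont_comp f (phi : G -> G) : continuous phi -> ncont f -> ncont (f \o phi).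
Proof. by move=> cphi cf x e e0; exact: (cphi x _ (cf (phi x) e e0)). Qed.

Lemma continuous_mulgl x : continuous (fun g : G => (x * g)%g).
Proof.
move=> g; apply: (@continuous_comp _ _ _ (fun g => (x, g)) (fun p => (p.1 * p.2)%g)).
  by apply: cvg_pair; [exact: cvg_cst|exact: cvg_id].
exact: mulg_continuous.
Qed.

Lemma continuous_mulgr x : continuous (fun g : G => (g * x)%g).
Proof.
move=> g; apply: (@continuous_comp _ _ _ (fun g => (g, x)) (fun p => (p.1 * p.2)%g)).
  by apply: cvg_pair; [exact: cvg_id|exact: cvg_cst].
exact: mulg_continuous.
Qed.

Lemma ncont_mulgl x f : ncont f -> ncont (fun g => f (x * g)%g).
Proof. exact/ncont_comp/continuous_mulgl. Qed.

Lemma ncont_mulgr x f : ncont f -> ncont (fun g => f (g * x)%g).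
Proof. exact/ncont_comp/continuous_mulgr. Qed.

Lemma ncont_inv f : ncont f -> ncont (fun g => f (g^-1)%g).
Proof. exact/ncont_comp/invg_continuous. Qed.

Lemma ncont_cst c : ncont (fun=> c).
Proof. by move=> x e e0; apply: nearW => y; rewrite subrr nrm0 ltW. Qed.

Lemma ncontD f h : ncont f -> ncont h -> ncont (fun x => f x + h x).
Proof.
move=> cf ch x e e0; have e2 : 0 < e / 2%:R by rewrite divr_gt0.
near=> y; rewrite opprD addrACA; apply: le_trans (nrmD _ _) _.
have : nrm (f x - f y) <= e / 2%:R by near: y; exact: cf.
have : nrm (h x - h y) <= e / 2%:R by near: y; exact: ch.
lra.
Unshelve. all: by end_near. Qed.

Lemma ncont_sum (I : Type) (r : seq I) (F : I -> G -> E) :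
  (forall i, ncont (F i)) -> ncont (fun x => \sum_(i <- r) F i x).
Proof.
move=> cF; elim: r => [|i r IH].
  by under [fun x => _]funext do rewrite big_nil; exact: ncont_cst.
by under [fun x => _]funext do rewrite big_cons; exact: ncontD.
Qed.

Lemma ncont_lip (E' : zmodType) (nrm' : E' -> R) (f' : G -> E') (L : E' -> E) (C : R) :
  0 <= C -> (forall a b, nrm (L a - L b) <= C * nrm' (a - b)) ->
  (forall x e, 0 < e -> \forall y \near x, nrm' (f' x - f' y) <= e) ->
  ncont (fun x => L (f' x)).
Proof.
move=> C0 hL cf x e e0; have C1 : 0 < C + 1 by rewrite ltr_wpDl.
have e1 : 0 < e / (C + 1) by rewrite divr_gt0.
near=> y; apply: le_trans (hL _ _) _.
have h : nrm' (f' x - f' y) <= e / (C + 1) by near: y; exact: cf.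
apply: le_trans (ler_wpM2l C0 h) _.
by rewrite mulrA ler_pdivrMr // mulrC ler_wpM2l ?(ltW e0) // lerDl.
Unshelve. all: by end_near. Qed.

Lemma ncont_avL s f : ncont f -> ncont (avL s f).
Proof.
move=> cf; rewrite /avL /avg.
apply: (@ncont_lip E nrm _ (fun a => (size s)%:R^-1 *: a) ((size s)%:R^-1)).
- by rewrite invr_ge0.
- by move=> a b; rewrite -scalerBr nrmZ.
by apply: (@ncont_sum _ s (fun x g => f (x * g)%g)) => x; exact: ncont_mulgl.
Qed.

Hypothesis ap : mean_approx.

(** Applied to [f] and to [f] composed with inversion, [mean_approx] gives nearly constant left
    averages with values near [c m] and right ones near [d n]. Two-sided averages show that [c m]
    and [d n] are close, so both sequences are Cauchy with the same limit. *)
Lemma mean_exists f : ncont f -> exists c, isL f c /\ isR f c.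
Proof.
move=> cf; pose ep (n : nat) : R := n.+1%:R^-1.
have ep0 n : 0 < ep n by rewrite invr_gt0.
have epm m n : (m <= n)%N -> ep n <= ep m.
  by move=> mn; rewrite lef_pV2 ?posrE ?ltr0n // ler_nat ltnS.
have [sc hsc] := choice (fun n => ap cf (ep0 n)).
have [c hc] := choice hsc.
have [tc htc] := choice (fun n => ap (ncont_inv cf) (ep0 n)).
have [d hd] := choice htc.
have {}hd n : tc n != [::] /\ forall g, nrm (avR [seq (x^-1)%g | x <- tc n] f g - d n) <= ep n.
  case: (hd n) => t0 ht; split=> // g; have := ht (g^-1)%g; rewrite /avL /avR avgV.
  by congr (nrm (avg _ _ - _) <= _); apply/funext => x; rewrite invgM invgK.
have cd m n : nrm (c m - d n) <= ep m + ep n.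
  case: (hc m) => s0 hs; case: (hd n) => t0 ht.
  set s := sc m in s0 hs; set t := [seq (x^-1)%g | x <- tc n] in ht.
  have {}t0 : t != [::] by rewrite /t; case: (tc n) t0.
  pose a := avg t (fun y => avL s f y).
  have h1 : nrm (a - c m) <= ep m by rewrite avgB //; apply: avg_le => // y; exact: hs.
  have h2 : nrm (a - d n) <= ep n.
    by rewrite /a avg_exch avgB //; apply: avg_le => // x; exact: ht.
  by apply: le_trans (nrm_tri a _ _) _; rewrite (nrmBC (c m)) lerD.
have cc m n : nrm (c m - c n) <= 2%:R * ep m + 2%:R * ep n.
  have := nrm_tri (d (maxn m n)) (c m) (c n); rewrite (nrmBC (d _)).
  have := cd m (maxn m n); have := cd n (maxn m n).
  have := epm _ _ (leq_maxl m n); have := epm _ _ (leq_maxr m n); lra.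
have epl (e : R) : 0 < e -> exists N, forall n, (N <= n)%N -> ep n <= e.
  move=> e0; exists (Num.truncn e^-1) => n hn.
  rewrite /ep invf_ple ?posrE //; apply: ltW.
  apply: lt_le_trans (Num.Theory.truncnS_gt _) _ => //.
  by rewrite ler_nat ltnS.
have [a ha] : exists a, forall n, nrm (a - c n) <= 2%:R * ep n.
  case: gn => _ _ _ _; apply=> // e e0.
  have [N hN] := epl _ (divr_gt0 e0 (ltr0n R 2)).
  by exists N => n /hN; lra.
exists a; split=> e e0; have [N hN] := epl _ (divr_gt0 e0 (ltr0n R 5)).
  exists (sc N); first by case: (hc N).
  move=> g; apply: le_trans (nrm_tri (c N) _ _) _.
  have := hN N (leqnn _); have := ha N; rewrite (nrmBC a).
  by case: (hc N) => _ /(_ g); lra.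
exists [seq (x^-1)%g | x <- tc N]; first by case: (hd N) => + _; case: (tc N).
move=> g; apply: le_trans (nrm_tri (d N) _ _) _.
have := hN N (leqnn _); have := ha N; have := cd N N.
have := nrm_tri (c N) (d N) a; rewrite (nrmBC (d N) (c N)) (nrmBC a (c N)).
by case: (hd N) => _ /(_ g); lra.
Qed.

Lemma meanP f : ncont f -> isL f (mean f) /\ isR f (mean f).
Proof. by move=> cf; have [c hc] := mean_exists cf; exact: (@xgetPex _ 0 [set c | isL f c /\ isR f c] (ex_intro _ c hc)). Qed.

Lemma meanE f c : ncont f -> isL f c -> mean f = c.
Proof. by move=> cf hL; have [_ hR] := meanP cf; rewrite (isLR_eq hL hR). Qed.

Lemma meanE' f c : ncont f -> isR f c -> mean f = c.
Proof. by move=> cf hR; have [hL _] := meanP cf; exact: isLR_eq hL hR. Qed.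

Lemma mean_mulgl x f : ncont f -> mean (fun g => f (x * g)%g) = mean f.
Proof.
move=> cf; apply: meanE'; first exact: ncont_mulgl.
move=> e e0; have [s s0 hs] := (proj2 (meanP cf)) e e0; exists s => // g.
have := hs (x * g)%g; rewrite /avR.
by congr (nrm (avg _ _ - _) <= _); apply/funext => y; rewrite mulgA.
Qed.

Lemma mean_mulgr x f : ncont f -> mean (fun g => f (g * x)%g) = mean f.
Proof.
move=> cf; apply: meanE; first exact: ncont_mulgr.
move=> e e0; have [s s0 hs] := (proj1 (meanP cf)) e e0; exists s => // g.
have := hs (g * x)%g; rewrite /avL.
by congr (nrm (avg _ _ - _) <= _); apply/funext => y; rewrite mulgA.
Qed.

Lemma mean_inv f : ncont f -> mean (fun g => f (g^-1)%g) = mean f.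
Proof.
move=> cf; apply: meanE; first exact: ncont_inv.
exact/isR_inv/(proj2 (meanP cf)).
Qed.

Lemma mean_cst c : mean (fun=> c) = c.
Proof.
apply: meanE; first exact: ncont_cst.
move=> e e0; exists [:: 1%g] => // g.
by rewrite /avL avg_cst // subrr nrm0 ltW.
Qed.

(** One list has to serve both functions: once [s] flattens [f], a list [t] flattens [avL s h],
    which has the mean of [h], and the products [x * y] flatten both. *)
Lemma meanD f h : ncont f -> ncont h -> mean (fun x => f x + h x) = mean f + mean h.
Proof.
move=> cf ch; apply: meanE; first exact: ncontD.
move=> e e0; have e2 : 0 < e / 2%:R by rewrite divr_gt0.
have [s s0 hs] := (proj1 (meanP cf)) _ e2.
have ch' := ncont_avL s ch.
have hR : isR (avL s h) (mean h).
  move=> e' e'0; have [t t0 ht] := (proj2 (meanP ch)) _ e'0; exists t => // g.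
  rewrite /avR /avL avg_exch avgB //; apply: avg_le => // x.
  have := ht (x * g)%g; rewrite /avR.
  by congr (nrm (avg _ _ - _) <= _); apply/funext => y; rewrite mulgA.
have mh : mean (avL s h) = mean h by exact: meanE'.
have [t t0 ht] := (proj1 (meanP ch')) _ e2; rewrite mh in ht.
exists [seq (x * y)%g | x <- s, y <- t]; first exact: allpairs_neq0.
move=> g; rewrite /avL avgD -!/(avL _ _ _) !avL_pairs opprD addrACA.
apply: le_trans (nrmD _ _) _; rewrite [leRHS]splitr; apply: lerD; last exact: ht.
by rewrite avgB //; apply: avg_le => // y; exact: hs.
Qed.

Lemma mean_sum (I : Type) (r : seq I) (F : I -> G -> E) :
  (forall i, ncont (F i)) ->
  mean (fun x => \sum_(i <- r) F i x) = \sum_(i <- r) mean (F i).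
Proof.
move=> cF; elim: r => [|i r IH].
  by under [fun x => _]funext do rewrite big_nil; rewrite big_nil mean_cst.
under [fun x => _]funext do rewrite big_cons.
by rewrite meanD ?IH ?big_cons //; exact: ncont_sum.
Qed.

Lemma mean_closed f (Q : E -> Prop) : ncont f ->
  (forall a, (forall e, 0 < e -> exists2 b, Q b & nrm (b - a) <= e) -> Q a) ->
  Q 0 -> (forall a b, Q a -> Q b -> Q (a + b)) -> (forall n a, Q a -> Q (n%:R^-1 *: a)) ->
  (forall x, Q (f x)) -> Q (mean f).
Proof.
move=> cf Qc Q0 QD QZ Qf; apply: Qc => e e0.
have [s s0 hs] := (proj1 (meanP cf)) e e0; exists (avL s f 1%g) => //.
by apply: QZ; elim/big_ind: _ => //.
Qed.

Lemma mean_le f (C : R) : ncont f -> (forall x, nrm (f x) <= C) -> nrm (mean f) <= C.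
Proof.
move=> cf h; apply/ler_addgt0Pr => e e0.
have [s s0 hs] := (proj1 (meanP cf)) e e0.
have := nrm_tri (avL s f 1%g) (mean f) 0; rewrite !subr0 (nrmBC (mean f)).
have := hs 1%g; have : nrm (avL s f 1%g) <= C by exact: avg_le.
lra.
Qed.

Lemma ncont_bounded f : compact [set: G] -> ncont f -> exists C, forall x, nrm (f x) <= C.
Proof.
move=> cG cf; have [s hs] := @finite_cover G (fun x => [set y | nrm (f x - f y) <= 1])
  cG (fun x => cf x 1 ltr01).
exists (\sum_(x <- s) nrm (f x) + 1) => y; have [x xs /= h] := hs y.
have := nrm_tri (f x) (f y) 0; rewrite !subr0 (nrmBC (f y)) => h2.
have : nrm (f x) <= \sum_(x <- s) nrm (f x).
  by rewrite (big_rem x) //= lerDl; apply: sumr_ge0.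
lra.
Qed.

Lemma unif_cont f e : compact [set: G] -> ncont f -> 0 < e ->
  \forall w \near (1%g : G), forall x, nrm (f (x * w)%g - f x) <= e.
Proof.
move=> cG cf e0; have e2 : 0 < e / 2%:R by rewrite divr_gt0.
pose P (w x : G) := nrm (f (x * w)%g - f x) <= e.
have H x : [set: G] x -> \forall x' \near x & w \near nbhs (1%g : G), P w x'.
  move=> _.
  apply: (@filterS2 _ (filter_prod (nbhs x) (nbhs (1%g : G))) _
    [set p | nrm (f x - f (p.1 * p.2)%g) <= e / 2%:R]
    [set p | nrm (f x - f p.1) <= e / 2%:R]).
  - move=> [x' w] /= h1 h2; apply: le_trans (nrm_tri (f x) _ _) _.
    by rewrite (nrmBC (f _) (f x)); lra.
  - apply: (@mulg_continuous G (x, 1%g) [set y | nrm (f x - f y) <= e / 2%:R]).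
    by rewrite /= mulg1; exact: cf.
  - exists ([set x' | nrm (f x - f x') <= e / 2%:R], setT); last by move=> [a b] [].
    by split=> /=; [exact: cf|exact: filterT].
have hU := (iffLR (compact_near_coveringP [set: G])) cG _ (nbhs (1%g : G)) P (nbhs_filter _) H.
by apply: filterS hU => w h x; exact: h.
Qed.

End Averages.

Lemma sum_le_size (R : realType) (T : Type) (s : seq T) (F : T -> R) (M : R) :
  (forall x, F x <= M) -> \sum_(x <- s) F x <= (size s)%:R * M.
Proof.
move=> h; apply: le_trans (ler_sum _ (fun i _ => h i)) _.
by rewrite big_const_seq count_predT iter_addr_0 mulr_natl.
Qed.

(** * The mean of real functions *)

Section RealMean.
Variables (R : realType) (G : topologicalGroupType).
Hypothesis cG : compact [set: G].
Implicit Types (f h u v : G -> R) (s t : seq G) (g x y : G) (e : R).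

Local Notation rnrm := (@Num.norm _ R : R^o -> R).
Local Notation rcont := (@ncont R G R R^o rnrm).

Lemma good_norm_real : @good_norm R R R^o rnrm.
Proof.
split.
- exact: ler_normD.
- exact: normrN.
- by move=> n a; rewrite normrM ger0_norm // invr_ge0.
- by move=> a; rewrite normr_le0 => /eqP.
- by move=> u d hu _; exact: real_complete hu.
Qed.

Lemma sum_pin (s : seq G) (F : G -> R) M b x0 : x0 \in s ->
  (forall x, F x <= M) -> F x0 <= b ->
  \sum_(x <- s) F x <= (size s)%:R * M - M + b.
Proof.
move=> xs h hb; rewrite (big_rem x0) //= addrC lerD //.
apply: le_trans (sum_le_size _ h) _; rewrite size_rem //.
by case: s xs => // y s _ /=; rewrite -natr1 mulrDl mul1r addrK.
Qed.

(* Averaging over translates that visit a fixed small neighbourhood from every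
   starting point contracts the oscillation by a fixed factor, and preserves the
   modulus of left continuity. *)
Lemma real_mean_approx : @mean_approx R G R R^o rnrm.
Proof.
move=> f cf e e0; have e3 : 0 < e / 3%:R by rewrite divr_gt0.
set ep := e / 3%:R in e3.
have [C hC] := ncont_bounded good_norm_real cG cf.
have hW := unif_cont good_norm_real cG cf e3; rewrite -/ep in hW.
pose W := [set w : G | forall x, `|f (x * w)%g - f x| <= ep].
have nW x : nbhs x [set y | W (x^-1 * y)%g].
  by apply: (@continuous_mulgl G (x^-1)%g x W); rewrite mulVg.
have [z hz] := finite_cover cG nW.
pose t := [seq (x^-1)%g | x <- z].
have ht g : exists2 x, x \in t & W (x * g)%g.
  by have [x xz Wx] := hz g; exists (x^-1)%g => //; exact: map_f.
have t0 : t != [::] by have [x + _] := ht 1%g; case: (t).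
pose n : R := (size t)%:R; have n0 : 0 < n by rewrite /n ltr0n; case: (t) t0.
have n1 : 1 <= n by rewrite /n ler1n; case: (t) t0.
(* One round maps a bound [D] on the oscillation to [(1 - n^-1) D + n^-1 (2 ep)]; [2 ep] is the
   fixed point of this map and the excess over it decays geometrically. *)
have contr k : exists s m M, [/\ s != [::],
    forall g, m <= avL s (f : G -> R^o) g <= M
    & M - m <= 2%:R * ep + (1 - n^-1) ^+ k * (2%:R * C)].
  elim: k => [|k [s [m [M [s0 hs hMm]]]]].
    exists [:: 1%g], (- C), C; split=> //; last by rewrite expr0 mul1r; lra.
    move=> g; have := hC g; rewrite /avL /avg big_seq1 mul1g invr1 scale1r.
    by rewrite ler_norml.
  pose v := avL s (f : G -> R^o); pose c := v 1%g.
  have hv w x : W w -> `|v (x * w)%g - v x| <= ep.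
    move=> Ww; rewrite /v /avL /avg -scalerBr -sumrB.
    rewrite normrM ger0_norm ?invr_ge0 // ler_pdivrMl; last by rewrite ltr0n; case: (s) s0.
    apply: le_trans (ler_norm_sum _ _ _) _.
    by apply: sum_le_size => y; rewrite mulgA; exact: Ww.
  have cb w : W w -> c - ep <= v w <= c + ep.
    by move=> Ww; rewrite -ler_distl; have := hv w 1%g Ww; rewrite mul1g.
  exists [seq (x * y)%g | x <- s, y <- t],
    (n^-1 * (n * m - m + (c - ep))), (n^-1 * (n * M - M + (c + ep))); split.
  - exact: allpairs_neq0.
  - move=> g; rewrite avL_pairs -/v /avg -/n; have [x xt Wx] := ht g.
    have /andP[h1 h2] := cb _ Wx.
    apply/andP; split; rewrite [_ *: _]/(_ * _) ler_pM2l ?invr_gt0 //.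
      rewrite -[leRHS]opprK -sumrN lerNr.
      apply: le_trans (@sum_pin t (fun y => - v (y * g)%g) (- m) (- (c - ep)) x xt _ _) _.
      + by move=> y; rewrite lerN2; case/andP: (hs (y * g)%g).
      + by rewrite lerN2.
      + by rewrite -/n; lra.
    by apply: (@sum_pin t (fun y => v (y * g)%g) _ _ x) => // y; case/andP: (hs (y * g)%g).
  - rewrite -mulrBr exprS -mulrA; set q := (1 - n^-1) ^+ k * (2%:R * C) in hMm *.
    have ni : 0 < n^-1 by rewrite invr_gt0.
    have ni1 : n^-1 <= 1 by rewrite invf_le1.
    have -> : n^-1 * (n * M - M + (c + ep) - (n * m - m + (c - ep)))
        = (1 - n^-1) * (M - m) + n^-1 * (2%:R * ep).
      have nn : n^-1 * n = 1 by rewrite mulVf // gt_eqF.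
      have -> : n * M - M + (c + ep) - (n * m - m + (c - ep))
        = n * (M - m) - (M - m) + 2%:R * ep by ring.
      by rewrite mulrDr mulrBr mulrA nn; ring.
    have : (1 - n^-1) * (M - m) <= (1 - n^-1) * (2%:R * ep + q).
      by rewrite ler_wpM2l // subr_ge0.
    lra.
have [N hN] : exists k, (1 - n^-1) ^+ k * (2%:R * C) <= ep.
  have C0 : 0 <= C by apply: le_trans (hC 1%g).
  have C1 : 0 < 2%:R * C + 1 by lra.
  have nib : 0 <= 1 - n^-1 < 1.
    by rewrite subr_ge0 invf_le1 // n1 /= gtrBl invr_gt0.
  have [N hN] := expr_small nib (divr_gt0 e3 C1); exists N.
  have := hN N (leqnn N); rewrite ler_pdivlMr //; apply: le_trans.
  by rewrite ler_wpM2l ?exprn_ge0 ?lerDl //; case/andP: nib.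
have [s [m [M [s0 hs hMm]]]] := contr N.
exists s, m; split=> // g; have /andP[h1 h2] := hs g.
rewrite ger0_norm ?subr_ge0 //; move: hMm h2; rewrite /ep in hN *; lra.
Qed.

Definition I (f : G -> R) : R := mean rnrm (f : G -> R^o).

Definition rc f : Prop := rcont f.

Lemma rc_cst (c : R) : rc (fun=> c).
Proof. exact: (ncont_cst good_norm_real). Qed.

Lemma rcD f h : rc f -> rc h -> rc (fun x => f x + h x).
Proof. exact: (ncontD good_norm_real). Qed.

Lemma rc_sum (T : Type) (r : seq T) (F : T -> G -> R) :
  (forall i, rc (F i)) -> rc (fun x => \sum_(i <- r) F i x).
Proof. exact: (ncont_sum good_norm_real). Qed.

Lemma rc_mulgl x f : rc f -> rc (fun g => f (x * g)%g).
Proof. exact: ncont_mulgl. Qed.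

Lemma rc_mulgr x f : rc f -> rc (fun g => f (g * x)%g).
Proof. exact: ncont_mulgr. Qed.

Lemma rc_inv f : rc f -> rc (fun g => f (g^-1)%g).
Proof. exact: ncont_inv. Qed.

Lemma rc_bounded f : rc f -> exists2 C, 0 < C & forall x, `|f x| <= C.
Proof.
move=> cf; have [C hC] := ncont_bounded good_norm_real cG cf.
exists (C + 1) => [|x]; last by apply: le_trans (hC x) _; rewrite lerDl.
by apply: le_lt_trans (le_trans (normr_ge0 _) (hC 1%g)) _; rewrite ltrDl.
Qed.

Lemma rcM f h : rc f -> rc h -> rc (fun x => f x * h x).
Proof.
move=> cf ch; have [C C0 hC] := rc_bounded cf; have [D D0 hD] := rc_bounded ch.
move=> x e e0; have CD : 0 < C + D by rewrite addr_gt0.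
have e1 : 0 < e / (C + D) by rewrite divr_gt0.
near=> y.
have h1 : `|f x - f y| <= e / (C + D) by near: y; exact: cf.
have h2 : `|h x - h y| <= e / (C + D) by near: y; exact: ch.
have -> : f x * h x - f y * h y = f x * (h x - h y) + (f x - f y) * h y by ring.
apply: le_trans (ler_normD _ _) _; rewrite !normrM.
have : `|f x| * `|h x - h y| <= C * (e / (C + D)) by rewrite ler_pM.
have : `|f x - f y| * `|h y| <= (e / (C + D)) * D by rewrite ler_pM.
have : (C + D) * (e / (C + D)) = e by rewrite mulrCA divff ?mulr1 // gt_eqF.
rewrite mulrDl; lra.
Unshelve. all: by end_near. Qed.

Lemma rcN f : rc f -> rc (fun x => - f x).
Proof.
move=> cf; have := rcM (rc_cst (- 1)) cf.
by congr rc; apply/funext => x; rewrite mulN1r.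
Qed.

Lemma rcB f h : rc f -> rc h -> rc (fun x => f x - h x).
Proof. by move=> cf ch; apply: rcD => //; exact: rcN. Qed.

Lemma rc_lip (E' : zmodType) (nrm' : E' -> R) (f' : G -> E') (L : E' -> R) (C : R) :
  0 <= C -> (forall a b, `|L a - L b| <= C * nrm' (a - b)) ->
  (forall x e, 0 < e -> \forall y \near x, nrm' (f' x - f' y) <= e) ->
  rc (fun x => L (f' x)).
Proof. exact: (@ncont_lip R G R R^o rnrm). Qed.

Lemma rc_max0 f : rc f -> rc (fun x => Num.max 0 (f x)).
Proof.
move=> cf; apply: (@rc_lip R Num.norm f (Num.max 0) 1) => // a b; rewrite mul1r.
by rewrite !maxEle; case: (leP 0 a) => ha; case: (leP 0 b) => hb;
  rewrite ?subrr ?normr0 ?subr0 ?sub0r ?normrN // ler_norml; have := ler_norm (a - b);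
  have := ler_norm (b - a); rewrite (distrC b); lra.
Qed.

Lemma ID f h : rc f -> rc h -> I (fun x => f x + h x) = I f + I h.
Proof. exact: (meanD good_norm_real real_mean_approx). Qed.

Lemma I_cst (c : R) : I (fun=> c) = c.
Proof. exact: (mean_cst good_norm_real real_mean_approx). Qed.

Lemma I_mulgl x f : rc f -> I (fun g => f (x * g)%g) = I f.
Proof. exact: (mean_mulgl good_norm_real real_mean_approx). Qed.

Lemma I_mulgr x f : rc f -> I (fun g => f (g * x)%g) = I f.
Proof. exact: (mean_mulgr good_norm_real real_mean_approx). Qed.

Lemma I_inv f : rc f -> I (fun g => f (g^-1)%g) = I f.
Proof. exact: (mean_inv good_norm_real real_mean_approx). Qed.

Lemma I_sum (T : Type) (r : seq T) (F : T -> G -> R) : (forall i, rc (F i)) ->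
  I (fun x => \sum_(i <- r) F i x) = \sum_(i <- r) I (F i).
Proof. exact: (mean_sum good_norm_real real_mean_approx). Qed.

Lemma I_norm_le f (C : R) : rc f -> (forall x, `|f x| <= C) -> `|I f| <= C.
Proof. exact: (mean_le good_norm_real real_mean_approx). Qed.

Lemma IZ (c : R) f : rc f -> I (fun x => c * f x) = c * I f.
Proof.
move=> cf; apply: (meanE good_norm_real real_mean_approx).
  exact: rcM (rc_cst c) cf.
have [hL _] := meanP good_norm_real real_mean_approx cf.
move=> e e0; have c1 : 0 < `|c| + 1 by rewrite ltr_wpDl.
have [s s0 hs] := hL _ (divr_gt0 e0 c1); exists s => // g.
have -> : avL s (fun x => c * f x : R^o) g = c * avL s (f : G -> R^o) g.
  by rewrite /avL /avg -mulr_sumr [RHS]mulrCA.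
rewrite -mulrBr normrM; apply: le_trans (ler_wpM2l (normr_ge0 c) (hs g)) _.
by rewrite mulrA ler_pdivrMr // mulrC ler_wpM2l ?(ltW e0) // lerDl.
Qed.

Lemma IN f : rc f -> I (fun x => - f x) = - I f.
Proof.
move=> cf; rewrite -mulN1r -IZ //; congr I.
by apply/funext => x; rewrite mulN1r.
Qed.

Lemma IB f h : rc f -> rc h -> I (fun x => f x - h x) = I f - I h.
Proof. by move=> cf ch; rewrite ID ?IN //; exact: rcN. Qed.

Lemma I_ge0 f : rc f -> (forall x, 0 <= f x) -> 0 <= I f.
Proof.
move=> cf f0.
apply: (mean_closed good_norm_real real_mean_approx (Q := fun a => 0 <= a) cf) => //.
- move=> a ha; apply/ler_addgt0Pr => e /ha[b b0].
  by rewrite ler_norml => /andP[_]; lra.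
- by move=> a b; exact: addr_ge0.
- by move=> n a a0; rewrite mulr_ge0 // invr_ge0.
Qed.

Lemma I_le f h : rc f -> rc h -> (forall x, f x <= h x) -> I f <= I h.
Proof.
by move=> cf ch fh; rewrite -subr_ge0 -IB //; apply: I_ge0 => [|x]; [exact: rcB|rewrite subr_ge0].
Qed.

(** The sets where finitely many translates of [f] are at least [f 1 / 2] cover [G]. The sum of
    these translates is at least that constant, and each has mean [I f]. *)
Lemma I_gt0 f : rc f -> (forall x, 0 <= f x) -> 0 < f 1%g -> 0 < I f.
Proof.
move=> cf f0 f1; pose c := f 1%g / 2%:R; have c0 : 0 < c by rewrite divr_gt0.
have nW x : nbhs x [set y | c <= f (x^-1 * y)%g].
  apply: (@continuous_mulgl G (x^-1)%g x [set w | c <= f w]); rewrite mulVg.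
  apply: filterS (cf 1%g c c0) => w /=; rewrite ler_norml /c; lra.
have [s hs] := finite_cover cG nW.
have : c <= I (fun g => \sum_(x <- s) f (x^-1 * g)%g).
  rewrite -{1}(I_cst c); apply: I_le => [||y]; first exact: rc_cst.
    by apply: rc_sum => x; exact: rc_mulgl.
  have [x xs hx] := hs y; rewrite (big_rem x) //=; apply: le_trans hx _.
  by rewrite lerDl; apply: sumr_ge0.
rewrite I_sum; last by move=> x; exact: rc_mulgl.
under eq_bigr do rewrite I_mulgl //.
rewrite big_const_seq count_predT iter_addr_0 -mulr_natl => h.
rewrite ltNge; apply/negP => I0; have : 0 <= (size s)%:R :> R by [].
by nra.
Qed.

Lemma I_sq_eq0 f : rc f -> I (fun x => f x * f x) = 0 -> forall x, f x = 0.
Proof.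
move=> cf I0 x; apply/eqP; apply: contraT => fx.
suff : 0 < I (fun y => f (x * y)%g * f (x * y)%g).
  by rewrite (I_mulgl x (f := fun y => f y * f y)) ?I0 ?ltxx //; exact: rcM.
apply: I_gt0 => [|y|].
- by apply: (rcM (f := fun y => f (x * y)%g)); exact: rc_mulgl.
- by rewrite -expr2 sqr_ge0.
- by rewrite mulg1 -expr2 exprn_even_gt0.
Qed.

End RealMean.

(** * The mean of [A]-valued functions *)

Section VectorMean.
Variables (R : realType) (A : cstarAlgType R) (G : topologicalGroupType).
Hypothesis cG : compact [set: G].
Implicit Types (f h : G -> A) (u v : G -> R) (s t : seq G) (g x y : G) (e : R).

Local Notation anrm := (@nm R A).
Local Notation vc := (@ncont R G R[i] A anrm).

Lemma good_norm_nm : @good_norm R R[i] A anrm.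
Proof.
split.
- exact: nmD.
- exact: nmN.
- by move=> n a; rewrite nmZ cmV cnatE cm_real ger0_norm.
- by move=> a a0; apply/eqP; rewrite -nm_eq0 eq_le a0 nm_ge0.
- exact: nm_complete.
Qed.

Lemma rcV u : rc u -> (forall x, 0 < u x) -> rc (fun x => (u x)^-1).
Proof.
move=> cu u0 x e e0; have ux := u0 x.
pose d := Num.min (u x / 2%:R) (e * (u x * u x) / 2%:R).
have d0 : 0 < d by rewrite lt_min !divr_gt0 //= mulr_gt0 // mulr_gt0.
apply: filterS (cu x d d0) => y; rewrite le_min => /andP[h1 h2].
have uy : u x / 2%:R <= u y by move: h1; rewrite ler_norml; lra.
have uy0 := u0 y; have uxy : 0 < u x * u y by rewrite mulr_gt0.
have -> : (u x)^-1 - (u y)^-1 = (u y - u x) / (u x * u y).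
  by field; rewrite !gt_eqF.
rewrite normrM distrC normfV (gtr0_norm uxy) ler_pdivrMr //; apply: le_trans h2 _.
rewrite -mulrA ler_wpM2l ?(ltW e0) // -mulrA ler_wpM2l ?(ltW ux) //.
Qed.

(** The weights [e - nm (f x - f y)], cut off at 0 and normalized, are a partition of unity that
    only mixes values within [e] of [f y]. This reduces means of vectors to means of real
    functions. *)
Lemma vector_partition f e : vc f -> 0 < e -> exists s (u : G -> G -> R),
  (forall x, rc (u x)) /\
  forall y, nm (f y - \sum_(x <- s) (u x y)%:C *: f x) <= e.
Proof.
move=> cf e0; have e2 : 0 < e / 2%:R by rewrite divr_gt0.
have [s hs] := @finite_cover G (fun x => [set y | nm (f x - f y) <= e / 2%:R]) cG
  (fun x => cf x _ e2).
pose d x y := Num.max 0 (e - nm (f x - f y)).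
have d0 x y : 0 <= d x y by rewrite le_max lexx.
have cd x : rc (d x).
  apply: rc_max0; have := @rc_lip R G A anrm f (fun a => e - nm (f x - a)) 1 ler01; apply=> // a b.
  rewrite mul1r; have h1 := nm_triangle b (f x) a; have h2 := nm_triangle a (f x) b.
  by rewrite (nmBC b a) in h1; rewrite ler_norml; apply/andP; split; lra.
pose D y := \sum_(x <- s) d x y.
have D0 y : 0 < D y.
  have [x xs hx] := hs y; rewrite /D (big_rem x) //=; apply: ltr_wpDr; first exact: sumr_ge0.
  by rewrite lt_max; apply/orP; right; move: hx => /=; lra.
have cD : rc D by exact: rc_sum.
exists s, (fun x y => d x y * (D y)^-1); split.
  by move=> x; apply: rcM => //; exact: rcV.
move=> y; have su : \sum_(x <- s) d x y * (D y)^-1 = 1.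
  by rewrite -mulr_suml -/(D y) divff // gt_eqF.
have -> : f y - \sum_(x <- s) (d x y * (D y)^-1)%:C *: f x =
    \sum_(x <- s) (d x y * (D y)^-1)%:C *: (f y - f x).
  under [RHS]eq_bigr do rewrite scalerBr.
  by rewrite sumrB -scaler_suml -rmorph_sum su scale1r.
apply: le_trans (nm_sum _ _ _) _.
rewrite -[leRHS]mul1r -su mulr_suml; apply: ler_sum => x _.
have q0 : 0 <= d x y * (D y)^-1 by rewrite mulr_ge0 // invr_ge0 ltW.
rewrite nmZ cm_real ger0_norm //.
have [h|h] := leP (nm (f x - f y)) e; first by rewrite ler_wpM2l // nmBC.
by rewrite /d (_ : Num.max _ _ = 0) ?mul0r //; apply/max_idPl; lra.
Qed.

Lemma I_avL s u : s != [::] -> rc u -> I (avL s (u : G -> R^o)) = I u.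
Proof.
move=> s0 cu; rewrite /avL /avg.
have cs : rc (fun g => \sum_(x <- s) u (x * g)%g).
  by apply: (@rc_sum R G _ s (fun x g => u (x * g)%g)) => x; exact: rc_mulgl.
rewrite (IZ cG _ cs) (I_sum cG); last by move=> x; exact: rc_mulgl.
under eq_bigr do rewrite (I_mulgl cG) //.
rewrite big_const_seq count_predT iter_addr_0 -[I u *+ _]mulr_natl mulrA mulVf ?mul1r //.
exact: size_neq0.
Qed.

Lemma simultaneous_mean (T : eqType) (F : T -> G -> R) (r : seq T) e :
  (forall i, rc (F i)) -> 0 < e ->
  exists2 s, s != [::] &
    forall i, i \in r -> forall g, `|avL s (F i : G -> R^o) g - I (F i)| <= e.
Proof.
move=> cF e0; elim: r => [|i r [s s0 hs]]; first by exists [:: 1%g].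
have ch : rc (avL s (F i : G -> R^o)) by apply: (ncont_avL (good_norm_real R)); exact: cF.
have [hL _] := meanP (good_norm_real R) (real_mean_approx cG) ch.
have [t t0 ht] := hL e e0.
exists [seq (x * y)%g | x <- s, y <- t]; first exact: allpairs_neq0.
move=> j; rewrite inE => /predU1P[->|jr] g; rewrite avL_pairs.
  by have := ht g; rewrite -[mean _ _]/(I _) I_avL.
rewrite avgB //; apply: (avg_le (good_norm_real R)) => // y; exact: hs.
Qed.

Lemma avg_scale s u (a : A) : avg s (fun x => (u x)%:C *: a) = (avg s (u : G -> R^o))%:C *: a.
Proof.
rewrite /avg -scaler_suml scalerA; congr (_ *: _).
by rewrite [_ *: _ in RHS]/(_ * _) rmorphM rmorph_sum fmorphV rmorph_nat.
Qed.

Lemma vector_mean_approx : @mean_approx R G R[i] A anrm.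
Proof.
move=> f cf e e0; have e2 : 0 < e / 2%:R by rewrite divr_gt0.
have [r [u [cu hu]]] := vector_partition cf e2.
pose N := \sum_(x <- r) nm (f x); have N0 : 0 <= N by apply: sumr_ge0 => x _; exact: nm_ge0.
have N1 : 0 < N + 1 by lra.
have [s s0 hs] := simultaneous_mean r cu (divr_gt0 e2 N1).
exists s, (\sum_(x <- r) (I (u x))%:C *: f x); split=> // g.
pose P y := \sum_(x <- r) (u x y)%:C *: f x.
apply: le_trans (nm_triangle (avL s P g) _ _) _; rewrite [leRHS]splitr; apply: lerD.
  have -> : avL s f g - avL s P g = avg s (fun x => f (x * g)%g - P (x * g)%g).
    by rewrite /avL /avg -scalerBr sumrB.
  by apply: (avg_le good_norm_nm) => // x; exact: hu.
have -> : avL s P g = \sum_(x <- r) (avL s (u x : G -> R^o) g)%:C *: f x.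
  rewrite /avL /P /avg exchange_big scaler_sumr; apply: eq_bigr => x _.
  exact: (avg_scale s (fun y => u x (y * g)%g)).
rewrite -sumrB; apply: le_trans (nm_sum _ _ _) _.
apply: le_trans (_ : \sum_(x <- r) (e / 2%:R / (N + 1)) * nm (f x) <= _).
  rewrite big_seq [leRHS]big_seq; apply: ler_sum => x xr.
  rewrite -scalerBl nmZ -rmorphB cm_real ler_wpM2r ?nm_ge0 //; exact: hs.
rewrite -mulr_sumr mulrAC ler_pdivrMr // ler_wpM2l ?(ltW e2) // /N; lra.
Qed.

Definition J f : A := mean anrm f.

Lemma vc_cst a : vc (fun=> a). Proof. exact: (ncont_cst good_norm_nm). Qed.

Lemma vcD f h : vc f -> vc h -> vc (fun x => f x + h x).
Proof. exact: (ncontD good_norm_nm). Qed.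

Lemma vc_sum (T : Type) (r : seq T) (F : T -> G -> A) :
  (forall i, vc (F i)) -> vc (fun x => \sum_(i <- r) F i x).
Proof. exact: (ncont_sum good_norm_nm). Qed.

Lemma vc_lip f (L : A -> A) (C : R) : 0 <= C ->
  (forall a b, nm (L a - L b) <= C * nm (a - b)) -> vc f -> vc (fun x => L (f x)).
Proof. by move=> C0 hL cf; exact: (@ncont_lip R G R[i] A anrm A anrm f L C). Qed.

Lemma vcZ u f : rc u -> vc f -> vc (fun x => (u x)%:C *: f x).
Proof.
move=> cu cf; have [C C0 hC] := rc_bounded cG cu.
have [D' hD'] := ncont_bounded good_norm_nm cG cf.
have D'0 : 0 <= D' by apply: le_trans (hD' 1%g); exact: nm_ge0.
move=> x e e0; have CD : 0 < C + D' by rewrite ltr_wpDr.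
have e1 : 0 < e / (C + D') by rewrite divr_gt0.
near=> y.
have h1 : `|u x - u y| <= e / (C + D') by near: y; exact: cu.
have h2 : nm (f x - f y) <= e / (C + D') by near: y; exact: cf.
have -> : (u x)%:C *: f x - (u y)%:C *: f y =
    (u x)%:C *: (f x - f y) + (u x - u y)%:C *: f y.
  by rewrite scalerBr rmorphB scalerBl addrA subrK.
apply: le_trans (nmD _ _) _; rewrite !nmZ !cm_real.
have : `|u x| * nm (f x - f y) <= C * (e / (C + D')) by rewrite ler_pM ?nm_ge0.
have : `|u x - u y| * nm (f y) <= (e / (C + D')) * D' by rewrite ler_pM ?nm_ge0.
have : (C + D') * (e / (C + D')) = e by rewrite mulrCA divff ?mulr1 // gt_eqF.
rewrite mulrDl; lra.
Unshelve. all: by end_near. Qed.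

Lemma vc_mulgl x f : vc f -> vc (fun g => f (x * g)%g).
Proof. exact: ncont_mulgl. Qed.

Lemma JD f h : vc f -> vc h -> J (fun x => f x + h x) = J f + J h.
Proof. exact: (meanD good_norm_nm vector_mean_approx). Qed.

Lemma J_cst a : J (fun=> a) = a.
Proof. exact: (mean_cst good_norm_nm vector_mean_approx). Qed.

Lemma J_mulgl x f : vc f -> J (fun g => f (x * g)%g) = J f.
Proof. exact: (mean_mulgl good_norm_nm vector_mean_approx). Qed.

Lemma J_sum (T : Type) (r : seq T) (F : T -> G -> A) : (forall i, vc (F i)) ->
  J (fun x => \sum_(i <- r) F i x) = \sum_(i <- r) J (F i).
Proof. exact: (mean_sum good_norm_nm vector_mean_approx). Qed.

Lemma J_le f (C : R) : vc f -> (forall x, nm (f x) <= C) -> nm (J f) <= C.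
Proof. exact: (mean_le good_norm_nm vector_mean_approx). Qed.

Lemma J_closed f (Q : A -> Prop) : vc f ->
  (forall a, (forall e, 0 < e -> exists2 b, Q b & nm (b - a) <= e) -> Q a) ->
  Q 0 -> (forall a b, Q a -> Q b -> Q (a + b)) ->
  (forall (n : nat) a, Q a -> Q (n%:R^-1 *: a)) ->
  (forall x, Q (f x)) -> Q (J f).
Proof. exact: (mean_closed good_norm_nm vector_mean_approx). Qed.

Lemma J_lin f (L : A -> A) (C : R) : 0 <= C ->
  (forall a b, L (a + b) = L a + L b) -> (forall (k : R[i]) a, L (k *: a) = k *: L a) ->
  (forall a, nm (L a) <= C * nm a) -> vc f -> J (fun x => L (f x)) = L (J f).
Proof.
move=> C0 LD LZ LC cf.
have LB a b : L (a - b) = L a - L b.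
  by rewrite LD -[- b]scaleN1r LZ scaleN1r.
have L0 : L 0 = 0 by have := LZ 0 0; rewrite !scale0r.
apply: (meanE good_norm_nm vector_mean_approx).
  by apply: vc_lip C0 _ cf => a b; rewrite -LB.
have [hL _] := meanP good_norm_nm vector_mean_approx cf.
move=> e e0; have c1 : 0 < C + 1 by rewrite ltr_wpDl.
have [s s0 hs] := hL _ (divr_gt0 e0 c1); exists s => // g.
have -> : avL s (fun x => L (f x)) g = L (avL s f g).
  by rewrite /avL /avg LZ; congr (_ *: _); rewrite (big_morph L LD L0).
rewrite -LB; apply: le_trans (LC _) _; apply: le_trans (ler_wpM2l C0 (hs g)) _.
by rewrite mulrA ler_pdivrMr // mulrC ler_wpM2l ?(ltW e0) // lerDl.
Qed.

Lemma JZ (k : R[i]) f : vc f -> J (fun x => k *: f x) = k *: J f.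
Proof.
move=> cf; apply: (J_lin (L := fun a => k *: a) (cm_ge0 k)) => //.
- by move=> a b; rewrite scalerDr.
- by move=> l a; rewrite !scalerA mulrC.
- by move=> a; rewrite nmZ.
Qed.

Lemma J_scale u (a : A) : rc u -> J (fun x => (u x)%:C *: a) = (I u)%:C *: a.
Proof.
move=> cu; apply: (meanE good_norm_nm vector_mean_approx).
  by apply: vcZ => //; exact: vc_cst.
have [hL _] := meanP (good_norm_real R) (real_mean_approx cG) cu.
move=> e e0; have c1 : 0 < nm a + 1 by rewrite ltr_wpDl ?nm_ge0.
have [s s0 hs] := hL _ (divr_gt0 e0 c1); exists s => // g.
have -> : avL s (fun x => (u x)%:C *: a) g = (avL s (u : G -> R^o) g)%:C *: a.
  exact: (avg_scale s (fun x => u (x * g)%g)).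
rewrite -scalerBl -rmorphB nmZ cm_real.
apply: le_trans (ler_wpM2r (nm_ge0 a) (hs g)) _.
by rewrite mulrAC ler_pdivrMr // ler_wpM2l ?(ltW e0) // lerDl.
Qed.

(** Choose a list [s] whose average of [u] is everywhere below [I u + e]. Replacing [f] by [avL s f]
    does not change [J f], and [avL s f] is pointwise dominated by that average. *)
Lemma nm_J_le f u : vc f -> rc u -> (forall x, nm (f x) <= u x) -> nm (J f) <= I u.
Proof.
move=> cf cu h; apply/ler_addgt0Pr => e e0.
have [hL _] := meanP (good_norm_real R) (real_mean_approx cG) cu.
have [s s0 hs] := hL _ e0.
have cs : vc (fun g => \sum_(x <- s) f (x * g)%g).
  by apply: (@vc_sum _ s (fun x g => f (x * g)%g)) => x; exact: vc_mulgl.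
have -> : J f = J (avL s f).
  rewrite /avL /avg JZ // J_sum; last by move=> x; exact: vc_mulgl.
  under eq_bigr do rewrite J_mulgl //.
  rewrite big_const_seq count_predT iter_addr_0 -[J f *+ _]scaler_nat scalerA.
  by rewrite mulVf ?scale1r // size_neq0.
apply: J_le; first exact: (ncont_avL good_norm_nm).
move=> g; apply: le_trans (_ : avL s (u : G -> R^o) g <= _); last first.
  by have := hs g; rewrite ler_norml -[mean _ _]/(I _); lra.
rewrite /avL /avg nmZ cmV cnatE cm_real ger0_norm // [_ *: _]/(_ * _).
rewrite ler_wpM2l ?invr_ge0 //; apply: le_trans (nm_sum _ _ _) _.
exact: ler_sum.
Qed.

End VectorMean.

(** * Fubini's theorem, the inner product and convolution *)

Section Convolution.
Variables (R : realType) (G : topologicalGroupType).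
Hypothesis cG : compact [set: G].
Implicit Types (f h k u v w : G -> R) (g x y z : G) (e c : R) (F : G -> G -> R).

Definition unif F : Prop :=
  forall y e, 0 < e -> \forall y' \near y, forall x, `|F x y - F x y'| <= e.

(** Continuity in each variable uniformly in the other, with a bound: on a compact group a form of
    joint continuity, and one that products and means preserve. *)
Definition joint F : Prop :=
  [/\ unif F, unif (fun x y => F y x) & exists2 C, 0 < C & forall x y, `|F x y| <= C].

Lemma unif_rc F x : unif F -> rc (F x).
Proof. by move=> uF y e e0; apply: filterS (uF y e e0) => y'; apply. Qed.

Lemma unif_comp F (phi : G -> G) : continuous phi -> unif F -> unif (fun x y => F x (phi y)).
Proof. by move=> cphi uF y e e0; exact: (cphi y _ (uF (phi y) e e0)). Qed.

Lemma joint_sym F : joint F -> joint (fun x y => F y x).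
Proof. by move=> [h1 h2 [C C0 hC]]; split=> //; exists C. Qed.

Lemma joint_snd h : rc h -> joint (fun _ y => h y).
Proof.
move=> ch; have [C C0 hC] := rc_bounded cG ch; split; last by exists C.
- by move=> y e e0; apply: filterS (ch y e e0).
- by move=> y e e0; apply: nearW => y' x; rewrite subrr normr0 ltW.
Qed.

Lemma joint_fst h : rc h -> joint (fun x _ => h x).
Proof. by move=> ch; apply: joint_sym; exact: joint_snd. Qed.

Lemma jointM F F' : joint F -> joint F' -> joint (fun x y => F x y * F' x y).
Proof.
have aux (H H' : G -> G -> R) (C D : R) : 0 < C -> 0 < D -> unif H -> unif H' ->
    (forall x y, `|H x y| <= C) -> (forall x y, `|H' x y| <= D) ->
    unif (fun x y => H x y * H' x y).
  move=> C0 D0 uH uH' hC hD y e e0; have CD : 0 < C + D by rewrite addr_gt0.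
  have e1 : 0 < e / (C + D) by rewrite divr_gt0.
  apply: filterS2 (uH y _ e1) (uH' y _ e1) => y' h1 h2 x.
  have -> : H x y * H' x y - H x y' * H' x y' =
    H x y * (H' x y - H' x y') + (H x y - H x y') * H' x y' by ring.
  apply: le_trans (ler_normD _ _) _; rewrite !normrM.
  have : `|H x y| * `|H' x y - H' x y'| <= C * (e / (C + D)) by rewrite ler_pM.
  have : `|H x y - H x y'| * `|H' x y'| <= (e / (C + D)) * D by rewrite ler_pM.
  have : (C + D) * (e / (C + D)) = e by rewrite mulrCA divff ?mulr1 // gt_eqF.
  rewrite mulrDl; lra.
move=> [u1 u2 [C C0 hC]] [v1 v2 [D D0 hD]]; split.
- exact: (aux _ _ C D).
- exact: (aux _ _ C D).
- by exists (C * D); [rewrite mulr_gt0|move=> x y; rewrite normrM ler_pM].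
Qed.

Lemma unif_mul h (a : G -> G) : rc h -> unif (fun x y => h (a x * y)%g).
Proof.
move=> ch y e e0; have hW := unif_cont (good_norm_real R) cG ch e0.
have := @continuous_mulgl G (y^-1)%g y _.
rewrite mulVg => /(_ _ hW) /= hN.
have {}hN : \forall y' \near y, forall x, `|h (x * (y^-1 * y'))%g - h x| <= e := hN.
apply: filterS hN => y' hy x.
by have := hy (a x * y)%g; rewrite -mulgA mulVKg distrC.
Qed.

Lemma joint_mul h : rc h -> joint (fun x y => h (x * y)%g).
Proof.
move=> ch; have [C C0 hC] := rc_bounded cG ch; split; last by exists C.
- exact: (unif_mul id ch).
- have := unif_comp (@invg_continuous G) (unif_mul (fun x => x^-1)%g (rc_inv ch)).
  by congr unif; apply/funext => x; apply/funext => y; rewrite -invgM invgK.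
Qed.

Lemma joint_div h : rc h -> joint (fun x y => h (x^-1 * y)%g).
Proof.
move=> /joint_mul[u1 u2 [C C0 hC]]; split; last by exists C.
- by move=> y e e0; apply: filterS (u1 y e e0) => y' hy x; exact: hy.
- exact: (unif_comp (@invg_continuous G) u2).
Qed.

Lemma joint_rc_fst F y : joint F -> rc (fun x => F x y).
Proof. by move=> [_ u2 _]; exact: unif_rc u2. Qed.

Lemma joint_rc_snd F x : joint F -> rc (F x).
Proof. by move=> [u1 _ _]; exact: unif_rc u1. Qed.

Lemma rc_I F : joint F -> rc (fun y => I (fun x => F x y)).
Proof.
move=> jF y e e0; case: (jF) => u1 _ _; apply: filterS (u1 y e e0) => y' hy.
have c1 := joint_rc_fst y jF; have c2 := joint_rc_fst y' jF.
by rewrite -IB //; apply: I_norm_le => //; exact: rcB.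
Qed.

(** One list [s] averages in [x] both [Phi] and the sections at finitely many [y]; equicontinuity
    extends this to all [y], so the average [a] is uniformly close to [Psi]. Its mean in [y] is an
    average of [Phi], hence close to [I Phi]. *)
Lemma fubini F : joint F ->
  I (fun x => I (fun y => F x y)) = I (fun y => I (fun x => F x y)).
Proof.
move=> jF; apply/eqP; rewrite -subr_eq0 -normr_eq0 eq_le normr_ge0 andbT.
apply/ler_addgt0Pr => e e0; rewrite add0r; have e5 : 0 < e / 5%:R by rewrite divr_gt0.
set d := e / 5%:R in e5; case: (jF) => u1 u2 _.
have [r hr] := finite_cover cG (fun y => u1 y d e5).
pose Phi x := I (F x); pose Psi y := I (fun x => F x y).
have cPhi : rc Phi by exact: (rc_I (joint_sym jF)).
have cPsi : rc Psi by exact: rc_I.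
pose H (o : option G) : G -> R := if o is Some y then fun x => F x y else Phi.
have cH o : rc (H o) by case: o => [y|] //=; exact: joint_rc_fst.
have [s s0 hs] := simultaneous_mean cG (None :: map Some r) cH e5.
pose a y := avL s (H (Some y) : G -> R^o) 1%g.
have aE y : a y = (size s)%:R^-1 * \sum_(x <- s) F x y.
  by rewrite /a /avL /avg /=; congr (_ * _); apply: eq_bigr => x _; rewrite mulg1.
have ca : rc a.
  rewrite (_ : a = fun y => (size s)%:R^-1 * \sum_(x <- s) F x y); last exact/funext.
  apply: rcM => //; first exact: rc_cst.
  by apply: rc_sum => x; exact: joint_rc_snd.
have haP y : `|a y - Psi y| <= 3%:R * d.
  have [y0 y0r hy] := hr y.
  have h1 : `|a y0 - a y| <= d.
    rewrite !aE -mulrBr -sumrB normrM ger0_norm ?invr_ge0 // ler_pdivrMl; last first.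
      by rewrite ltr0n; case: (s) s0.
    by apply: le_trans (ler_norm_sum _ _ _) _; apply: sum_le_size => x; exact: hy.
  have h2 : `|a y0 - Psi y0| <= d.
    by apply: (hs (Some y0)); rewrite inE; apply/orP; right; exact: map_f.
  have h3 : `|Psi y0 - Psi y| <= d.
    have c1 := joint_rc_fst y jF; have c2 := joint_rc_fst y0 jF.
    by rewrite -IB //; apply: I_norm_le => //; exact: rcB.
  rewrite distrC in h1; have -> : 3%:R * d = d + (d + d) by ring.
  apply: le_trans (ler_distD (a y0) _ _) _; rewrite lerD //.
  by apply: le_trans (ler_distD (Psi y0) _ _) _; rewrite lerD.
have Ia : I a = avL s (Phi : G -> R^o) 1%g.
  rewrite (_ : a = fun y => (size s)%:R^-1 * \sum_(x <- s) F x y); last exact/funext.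
  rewrite IZ //; last by apply: rc_sum => x; exact: joint_rc_snd.
  rewrite I_sum //; last by move=> x; exact: joint_rc_snd.
  by rewrite /avL /avg; congr (_ * _); apply: eq_bigr => x _; rewrite mulg1.
have h1 : `|I a - I Phi| <= d by rewrite Ia; apply: (hs None); rewrite mem_head.
have h2 : `|I a - I Psi| <= 3%:R * d.
  by rewrite -IB //; apply: I_norm_le => //; exact: rcB.
rewrite distrC in h1; suff : `|I Phi - I Psi| <= e by [].
have -> : e = d + 3%:R * d + d by rewrite /d; field.
apply: le_trans (ler_distD (I a) _ _) _; apply: le_trans (lerD h1 h2) _.
by rewrite lerDl ltW.
Qed.

Definition ip f h : R := I (fun x => f x * h x).

Definition conv f h : G -> R := fun x => I (fun y => f y * h (y^-1 * x)%g).

Definition nrm2 f : R := Num.sqrt (ip f f).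

Lemma ipC f h : ip f h = ip h f.
Proof. by congr I; apply/funext => x; rewrite mulrC. Qed.

Lemma ipDl f f' h : rc f -> rc f' -> rc h -> ip (fun x => f x + f' x) h = ip f h + ip f' h.
Proof.
move=> cf cf' ch; rewrite -ID //; try exact: rcM.
by congr I; apply/funext => x; rewrite mulrDl.
Qed.

Lemma ipZl c f h : rc f -> rc h -> ip (fun x => c * f x) h = c * ip f h.
Proof.
move=> cf ch; rewrite -IZ //; last exact: rcM.
by congr I; apply/funext => x; rewrite mulrA.
Qed.

Lemma ipBl f f' h : rc f -> rc f' -> rc h -> ip (fun x => f x - f' x) h = ip f h - ip f' h.
Proof.
move=> cf cf' ch; rewrite -IB //; try exact: rcM.
by congr I; apply/funext => x; rewrite mulrBl.
Qed.

Lemma ip_ge0 f : rc f -> 0 <= ip f f.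
Proof. by move=> cf; apply: I_ge0 => // [|x]; [exact: rcM|rewrite -expr2 sqr_ge0]. Qed.

Lemma ip_eq0 f : rc f -> ip f f = 0 -> forall x, f x = 0.
Proof. exact: I_sq_eq0. Qed.

Lemma nrm2_ge0 f : 0 <= nrm2 f. Proof. exact: sqrtr_ge0. Qed.

Lemma nrm2_sq f : rc f -> nrm2 f ^+ 2 = ip f f.
Proof. by move=> cf; rewrite sqr_sqrtr // ip_ge0. Qed.

Lemma ip_le f h : rc f -> rc h -> `|ip f h| <= nrm2 f * nrm2 h.
Proof.
move=> cf ch; have [h0|h0] := eqVneq (ip h h) 0.
  have hz := ip_eq0 ch h0.
  have -> : ip f h = 0.
    by rewrite /ip -[RHS](I_cst cG 0); congr I; apply/funext => x; rewrite hz mulr0.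
  by rewrite normr0 mulr_ge0 ?nrm2_ge0.
have hp : 0 < ip h h by rewrite lt0r h0 ip_ge0.
rewrite -(@ler_pXn2r _ 2) ?nnegrE ?mulr_ge0 ?nrm2_ge0 // exprMn !nrm2_sq //.
rewrite real_normK ?num_real //.
pose t := ip f h / ip h h; pose k x := f x - t * h x.
have cth : rc (fun x => t * h x) by apply: rcM => //; exact: rc_cst.
have ck : rc k by exact: rcB.
have ek w : rc w -> ip k w = ip f w - t * ip h w.
  by move=> cw; rewrite -ipZl //; exact: ipBl.
have : ip k k = ip f f - ip f h ^+ 2 / ip h h.
  rewrite ek // (ipC f) (ipC h) !ek // (ipC h f) /t; field.
  by rewrite gt_eqF.
have := ip_ge0 ck => + kk; rewrite kk.
by rewrite subr_ge0 ler_pdivrMr.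
Qed.

Lemma conv_joint f h : rc f -> rc h -> joint (fun y x => f y * h (y^-1 * x)%g).
Proof. by move=> cf ch; apply: jointM; [exact: joint_fst|exact: joint_div]. Qed.

Lemma rc_conv f h : rc f -> rc h -> rc (conv f h).
Proof. by move=> cf ch; exact: rc_I (conv_joint cf ch). Qed.

Lemma rc_divl h x : rc h -> rc (fun y => h (y^-1 * x)%g).
Proof. by move=> ch; exact: (joint_rc_fst x (joint_div ch)). Qed.

Lemma conv_le f h x : rc f -> rc h -> `|conv f h x| <= nrm2 f * nrm2 h.
Proof.
move=> cf ch; have chx := rc_divl x ch.
suff -> : nrm2 h = nrm2 (fun y => h (y^-1 * x)%g) by exact: ip_le.
congr Num.sqrt; rewrite /ip; have chh : rc (fun y => h y * h y) by exact: rcM.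
by rewrite -(I_mulgr cG x chh) -(I_inv cG (rc_mulgr x chh)).
Qed.

Lemma nrm2_le f c : rc f -> 0 <= c -> (forall x, `|f x| <= c) -> nrm2 f <= c.
Proof.
move=> cf c0 h; rewrite -(@ler_pXn2r _ 2) ?nnegrE ?nrm2_ge0 // nrm2_sq //.
have -> : c ^+ 2 = I (fun _ : G => c ^+ 2) by rewrite I_cst.
apply: I_le => // [||x]; [exact: rcM|exact: rc_cst|].
rewrite -expr2 -(real_normK (num_real (f x))) ler_pXn2r ?nnegrE //.
Qed.

Lemma conv_nrm2 f h : rc f -> rc h -> nrm2 (conv f h) <= nrm2 f * nrm2 h.
Proof.
move=> cf ch; apply: nrm2_le => [||x]; first exact: rc_conv.
  by rewrite mulr_ge0 ?nrm2_ge0.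
exact: conv_le.
Qed.

Lemma convDr f h h' : rc f -> rc h -> rc h' ->
  conv f (fun x => h x + h' x) = fun x => conv f h x + conv f h' x.
Proof.
move=> cf ch ch'; apply/funext => x; rewrite /conv -ID //; try by apply: rcM => //; exact: rc_divl.
by congr I; apply/funext => y; rewrite mulrDr.
Qed.

Lemma convDl f f' h : rc f -> rc f' -> rc h ->
  conv (fun x => f x + f' x) h = fun x => conv f h x + conv f' h x.
Proof.
move=> cf cf' ch; apply/funext => x; rewrite /conv -ID //; try by apply: rcM => //; exact: rc_divl.
by congr I; apply/funext => y; rewrite mulrDl.
Qed.

Lemma convZr c f h : rc f -> rc h -> conv f (fun x => c * h x) = fun x => c * conv f h x.
Proof.
move=> cf ch; apply/funext => x; rewrite /conv -IZ //; last by apply: rcM => //; exact: rc_divl.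
by congr I; apply/funext => y; rewrite mulrCA.
Qed.

Lemma conv_shift f h x : rc f -> rc h -> conv f h x = I (fun z => f (x * z)%g * h (z^-1)%g).
Proof.
move=> cf ch; have := I_mulgl cG x (f := fun y => f y * h (y^-1 * x)%g) _.
rewrite -/(conv f h x) => <-; last by apply: rcM => //; exact: rc_divl.
by congr I; apply/funext => z; rewrite invgM mulgVK.
Qed.

Lemma convA f h k : rc f -> rc h -> rc k -> conv (conv f h) k = conv f (conv h k).
Proof.
move=> cf ch ck; apply/funext => x; rewrite /conv.
have jF : joint (fun z y => f y * h (y^-1 * z)%g * k (z^-1 * x)%g).
  apply: jointM; last by apply: joint_fst; exact: rc_divl.
  by apply: joint_sym; exact: conv_joint.
transitivity (I (fun z => I (fun y => f y * h (y^-1 * z)%g * k (z^-1 * x)%g))).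
  congr I; apply/funext => z; rewrite mulrC -IZ //; last by exact: (joint_rc_fst z (conv_joint cf ch)).
  by congr I; apply/funext => y; rewrite mulrC.
rewrite (fubini jF); congr I; apply/funext => y.
rewrite -IZ //; last first.
  by apply: rcM => //; exact: rc_divl.
have c1 : rc (fun z => f y * h (y^-1 * z)%g * k (z^-1 * x)%g).
  by have := joint_rc_fst y jF.
rewrite -(I_mulgl cG y c1); congr I; apply/funext => z.
by rewrite mulKg invgM -!mulgA mulrA.
Qed.

Definition symm f : Prop := forall x, f (x^-1)%g = f x.

Lemma conv_symm f h x : rc f -> rc h -> symm f -> symm h ->
  conv f h (x^-1)%g = conv h f x.
Proof.
move=> cf ch sf sh; rewrite [RHS]conv_shift //.
rewrite /conv; congr I; apply/funext => y.
by rewrite -invgM sh mulrC sf.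
Qed.

Lemma conv_ip u f h : rc u -> rc f -> rc h -> symm u ->
  ip (conv u f) h = ip f (conv u h).
Proof.
move=> cu cf ch su; rewrite /ip /conv.
transitivity (I (fun x => I (fun y => u y * f (y^-1 * x)%g * h x))).
  congr I; apply/funext => x; rewrite mulrC -IZ //; last by exact: (joint_rc_fst x (conv_joint cu cf)).
  by congr I; apply/funext => y; rewrite mulrC.
have j1 : joint (fun x y => u y * f (y^-1 * x)%g * h x).
  by apply: jointM; [apply: joint_sym; exact: conv_joint|exact: joint_fst].
have j2 : joint (fun x y => f x * (u y * h (y^-1 * x)%g)).
  by apply: jointM; [exact: joint_fst|apply: joint_sym; exact: conv_joint].
rewrite (fubini j1).
transitivity (I (fun x => I (fun y => f x * (u y * h (y^-1 * x)%g)))); last first.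
  congr I; apply/funext => x; rewrite IZ //; exact: (joint_rc_fst x (conv_joint cu ch)).
rewrite (fubini j2).
have cy : rc (fun y => I (fun x => u y * f (y^-1 * x)%g * h x)) by exact: rc_I.
rewrite -(I_inv cG cy); congr I; apply/funext => y.
have cx : rc (fun x => u (y^-1)%g * f (y^-1^-1 * x)%g * h x).
  by have := joint_rc_fst (y^-1)%g j1.
rewrite -(I_mulgl cG (y^-1)%g cx); congr I; apply/funext => x.
by rewrite invgK mulVKg su; ring.
Qed.

End Convolution.

(** * Growth of log-convex submultiplicative sequences *)

Lemma bernoulli_le (R : realType) (x : R) n : 0 <= x <= 1 ->
  1 - n%:R * (1 - x) <= x ^+ n.
Proof.
move=> /andP[x0 x1]; elim: n => [|n IH]; first by rewrite mul0r subr0 expr0.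
rewrite exprS -natr1; have := ler_wpM2l x0 IH.
have : 0 <= n%:R * (1 - x) * (1 - x) by rewrite !mulr_ge0 // subr_ge0.
nra.
Qed.

(** [a n] stands for the norm of an [(n + 1)]-st power, hence the shifts. The ratios [a n.+1 / a n]
    increase by log-convexity and are bounded by [a 0]; [mu] is their supremum. If
    [a n < mu ^+ n.+1], some ratio [rho] has [a n < rho ^+ n.+1], and growth at rate [rho] from [N]
    on violates submultiplicativity along the indices [k * p + n]. *)
Lemma growth_rate (R : realType) (a : nat -> R) :
  (forall n, 0 < a n) -> (forall n, a n.+1 ^+ 2 <= a n.+2 * a n) ->
  (forall m n, a (n + m).+1 <= a n * a m) ->
  exists mu, [/\ 0 < mu, forall n, a n.+1 <= mu * a n & forall n, mu ^+ n.+1 <= a n].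
Proof.
move=> a0 alog asub; pose r n := a n.+1 / a n.
have r0 n : 0 < r n by rewrite divr_gt0.
have ar n : a n.+1 = r n * a n by rewrite divfK // gt_eqF.
have rS n : r n <= r n.+1.
  by rewrite /r ler_pdivrMr // mulrAC ler_pdivlMr // -expr2; exact: alog.
have rmono m n : (m <= n)%N -> r m <= r n.
  exact: (homo_leq (@lexx _ R) (@le_trans _ R) rS).
have rb n : r n <= a 0%N.
  by rewrite /r ler_pdivrMr // mulrC; have := asub 0%N n; rewrite addn0.
pose Q : set R := [set r n | n in [set: nat]].
have Qsup : has_sup Q.
  by split; [exists (r 0%N), 0%N|exists (a 0%N) => _ [n _ <-]].
pose mu := sup Q; have rmu n : r n <= mu by apply: ub_le_sup; [case: Qsup|exists n].
have mu0 : 0 < mu by exact: lt_le_trans (r0 0%N) (rmu 0%N).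
exists mu; split=> // [n|n]; first by rewrite ar ler_wpM2r // ltW.
rewrite leNgt; apply/negP => an; set p := n.+1 in an.
have mup : 0 < mu ^+ p by rewrite exprn_gt0.
pose ka := a n / mu ^+ p; have ka1 : ka < 1 by rewrite ltr_pdivrMr // mul1r.
have p0 : 0 < p%:R :> R by rewrite ltr0n.
pose d := (1 - ka) / (2%:R * p%:R).
have d0 : 0 < d by rewrite divr_gt0 ?mulr_gt0 // subr_gt0.
have [_ [N _ <-] hN] := sup_adherent (mulr_gt0 d0 mu0) Qsup; rewrite -/mu in hN.
set rho := r N in hN; have rho0 : 0 < rho by exact: r0.
have hrho : a n < rho ^+ p.
  pose x := rho / mu; have x01 : 0 <= x <= 1.
    apply/andP; split; first exact/ltW/divr_gt0.
    by rewrite ler_pdivrMr // mul1r; exact: rmu.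
  have xd : 1 - x < d.
    have : x * mu = rho by rewrite divfK // gt_eqF.
    by move=> xm; rewrite -(ltr_pM2r mu0) mulrBl mul1r xm; lra.
  have h := bernoulli_le p x01.
  have pd : p%:R * d = (1 - ka) / 2%:R by rewrite /d; field; rewrite gt_eqF.
  have h2 : p%:R * (1 - x) < p%:R * d by rewrite ltr_pM2l.
  have : ka < x ^+ p by lra.
  by rewrite /ka /x expr_div_n ltr_pM2r // invr_gt0.
have low j : a N * rho ^+ j <= a (N + j)%N.
  elim: j => [|j IH]; first by rewrite addn0 mulr1.
  rewrite addnS ar exprS mulrCA; apply: ler_pM => //; first exact: ltW.
    by rewrite mulr_ge0 ?exprn_ge0 // ltW.
  by apply: rmono; rewrite leq_addr.
have up k : a (k * p + n)%N <= a n ^+ k.+1.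
  elim: k => [|k IH]; first by rewrite mul0n add0n expr1.
  have -> : (k.+1 * p + n = (k * p + n + n).+1)%N by rewrite mulSn /p addSn (addnC n).
  apply: le_trans (asub _ _) _; rewrite [leRHS]exprSr ler_wpM2r //; exact: ltW.
pose y := a n / rho ^+ p.
have rp : 0 < rho ^+ p by rewrite exprn_gt0.
have y01 : 0 <= y < 1 by rewrite divr_ge0 ?ltW //= ltr_pdivrMr // mul1r.
have rN : 0 < rho ^+ N.+1 by rewrite exprn_gt0.
have [M hM] := expr_small y01 (divr_gt0 (a0 N) (mulr_gt0 (ltr0n R 2) rN)).
pose k := maxn N M; have kN : (N <= k * p + n)%N.
  apply: leq_trans (leq_maxl N M) _; apply: leq_trans (leq_addr _ _).
  by rewrite -{1}[maxn N M]muln1 leq_mul.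
have := hM k.+1 (leq_trans (leq_maxr N M) (leqnSn _)).
have := le_trans (low (k * p + n - N)%N) _; rewrite subnKC // => /(_ _ (up k)) h.
rewrite /y expr_div_n -exprM ler_pdivlMr ?mulr_gt0 //.
have e1 : rho ^+ (k * p + n - N) * rho ^+ N.+1 = rho ^+ (p * k.+1).
  by rewrite -exprD; congr (_ ^+ _); rewrite addnS subnK // [RHS]mulnC [RHS]mulSn /p addSn (addnC n).
have rpk : 0 < rho ^+ (p * k.+1) by rewrite exprn_gt0.
have : a N * rho ^+ (p * k.+1) <= a n ^+ k.+1 * rho ^+ N.+1.
  by rewrite -e1 mulrA ler_wpM2r // ltW.
have pos := mulr_gt0 (a0 N) rpk.
by rewrite mulrAC ler_pdivrMr // mulrCA => h1 h2; lra.
Qed.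

(** The squared norms of the powers rescaled by [mu] decrease and stay above [mu ^+ 2]; their limit
    [q0] is what will make the rescaled powers Cauchy. *)
Lemma growth_limit (R : realType) (a : nat -> R) :
  (forall n, 0 < a n) -> (forall n, a n.+1 ^+ 2 <= a n.+2 * a n) ->
  (forall m n, a (n + m).+1 <= a n * a m) ->
  exists mu (q : nat -> R) q0, [/\ 0 < mu, a 1%N <= mu * a 0%N,
    forall j, q j = (mu^-1 ^+ j * a j) ^+ 2, forall j, mu ^+ 2 <= q j
    & (forall n, q0 <= q n) /\
      forall e : R, 0 < e -> exists N, forall n, (N <= n)%N -> q n - q0 <= e].
Proof.
move=> a_gt0 alog asub.
have [mu [mu0 amu mua]] := growth_rate a_gt0 alog asub.
have mi0 : 0 < mu^-1 by rewrite invr_gt0.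
have mum : mu * mu^-1 = 1 by rewrite divff // gt_eqF.
pose q j := (mu^-1 ^+ j * a j) ^+ 2.
have qS j : q j.+1 <= q j.
  rewrite /q ler_pXn2r ?nnegrE ?mulr_ge0 ?exprn_ge0 ?(ltW (a_gt0 _)) ?(ltW mi0) //.
  rewrite exprSr -mulrA ler_wpM2l ?exprn_ge0 ?(ltW mi0) //.
  by rewrite ler_pdivrMl.
have qmono m n : (m <= n)%N -> q n <= q m.
  move=> mn; rewrite -(subnKC mn); elim: (n - m)%N => [|i IH]; first by rewrite addn0.
  by rewrite addnS; exact: le_trans (qS _) IH.
have qmu j : mu ^+ 2 <= q j.
  rewrite /q ler_pXn2r ?nnegrE ?mulr_ge0 ?exprn_ge0 ?(ltW (a_gt0 _)) ?(ltW mi0) ?(ltW mu0) //.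
  by rewrite exprVn ler_pdivlMl ?exprn_gt0 // -exprSr.
pose V : set R := [set q n | n in [set: nat]].
have Vinf : has_inf V.
  by split; [exists (q 0%N), 0%N|exists (mu ^+ 2) => _ [n _ <-]].
pose q0 := inf V; have q0q n : q0 <= q n by apply: ge_inf; [case: Vinf|exists n].
have qlim (e : R) : 0 < e -> exists N, forall n, (N <= n)%N -> q n - q0 <= e.
  move=> e0; have [_ [N _ <-] hN] := inf_adherent e0 Vinf; exists N => n Nn.
  by have := qmono _ _ Nn; rewrite -/q0 in hN; lra.
by exists mu, q, q0.
Qed.

(** * The top eigenfunction of a symmetric convolution operator *)

Section TopEigenfunction.
Variables (R : realType) (G : topologicalGroupType).
Hypothesis cG : compact [set: G].
Variable w : G -> R.
Hypotheses (cw : rc w) (sw : symm w) (w0 : 0 < nrm2 w).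
Implicit Types (f h : G -> R) (x y : G).

Lemma rc_lim f :
  (forall e : R, 0 < e -> exists2 h, rc h & forall x, `|f x - h x| <= e) -> rc f.
Proof.
move=> hf x e e0; have e3 : 0 < e / 3%:R by rewrite divr_gt0.
have [h ch fh] := hf _ e3; apply: filterS (ch x _ e3) => y hy.
apply: le_trans (ler_distD (h x) _ _) _.
have := ler_distD (h y) (h x) (f y); have := fh x; have := fh y; rewrite (distrC (f y)).
lra.
Qed.

Lemma convBr f h h' : rc f -> rc h -> rc h' ->
  conv f (fun x => h x - h' x) = fun x => conv f h x - conv f h' x.
Proof.
move=> cf ch ch'; apply/funext => x; rewrite /conv -IB //.
- by congr I; apply/funext => y; rewrite mulrBr.
- by apply: rcM => //; exact: rc_divl.
- by apply: rcM => //; exact: rc_divl.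
Qed.

Fixpoint cpow n : G -> R := if n is m.+1 then conv w (cpow m) else w.

Lemma rc_cpow n : rc (cpow n).
Proof. by elim: n => //= n IH; exact: rc_conv. Qed.

Lemma conv_cpow m n : conv (cpow n) (cpow m) = cpow (n + m).+1.
Proof. by elim: n => //= n IH; rewrite convA ?IH //; exact: rc_cpow. Qed.

Lemma symm_cpow n : symm (cpow n).
Proof.
elim: n => //= n IH x; rewrite conv_symm //; last exact: rc_cpow.
by have := conv_cpow 0 n; rewrite addn0 /= => ->.
Qed.

Lemma ip_cpow k l : ip (cpow k) (cpow l) = ip (cpow (k + l)) w.
Proof.
elim: l k => [|l IH] k; first by rewrite addn0.
have ck := rc_cpow k; have cl := rc_cpow l.
by rewrite /= -conv_ip // -[conv w (cpow k)]/(cpow k.+1) IH addSnnS.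
Qed.

Lemma conv_symm1 : conv w w 1%g = ip w w.
Proof. by congr I; apply/funext => y; rewrite mulg1 sw. Qed.

Local Opaque conv ip nrm2 I.

Let a n := nrm2 (cpow n).

Let alog n : a n.+1 ^+ 2 <= a n.+2 * a n.
Proof.
rewrite nrm2_sq //; last exact: rc_cpow.
have -> : ip (cpow n.+1) (cpow n.+1) = ip (cpow n.+2) (cpow n).
  by rewrite (ip_cpow n.+1 n.+1) (ip_cpow n.+2 n) (addSnnS n.+1).
by apply: le_trans (ler_norm _) _; apply: ip_le => //; exact: rc_cpow.
Qed.

Let a_gt0 n : 0 < a n.
Proof.
suff : 0 < a n /\ 0 < a n.+1 by case.
elim: n => [|n [h1 h2]].
  split; first exact: w0.
  rewrite lt0r nrm2_ge0 andbT; apply/eqP => a1.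
  have c1 := rc_cpow 1.
  have h : ip (cpow 1) (cpow 1) = 0 by rewrite -nrm2_sq // [nrm2 _]a1 expr0n.
  have := ip_eq0 cG c1 h 1%g; rewrite [cpow 1 _]conv_symm1 => h2.
  by have := nrm2_sq cG cw; rewrite h2 => /eqP; rewrite sqrf_eq0 gt_eqF.
split; first exact: h2.
rewrite lt0r nrm2_ge0 andbT; apply/eqP => a2.
by have := alog n; rewrite a2 mul0r leNgt exprn_gt0.
Qed.

Let asub m n : a (n + m).+1 <= a n * a m.
Proof. by rewrite /a -conv_cpow; apply: conv_nrm2 => //; exact: rc_cpow. Qed.

Lemma real_small (z C : R) : (forall e : R, 0 < e -> z <= C * e) -> z <= 0.
Proof.
move=> h; apply/ler_addgt0Pr => e e0; rewrite add0r.
have C1 : 0 < `|C| + 1 by rewrite ltr_wpDl.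
apply: le_trans (h _ (divr_gt0 e0 C1)) _.
rewrite mulrA ler_pdivrMr // mulrC ler_wpM2l ?(ltW e0) //.
by have := ler_norm C; lra.
Qed.

(* Power iteration: with [mu] the growth rate of the convolution powers of [w], the even
   ones rescaled by [mu] are Cauchy for [nrm2], and their limit is [phi]. *)
Lemma top_eigenfunction : exists (mu : R) phi, [/\ 0 < mu, rc phi, symm phi,
  conv w (conv w phi) = (fun x => mu ^+ 2 * phi x)
  & [/\ ip phi phi = ip w phi, mu ^+ 2 <= ip w phi
    & nrm2 (conv w w) <= mu * nrm2 w]].
Proof.
have [mu [q [q0 [mu0 amu0 qE qmu [q0q qlim]]]]] := growth_limit a_gt0 alog asub.
have mi0 : 0 < mu^-1 by rewrite invr_gt0.
have mum : mu * mu^-1 = 1 by rewrite divff // gt_eqF.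
(* Two convolutions at a time, so that eigenvalues [mu] and [- mu] of [conv w] are treated alike;
   [h 0 = w]. *)
pose h k : G -> R := fun x => mu^-1 ^+ (k + k) * cpow (k + k) x.
have ch k : rc (h k) by apply: rcM => //; [exact: rc_cst|exact: rc_cpow].
(* Since [conv w] is self-adjoint, the inner product only depends on [k + l]; convergence of [q]
   thus gives the Cauchy property. *)
have ip_h k l : ip (h k) (h l) = q (k + l)%N.
  have c1 := rc_cpow (k + k); have c2 := rc_cpow (l + l).
  rewrite qE (ipZl cG _ c1 (ch l)) (ipC _ (h l)) (ipZl cG _ c2 c1) ipC.
  rewrite (ip_cpow (k + k) (l + l)) exprMn (nrm2_sq cG (rc_cpow _)).
  rewrite (ip_cpow (k + l) (k + l)) mulrA; congr (_ * ip (cpow _) _); last by rewrite addnACA.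
  by rewrite -exprD -exprM; congr (_ ^+ _); rewrite addnACA muln2 addnn.
pose d k := Num.sqrt (q (k + k)%N - q0).
have d0 k : 0 <= d k by exact: sqrtr_ge0.
have hd k l : nrm2 (fun x => h k x - h l x) <= d k + d l.
  have cB : rc (fun x => h k x - h l x) by exact: rcB.
  rewrite -(@ler_pXn2r _ 2) ?nnegrE ?nrm2_ge0 ?addr_ge0 // nrm2_sq // ipBl //.
  rewrite ipC ipBl // [X in _ - X]ipC ipBl // !ip_h.
  have e1 : d k ^+ 2 = q (k + k)%N - q0 by rewrite sqr_sqrtr // subr_ge0.
  have e2 : d l ^+ 2 = q (l + l)%N - q0 by rewrite sqr_sqrtr // subr_ge0.
  have := mulr_ge0 (d0 k) (d0 l); have := q0q (k + l)%N; have := q0q (l + k)%N.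
  by nra.
have dlim (e : R) : 0 < e -> exists k, d k <= e /\ d k.+1 <= e.
  move=> e0; have [N hN] := qlim _ (exprn_gt0 2 e0); exists N.
  have aux n : (N <= n)%N -> d n <= e.
    move=> Nn; rewrite -(@ler_pXn2r _ 2) ?nnegrE ?(ltW e0) // sqr_sqrtr ?subr_ge0 //.
    by apply: hN; exact: leq_trans Nn (leq_addr _ _).
  by split; apply: aux.
pose W := nrm2 w; have W0 : 0 <= W by exact: nrm2_ge0.
have T2 f x : rc f -> `|conv w (conv w f) x| <= W * W * nrm2 f.
  move=> cf; apply: le_trans (conv_le cG x cw (rc_conv cG cw cf)) _.
  by rewrite -mulrA; apply: (ler_wpM2l W0); exact: conv_nrm2.
have T2B f f' : rc f -> rc f' -> conv w (conv w (fun x => f x - f' x)) =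
    fun x => conv w (conv w f) x - conv w (conv w f') x.
  by move=> cf cf'; rewrite convBr // convBr //; exact: rc_conv.
have hS k x : h k.+1 x = mu^-1 ^+ 2 * conv w (conv w (h k)) x.
  rewrite /h convZr //; last exact: rc_cpow.
  rewrite convZr //; last by apply: rc_conv => //; exact: rc_cpow.
  have -> : (k.+1 + k.+1 = (k + k).+2)%N by rewrite addSn addnS.
  by rewrite mulrA -exprD.
pose C := mu^-1 ^+ 2 * (W * W); have C0 : 0 <= C.
  by rewrite mulr_ge0 ?exprn_ge0 ?mulr_ge0 // ltW.
(* Two convolutions by [w] turn [nrm2] bounds into uniform ones, so from index 1 on the limit is
   uniform and hence continuous. *)
have hsup k l x : `|h k.+1 x - h l.+1 x| <= C * d k + C * d l.
  rewrite !hS -mulrBr normrM ger0_norm ?exprn_ge0 ?(ltW mi0) // -mulrDr /C -mulrA.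
  rewrite ler_wpM2l ?exprn_ge0 ?(ltW mi0) //.
  have := T2 _ x (rcB cG (ch k) (ch l)); rewrite T2B // => /le_trans; apply.
  by rewrite ler_wpM2l ?mulr_ge0.
have [phi hphi] := choice (fun x => @real_complete R (fun k => h k.+1 x) (fun k => C * d k)
  (fun k l => hsup k l x)).
have cphi : rc phi.
  apply: rc_lim => e e0; have C1 : 0 < C + 1 by lra.
  have [k [hk _]] := dlim _ (divr_gt0 e0 C1); exists (h k.+1) => // x.
  apply: le_trans (hphi x k) _; apply: le_trans (ler_wpM2l C0 hk) _.
  by rewrite mulrA ler_pdivrMr // mulrC ler_wpM2l ?(ltW e0) // lerDl.
have cB k : rc (fun x => phi x - h k x) by exact: rcB.
have nB k : nrm2 (fun x => phi x - h k.+1 x) <= C * d k.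
  by apply: nrm2_le => //; rewrite mulr_ge0.
have ipB f k : rc f -> `|ip f phi - ip f (h k.+1)| <= nrm2 f * (C * d k).
  move=> cf; rewrite ipC (ipC f) -ipBl // ipC.
  apply: le_trans (ip_le cG cf (cB k.+1)) _.
  by rewrite ler_wpM2l ?nrm2_ge0.
have eigen : conv w (conv w phi) = (fun x => mu ^+ 2 * phi x).
  apply/funext => x; apply/eqP; rewrite -subr_eq0 -normr_eq0 eq_le normr_ge0 andbT.
  apply: (@real_small _ (W * W * C + mu ^+ 2 * C)) => e /dlim[k [hk hk1]].
  have h1 := T2 _ x (cB k.+1); rewrite T2B // in h1.
  have h2 : conv w (conv w (h k.+1)) x = mu ^+ 2 * h k.+2 x.
    by rewrite hS mulrA -exprMn mum expr1n mul1r.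
  rewrite h2 in h1.
  have h3 : W * W * nrm2 (fun x => phi x - h k.+1 x) <= W * W * C * e.
    rewrite -[_ * C * _]mulrA ler_wpM2l ?mulr_ge0 //; apply: le_trans (nB k) _.
    by rewrite ler_wpM2l.
  have h4 : `|mu ^+ 2 * h k.+2 x - mu ^+ 2 * phi x| <= mu ^+ 2 * C * e.
    rewrite -mulrBr normrM ger0_norm ?sqr_ge0 // -mulrA ler_wpM2l ?sqr_ge0 //.
    rewrite distrC; apply: le_trans (hphi x k.+1) _; rewrite ler_wpM2l //.
  apply: le_trans (ler_distD (mu ^+ 2 * h k.+2 x) _ _) _.
  by rewrite mulrDl; apply: lerD => //; exact: le_trans h1 h3.
have h0 : h 0%N = w by apply/funext => x; rewrite /h expr0 mul1r.
(* Moving [conv w] across and using the eigenvalue shows independence of [k]; in the limit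
   [ip phi phi = ip w phi], that is, [w - phi] is orthogonal to [phi]. *)
have iph k : ip phi (h k) = ip w phi.
  elim: k => [|k IH]; first by rewrite h0 ipC.
  have ckk := rc_conv cG cw (ch k); have ckkk := rc_conv cG cw ckk.
  have -> : h k.+1 = fun x => mu^-1 ^+ 2 * conv w (conv w (h k)) x.
    by apply/funext => x; exact: hS.
  rewrite ipC ipZl // ipC -(conv_ip cG cw cphi ckk sw).
  rewrite -(conv_ip cG cw (rc_conv cG cw cphi) (ch k) sw) eigen ipZl // IH mulrA.
  by rewrite -exprMn mulVf ?gt_eqF // expr1n mul1r.
exists mu, phi; split=> //; last split.
- move=> x; apply/eqP; rewrite -subr_eq0 -normr_eq0 eq_le normr_ge0 andbT.
  apply: (@real_small _ (2%:R * C)) => e /dlim[k [hk _]].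
  have := hphi x k; have := hphi (x^-1)%g k.
  have -> : h k.+1 (x^-1)%g = h k.+1 x by rewrite /h symm_cpow.
  move=> h1 h2; apply: le_trans (ler_distD (h k.+1 x) _ _) _.
  rewrite (distrC _ (phi x)); have := ler_wpM2l C0 hk; lra.
- apply/eqP; rewrite -subr_eq0 -normr_eq0 eq_le normr_ge0 andbT.
  apply: (@real_small _ (nrm2 phi * C)) => e /dlim[k [hk _]].
  have := ipB phi k cphi; rewrite iph => /le_trans; apply.
  by rewrite -mulrA ler_wpM2l ?nrm2_ge0 // ler_wpM2l.
- rewrite -subr_le0; apply: (@real_small _ (nrm2 w * C)) => e /dlim[k [hk _]].
  have h1 := ipB w k cw; rewrite -{2}h0 ip_h in h1.
  have h2 : nrm2 w * (C * d k) <= nrm2 w * C * e.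
    by rewrite -mulrA ler_wpM2l ?nrm2_ge0 // ler_wpM2l.
  have := qmu (0 + k.+1)%N; move: (le_trans h1 h2); rewrite ler_norml; lra.
- exact: amu0.
Qed.

End TopEigenfunction.

(** * Representative functions and the Peter-Weyl theorem *)

Section PeterWeyl.
Variables (R : realType) (G : topologicalGroupType).
Hypothesis cG : compact [set: G].
Implicit Types (f h u w : G -> R) (x y : G) (e C : R).

Local Opaque conv ip nrm2 I.

(** Representative functions, those whose translates span a finite-dimensional space, in the form
    that separates [g] from the integration variable when [f] smears an orbit of [delta]. *)
Definition repf f : Prop := exists (T : finType) (a c : T -> G -> R),
  [/\ forall i, rc (a i), forall i, rc (c i)
    & forall x y, f (x * y)%g = \sum_i a i x * c i y].

Lemma repf_rc f : repf f -> rc f.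
Proof.
move=> [T [a [c [ca cc fE]]]].
have -> : f = fun x => \sum_i a i x * c i 1%g by apply/funext => x; rewrite -fE mulg1.
by apply: rc_sum => i; apply: rcM => //; exact: rc_cst.
Qed.

Lemma repfD f h : repf f -> repf h -> repf (fun x => f x + h x).
Proof.
move=> [T [a [c [ca cc fE]]]] [T' [a' [c' [ca' cc' hE]]]].
exists (T + T')%type, (fun i => match i with inl i => a i | inr i => a' i end),
  (fun i => match i with inl i => c i | inr i => c' i end); split.
- by case.
- by case.
- by move=> x y; rewrite big_sumType /= fE hE.
Qed.

Lemma repf_conv_r f w : rc w -> repf f -> repf (conv w f).
Proof.
move=> cw [T [a [c [ca cc fE]]]]; exists T, (fun i => conv w (a i)), c; split=> //.
  by move=> i; exact: rc_conv.
move=> x y; transitivity (I (fun z => \sum_i c i y * (w z * a i (z^-1 * x)%g))).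
  congr I; apply/funext => z; rewrite mulgA fE mulr_sumr; apply: eq_bigr => i _; ring.
have cwa i : rc (fun z => w z * a i (z^-1 * x)%g) by apply: rcM => //; exact: rc_divl.
rewrite I_sum //; last by move=> i; apply: rcM => //; exact: rc_cst.
by apply: eq_bigr => i _; rewrite IZ // mulrC.
Qed.

Lemma repf_conv_l f w : rc w -> repf f -> repf (conv f w).
Proof.
move=> cw rf; have cf := repf_rc rf; case: rf => [T [a [c [ca cc fE]]]].
exists T, a, (fun i => conv (c i) w); split=> //.
  by move=> i; exact: rc_conv.
move=> x y.
have c0 : rc (fun z => f z * w (z^-1 * (x * y))%g) by apply: rcM => //; exact: rc_divl.
transitivity (I (fun z => \sum_i a i x * (c i z * w (z^-1 * y)%g))).
  transitivity (I (fun z => f (x * z)%g * w ((x * z)^-1 * (x * y))%g)).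
    by rewrite (I_mulgl cG x c0).
  congr I; apply/funext => z; rewrite fE invgM -mulgA mulKg mulr_suml.
  by apply: eq_bigr => i _; rewrite mulrA.
have cwa i : rc (fun z => c i z * w (z^-1 * y)%g) by apply: rcM => //; exact: rc_divl.
rewrite I_sum //; last by move=> i; apply: rcM => //; exact: rc_cst.
by apply: eq_bigr => i _; rewrite IZ.
Qed.

Lemma ip_suml n (k : nat -> R) (e : nat -> G -> R) h :
  (forall i, (i < n)%N -> rc (e i)) -> rc h ->
  ip (fun x => \sum_(i < n) k i * e i x) h = \sum_(i < n) k i * ip (e i) h.
Proof.
elim: n => [|n IH] ce ch.
  rewrite [RHS]big_ord0 -[RHS](mul0r (ip h h)) -(ipZl cG 0 ch ch).
  by congr (ip _ h); apply/funext => x; rewrite big_ord0 mul0r.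
have ce' i : (i < n)%N -> rc (e i) by move=> h1; apply: ce; exact: ltnW.
rewrite big_ord_recr /= -IH // -ipZl //; last exact: ce.
rewrite -ipDl //; first by congr (ip _ h); apply/funext => x; rewrite big_ord_recr.
  have := @rc_sum R G 'I_n (index_enum _) (fun i x => k i * e i x); apply=> i.
  by apply: rcM => //; [exact: rc_cst|exact: ce'].
by apply: rcM => //; [exact: rc_cst|exact: ce].
Qed.

Section FiniteDimensional.
Variables (E : (G -> R) -> Prop) (C : R).
Hypotheses (Erc : forall f, E f -> rc f)
  (ED : forall f h, E f -> E h -> E (fun x => f x + h x))
  (EZ : forall k f, E f -> E (fun x => k * f x))
  (C0 : 0 <= C) (EC : forall f x, E f -> f x ^+ 2 <= C * ip f f).

Definition orthonormal n (e : nat -> G -> R) : Prop :=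
  (forall i, (i < n)%N -> E (e i)) /\
  (forall i j, (i < n)%N -> (j < n)%N -> ip (e i) (e j) = (i == j)%:R).

Lemma E_sum n (k : nat -> R) (e : nat -> G -> R) : E (fun=> 0) ->
  (forall i, (i < n)%N -> E (e i)) -> E (fun x => \sum_(i < n) k i * e i x).
Proof.
move=> E0; elim: n => [|n IH] he.
  by under [fun x => _]funext do rewrite big_ord0.
under [fun x => _]funext do rewrite big_ord_recr /=.
by apply: ED; [apply: IH => i h; apply: he; exact: ltnW|apply: EZ; exact: he].
Qed.

Lemma ip_orthonormal n (e : nat -> G -> R) (k : nat -> R) j : orthonormal n e -> (j < n)%N ->
  ip (fun x => \sum_(i < n) k i * e i x) (e j) = k j.
Proof.
move=> [Ee oe] jn; rewrite ip_suml //; first last.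
- exact/Erc/Ee.
- by move=> i h; exact/Erc/Ee.
rewrite (bigD1 (Ordinal jn)) //= oe // eqxx mulr1 big1 ?addr0 // => i ij.
by rewrite oe // (_ : (i : nat) == j = false) ?mulr0 //; apply/negbTE.
Qed.

(* The values at [x] of an orthonormal family form the coefficients of the
   element of [E] that represents the evaluation at [x]. *)
Lemma orthonormal_bound n (e : nat -> G -> R) : E (fun=> 0) -> orthonormal n e -> n%:R <= C.
Proof.
move=> E0 he; case: (he) => Ee oe; have ce i : (i < n)%N -> rc (e i) by move=> h; exact/Erc/Ee.
pose s x := \sum_(i < n) e i x * e i x.
have sC x : s x <= C.
  pose f y := \sum_(i < n) e i x * e i y.
  have Ef : E f by exact: (@E_sum n (fun i => e i x)).
  have fs : ip f f = s x.
    rewrite {1}/f (@ip_suml n (fun i => e i x)) //; last exact: Erc.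
    apply: eq_bigr => i _; congr (_ * _).
    by rewrite ipC (@ip_orthonormal n e (fun i => e i x)).
  have := EC x Ef; rewrite fs -/(s x) expr2.
  have : 0 <= s x by apply: sumr_ge0 => i _; rewrite -expr2 sqr_ge0.
  have [->//|sx] := eqVneq (s x) 0.
  by move=> s0; rewrite ler_pM2r // lt0r sx.
have cs : rc s.
  have := @rc_sum R G 'I_n (index_enum _) (fun i x => e i x * e i x); apply=> i.
  by apply: rcM => //; exact: ce.
have <- : I s = n%:R.
  rewrite I_sum //; last by move=> i; apply: rcM => //; exact: ce.
  rewrite (eq_bigr (fun=> 1)); first by rewrite sumr_const card_ord.
  by move=> i _; have := oe i i (ltn_ord i) (ltn_ord i); rewrite eqxx.
by rewrite -(I_cst cG C); apply: I_le => //; exact: rc_cst.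
Qed.

(** Orthonormal families have at most [C] members, so a maximal one exists; a nonzero difference
    between some [f] in [E] and its projection could be normalized and would extend it. *)
Lemma orthonormal_basis : E (fun=> 0) -> exists n (e : nat -> G -> R), orthonormal n e /\
  forall f, E f -> f = fun x => \sum_(i < n) ip f (e i) * e i x.
Proof.
move=> E0.
have [n [e [he hmax]]] : exists n (e : nat -> G -> R), orthonormal n e /\ forall e' : nat -> G -> R, ~ orthonormal n.+1 e'.
  apply: contrapT => hn; have all n : exists e : nat -> G -> R, orthonormal n e.
    elim: n => [|n [e he]]; first by exists (fun _ _ => 0).
    apply: contrapT => h; apply: hn; exists n, e; split=> // e' he'.
    by apply: h; exists e'.
  have [e he] := all (Num.truncn C).+1; have := orthonormal_bound E0 he.
  by rewrite leNgt (Num.Theory.truncnS_gt C).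
exists n, e; split=> // f Ef; case: (he) => Ee oe.
pose k i := ip f (e i); pose p x := \sum_(i < n) k i * e i x.
have Ep : E p by exact: E_sum.
pose g x := f x - p x.
have Eg : E g.
  have := ED Ef (EZ (- 1) Ep); congr E; apply/funext => x; by rewrite mulN1r.
have cf := Erc Ef; have cp := Erc Ep; have cg := Erc Eg.
have gj j : (j < n)%N -> ip g (e j) = 0.
  move=> jn; rewrite ipBl //; last exact/Erc/Ee.
  by rewrite ip_orthonormal // subrr.
have [g0|g0] := eqVneq (ip g g) 0.
  by apply/funext => x; apply/eqP; rewrite -subr_eq0; apply/eqP/(ip_eq0 cG cg g0).
exfalso; have gp : 0 < ip g g by rewrite lt0r g0 ip_ge0.
have ng : nrm2 g != 0 by rewrite -sqrf_eq0 nrm2_sq.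
apply: (hmax (fun i => if (i < n)%N then e i else fun x => (nrm2 g)^-1 * g x)); split.
  by move=> i _; case: ifP => h; [exact: Ee|exact: EZ].
have gn : ip (fun x => (nrm2 g)^-1 * g x) (fun x => (nrm2 g)^-1 * g x) = 1.
  have cng : rc (fun x => (nrm2 g)^-1 * g x) by exact/Erc/EZ.
  by rewrite (ipZl cG _ cg cng) ipC (ipZl cG _ cg cg) -(nrm2_sq cG cg); field.
have ge j : (j < n)%N -> ip (fun x => (nrm2 g)^-1 * g x) (e j) = 0.
  by move=> jn; rewrite ipZl ?gj ?mulr0 //; exact/Erc/Ee.
move=> i j; rewrite !ltnS => hi hj; case: ltnP => hin; case: ltnP => hjn.
- exact: oe.
- by rewrite ipC ge // (_ : i == j = false) //; apply/eqP => ij; rewrite ij ltnNge hjn in hin.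
- by rewrite ge // (_ : i == j = false) //; apply/eqP => ij; rewrite -ij ltnNge hin in hjn.
- by have -> : i = j; [apply/eqP; rewrite eqn_leq (leq_trans hi hjn) (leq_trans hj hin)|rewrite gn eqxx].
Qed.

End FiniteDimensional.

Lemma conv_mulgr w f y : conv w (fun x => f (x * y)%g) = fun x => conv w f (x * y)%g.
Proof.
by apply/funext => x; congr I; apply/funext => z; rewrite mulgA.
Qed.

(** On the eigenspace of [phi], values are bounded by a multiple of [nrm2], since two convolutions
    by [w] have this smoothing effect; so it has a finite orthonormal basis. Right translations
    commute with [conv w] and preserve it: expanding [phi (x * y)] in the basis separates the
    variables. *)
Lemma eigenfunction_repf w phi (mu : R) : rc w -> 0 < mu -> rc phi ->
  conv w (conv w phi) = (fun x => mu ^+ 2 * phi x) -> repf phi.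
Proof.
move=> cw mu0 cphi hphi.
pose E f := rc f /\ conv w (conv w f) = (fun x => mu ^+ 2 * f x).
pose C := (nrm2 w * nrm2 w / mu ^+ 2) ^+ 2.
have m2 : 0 < mu ^+ 2 by rewrite exprn_gt0.
have [] := @orthonormal_basis E C.
- by move=> f [].
- move=> f h [cf hf] [ch hh]; split; first exact: rcD.
  have c1 := rc_conv cG cw cf; have c2 := rc_conv cG cw ch.
  by rewrite (convDr cG cw cf ch) (convDr cG cw c1 c2) hf hh; apply/funext => x; rewrite mulrDr.
- move=> k f [cf hf]; split; first by apply: rcM => //; exact: rc_cst.
  have c1 := rc_conv cG cw cf.
  by rewrite (convZr cG k cw cf) (convZr cG k cw c1) hf; apply/funext => x; rewrite mulrCA.
- exact: sqr_ge0.
- move=> f x [cf hf]; rewrite -(nrm2_sq cG cf) -exprMn.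
  rewrite -(real_normK (num_real (f x))) ler_pXn2r ?nnegrE //; last first.
    by rewrite !mulr_ge0 ?nrm2_ge0 // invr_ge0 ltW.
  rewrite mulrAC ler_pdivlMr // mulrC -[X in X * _](ger0_norm (ltW m2)) -normrM.
  have -> : mu ^+ 2 * f x = conv w (conv w f) x by rewrite hf.
  apply: le_trans (conv_le cG x cw (rc_conv cG cw cf)) _.
  by rewrite -mulrA; apply: (ler_wpM2l (nrm2_ge0 w)); exact: conv_nrm2.
- have h0 : (fun _ : G => 0) = (fun x => 0 * phi x) by apply/funext => x; rewrite mul0r.
  split; first exact: rc_cst.
  have c1 := rc_conv cG cw cphi.
  rewrite h0 (convZr cG 0 cw cphi) (convZr cG 0 cw c1).
  by apply/funext => x; rewrite !mul0r mulr0.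
move=> n [e [[Ee oe] hb]].
have ce i : (i < n)%N -> rc (e i) by move=> /Ee[].
exists 'I_n, (fun i : 'I_n => e i), (fun (i : 'I_n) y => ip (fun x => phi (x * y)%g) (e i)); split.
- by move=> i; exact: ce.
- move=> i; apply: (rc_I cG (F := fun x y => phi (x * y)%g * e i x)).
  by apply: jointM => //; [exact: joint_mul|apply: joint_fst => //; exact: ce].
move=> x y; have Ey : E (fun x => phi (x * y)%g).
  split; first exact: rc_mulgr.
  by rewrite !conv_mulgr hphi.
by rewrite [LHS](congr1 (@^~ x) (hb _ Ey)); apply: eq_bigr => i _; rewrite mulrC.
Qed.

(* Subtracting a top eigenfunction lowers [ip w w] by at least [mu ^+ 2], so a
   near-minimizer [w] of [ip w w] among the functions congruent to [u] modulo [repf]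
   has a small [mu], and [w * w * w] is uniformly small. *)
Lemma peter_weyl u e : rc u -> symm u -> 0 < e ->
  exists2 f, repf f & forall x, `|conv u (conv u u) x - f x| <= e.
Proof.
move=> cu su e0.
have aux1 (a b c m q : R) : a <= b - c -> b < a + q -> m <= c -> m <= q by move=> *; lra.
have aux2 (a b q : R) : b < a + q -> q <= 1 -> b <= a + 1 by move=> *; lra.
have aux3 (a b c p : R) : p + c + b + a - (a + b + c) = p by ring.
pose W w := [/\ rc w, symm w & repf (fun x => u x - w x)].
pose V : set R := [set ip w w | w in W].
have repf0 : repf (fun=> 0).
  by exists void, (fun _ _ => 0), (fun _ _ => 0); split=> // x y; rewrite big_pred0 // => -[].
have Wu : W u by split=> //; under [fun x => _]funext do rewrite subrr.
have Vinf : has_inf V.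
  split; first by exists (ip u u), u.
  by exists 0 => _ [w [cw _ _] <-]; exact: ip_ge0.
have V0 : 0 <= inf V.
  by apply: lb_le_inf; [case: Vinf|move=> _ [w [cw _ _] <-]; exact: ip_ge0].
(* The final bound is [nrm2 w * nrm2 (conv w w) <= mu * ip w w <= d * (inf V + 1)]. *)
pose d := Num.min 1 (e / (inf V + 1)).
have V1 : 0 < inf V + 1 by lra.
have d0 : 0 < d by rewrite lt_min ltr01 divr_gt0.
have d1 : d <= 1 by rewrite ge_min lexx.
have de : d * (inf V + 1) <= e by rewrite -ler_pdivlMr // ge_min lexx orbT.
have [_ [w [cw sw rw] <-] hw] := inf_adherent (exprn_gt0 2 d0) Vinf.
have small x : `|conv w (conv w w) x| <= e.
  have cww := rc_conv cG cw cw.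
  apply: le_trans (conv_le cG x cw cww) _.
  have [w0|w0] := eqVneq (nrm2 w) 0; first by rewrite w0 mul0r ltW.
  have wp : 0 < nrm2 w by rewrite lt0r w0 nrm2_ge0.
  have [mu [phi [mu0 cphi sphi hphi [ipp ipw nw]]]] := top_eigenfunction cG cw sw wp.
  have rphi := eigenfunction_repf cw mu0 cphi hphi.
  have cB : rc (fun x => w x - phi x) by exact: rcB.
  have : inf V <= ip (fun x => w x - phi x) (fun x => w x - phi x).
    apply: ge_inf; first by case: Vinf.
    exists (fun x => w x - phi x) => //; split=> //.
      by move=> y; rewrite sw sphi.
    have := repfD rw rphi; congr repf; apply/funext => y.
    by rewrite opprB addrA addrAC.
  have -> : ip (fun x => w x - phi x) (fun x => w x - phi x) = ip w w - ip w phi.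
    rewrite (ipBl cG cw cphi cB) ipC (ipBl cG cw cphi cw).
    by rewrite [X in _ - X]ipC (ipBl cG cw cphi cphi) ipp subrr subr0 (ipC phi).
  move=> h; have mud : mu <= d.
    have : mu ^+ 2 <= d ^+ 2 by exact: aux1 h hw ipw.
    by rewrite ler_pXn2r // nnegrE ltW.
  apply: le_trans de; apply: le_trans (ler_wpM2l (ltW wp) nw) _.
  rewrite mulrCA -expr2 nrm2_sq //; apply: ler_pM => //; first exact: ltW.
    exact: ip_ge0.
  by apply: aux2 hw _; rewrite expr_le1 // ltW.
pose f0 x := u x - w x.
have cf0 : rc f0 by exact: rcB.
have cuu := rc_conv cG cu cu; have cww := rc_conv cG cw cw.
have cwu := rc_conv cG cw cu; have cf0u := rc_conv cG cf0 cu; have cwf0 := rc_conv cG cw cf0.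
have uE : u = fun x => w x + f0 x by apply/funext => x; rewrite /f0 addrC subrK.
have rf0 : repf f0 by [].
clearbody f0.
(* With [u = w + f0] the products telescope: [u u u - w w w = f0 u u + w f0 u + w w f0]. Each term
   contains [f0], and representative functions absorb convolutions on either side. *)
exists (fun x => conv f0 (conv u u) x + conv w (conv f0 u) x + conv w (conv w f0) x).
  apply: repfD; first apply: repfD.
  - exact: repf_conv_l.
  - by apply: repf_conv_r => //; exact: repf_conv_l.
  - by apply: repf_conv_r => //; exact: repf_conv_r.
move=> x.
have uvl v (cv : rc v) : conv u v = fun x => conv w v x + conv f0 v x.
  by rewrite -(convDl cG cw cf0 cv) -uE.
have e2 : conv w (conv u u) = fun x => conv w (conv w u) x + conv w (conv f0 u) x.
  by rewrite {1}(uvl u cu) (convDr cG cw cwu cf0u).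
have e3 : conv w (conv w u) = fun x => conv w (conv w w) x + conv w (conv w f0) x.
  have -> : conv w u = fun x => conv w w x + conv w f0 x by rewrite -(convDr cG cw cw cf0) -uE.
  exact: (convDr cG cw cww cwf0).
by rewrite (uvl _ cuu) e2 e3 aux3; exact: small.
Qed.

End PeterWeyl.

(** * Supports of convolutions *)

Section ConvolutionSupport.
Variables (R : realType) (G : topologicalGroupType).
Hypothesis cG : compact [set: G].
Implicit Types (f h d : G -> R).

Lemma conv_ge0 f h x : rc f -> rc h -> (forall y, 0 <= f y) -> (forall y, 0 <= h y) ->
  0 <= conv f h x.
Proof.
move=> cf ch f0 h0; apply: (I_ge0 cG) => [|y]; last exact: mulr_ge0.
by apply: (rcM cG) => //; exact: rc_divl.
Qed.

Lemma conv_gt0 f h : rc f -> rc h -> (forall y, 0 <= f y) -> (forall y, 0 <= h y) ->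
  0 < f 1%g -> 0 < h 1%g -> 0 < conv f h 1%g.
Proof.
move=> cf ch f0 h0 f1 h1; apply: (I_gt0 cG) => [|y|]; last by rewrite mulVg mulr_gt0.
  by apply: (rcM cG) => //; exact: rc_divl.
exact: mulr_ge0.
Qed.

(** For [f >= 0] the inequality [f y * d y <= r * f y] says that [f] lives where the subadditive
    function [d] is at most [r]; such radii add under convolution. *)
Lemma conv_support f h d (r s : R) x : rc f -> rc h ->
  (forall y, 0 <= f y) -> (forall y, 0 <= h y) ->
  (forall y z, d (y * z)%g <= d y + d z) ->
  (forall y, f y * d y <= r * f y) -> (forall y, h y * d y <= s * h y) ->
  conv f h x * d x <= (r + s) * conv f h x.
Proof.
move=> cf ch f0 h0 dM df dh; rewrite mulrC /conv.
have ci : rc (fun y => f y * h (y^-1 * x)%g) by apply: (rcM cG) => //; exact: rc_divl.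
rewrite -!(IZ cG) //; apply: (I_le cG) => [||y]; try by apply: (rcM cG) => //; exact: rc_cst.
have dx := dM y (y^-1 * x)%g; rewrite mulVKg in dx.
have h1 := ler_wpM2l (mulr_ge0 (f0 y) (h0 (y^-1 * x)%g)) dx.
have h2 := ler_wpM2l (h0 (y^-1 * x)%g) (df y).
have h3 := ler_wpM2l (f0 y) (dh (y^-1 * x)%g).
move: (f y) (h _) (d y) (d (y^-1 * x)%g) (d x) h1 h2 h3 => a b p q t; nra.
Qed.

End ConvolutionSupport.

(** * Smearing along the action: fixed elements and [G]-finite elements *)

Section Dynamics.
Variables (R : realType) (A : cstarAlgType R) (G : topologicalGroupType)
  (delta : {multiplicative G -> starAut A}).
Implicit Types (a b c : A) (g h x y : G).

Local Notation anrm := (@nm R A).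
Local Notation vc := (@ncont R G R[i] A anrm).
Local Opaque conv I J.

Lemma deltaM g h a : delta (g * h)%g a = delta g (delta h a).
Proof. by rewrite gmulfM. Qed.

Lemma delta1 a : delta 1%g a = a.
Proof. by apply: (can_inj (saut_VK (delta 1%g))); rewrite -deltaM mulg1. Qed.

Lemma deltaVK g a : delta (g^-1)%g (delta g a) = a.
Proof. by rewrite -deltaM mulVg delta1. Qed.

Lemma fixed_byP a : fixed_by (range delta) a <-> forall g, delta g a = a.
Proof. by split=> [h g|h _ [g _ <-]]; [apply: h; exists g|exact: h]. Qed.

Hypotheses (cG : compact [set: G]) (cdelta : pointwise_norm_continuous delta).

Lemma vc_orbit b : vc (fun g => delta g b).
Proof.
move=> x e e0; have /continuous_nmP/(_ e e0) : {for x, continuous (fun g => delta g b)} by exact: cdelta.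
by apply: filterS => y /ltW.
Qed.

Definition expect a : A := J (fun x => delta x a).

Lemma J_delta g (f : G -> A) : vc f -> J (fun x => delta g (f x)) = delta g (J f).
Proof.
move=> cf; apply: (J_lin cG (L := delta g) ler01) => // [a b|k a|a].
- exact: sautD.
- exact: sautZ.
- by rewrite nm_saut mul1r.
Qed.

Lemma expect_fixed a : fixed_by (range delta) (expect a).
Proof.
apply/fixed_byP => g; rewrite /expect -J_delta; last exact: vc_orbit.
under [fun x => _]funext do rewrite -deltaM.
by apply: (J_mulgl cG); exact: vc_orbit.
Qed.

Lemma J_pos (f : G -> A) : vc f -> (forall x, pos (uin (f x))) -> pos (uin (J f)).
Proof.
move=> cf pf; apply: (J_closed cG (Q := fun a => pos (uin a)) cf _ (pos0 A)) => //.
- move=> a ha; split.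
    apply: subr0_eq; apply: nu_small => e e0.
    have [b pb ba] := ha _ (divr_gt0 e0 (ltr0n R 2)).
    rewrite -(subrK (uin b) (ustar (uin a))) -addrA; apply: le_trans (nuD _ _) _.
    rewrite [e]splitr; apply: lerD; last by rewrite -uinB nu_uin.
    by rewrite -{1}(pos_sa pb) -ustarB nu_star -uinB nu_uin nmBC.
  exists (nm a + 1); apply/ler_addgt0Pr => e e0.
  pose m := Num.min e 1; have m0 : 0 < m by rewrite lt_min e0 ltr01.
  have [b pb ba] := ha m m0.
  have [me m1] : m <= e /\ m <= 1 by rewrite !ge_min !lexx orbT.
  rewrite -(subrK (uin b) (rs A _)) -addrA; apply: le_trans (nuD _ _) _.
  apply: lerD; last by rewrite -uinB nu_uin; apply: le_trans ba me.
  apply: pos_bound => //; rewrite nu_uin.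
  by have := nm_le a b; move: ba m1; lra.
- by move=> a b pa pb; rewrite uinD; exact: posD.
- by move=> n a pa; rewrite uinZ cnatE -fmorphV; apply: posZ => //; rewrite invr_ge0.
Qed.

(** A continuous, subadditive and symmetric length on [G]: its balls are the neighbourhoods of 1
    that matter for [b], and bumps are cut out of it. *)
Definition displ b x : R := nm (delta x b - b).

Lemma displ_mul b x y : displ b (x * y)%g <= displ b x + displ b y.
Proof.
rewrite /displ deltaM; apply: le_trans (nm_triangle (delta x b) _ _) _.
by rewrite -sautB nm_saut addrC.
Qed.

Lemma rc_displ b : rc (displ b).
Proof.
apply: (@rc_lip R G A anrm (fun x => delta x b) (fun a => nm (a - b)) 1 ler01); last exact: vc_orbit.
move=> a c; rewrite mul1r; have h1 := nm_triangle a c b; have h2 := nm_triangle c a b.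
by rewrite (nmBC c a) in h1; rewrite ler_norml; apply/andP; split; lra.
Qed.

Definition bump_at b (e : R) x : R := Num.max 0 (e - displ b x).

Lemma bump_at_ge0 b e x : 0 <= bump_at b e x.
Proof. by rewrite le_max lexx. Qed.

Lemma bump_at1 b e : 0 < e -> bump_at b e 1%g = e.
Proof. by move=> e0; rewrite /bump_at /displ delta1 subrr nm0 subr0; apply/max_idPr/ltW. Qed.

Lemma bump_at_le b e x : 0 < e -> bump_at b e x <= e.
Proof. by move=> e0; rewrite ge_max ltW //= lerBlDr lerDl nm_ge0. Qed.

Lemma rc_bump_at b e : rc (bump_at b e).
Proof. by apply: (rc_max0); apply: (rcB cG); [exact: rc_cst|exact: rc_displ]. Qed.

Lemma bump_at_displ b e x : bump_at b e x * displ b x <= e * bump_at b e x.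
Proof.
rewrite /bump_at; have [h|h] := leP (e - displ b x) 0; first by rewrite mul0r mulr0.
by rewrite mulrC ler_wpM2r ?(ltW h) //; lra.
Qed.

Lemma bump_at_symm b e : symm (bump_at b e).
Proof. by move=> x; rewrite /bump_at /displ -[nm (_ - _)](nm_saut (delta x)) sautB -deltaM mulgV delta1 nmBC. Qed.

(* Averaging a positive element over a neighbourhood of [1] gives an element close to
   a positive multiple of it, hence nonzero, and dominated by its mean over [G]. *)
Lemma fixed_neq0 : (exists a : A, a != 0) -> exists2 c, fixed_by (range delta) c & c != 0.
Proof.
move=> [a a0]; pose p := (star a * a)%g; pose P := nm p.
have pp : pos (uin p) by exact: pos_uin_mul.
have P0 : 0 < P by rewrite /P nm_cstar exprn_gt0 // lt0r nm_eq0 a0 nm_ge0.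
pose eta := P / 2%:R; have eta0 : 0 < eta by rewrite divr_gt0.
pose q x := eta^-1 * bump_at p eta x.
have q0 x : 0 <= q x by rewrite mulr_ge0 ?bump_at_ge0 // invr_ge0 ltW.
have q1 x : q x <= 1 by rewrite ler_pdivrMl // mulr1; exact: bump_at_le.
have cq : rc q by apply: (rcM cG); [exact: rc_cst|exact: rc_bump_at].
have c1q : rc (fun x => 1 - q x) by apply: (rcB cG) => //; exact: rc_cst.
have Iq : 0 < I q.
  by apply: (I_gt0 cG) => //; rewrite /q bump_at1 // mulVf // gt_eqF.
have op := vc_orbit p.
have pdelta x : pos (uin (delta x p)).
  have -> : delta x p = (star (delta x a) * delta x a)%g by rewrite -saut_star -sautM.
  exact: pos_uin_mul.
pose p1 := J (fun x => (q x)%:C *: delta x p).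
pose p2 := J (fun x => (1 - q x)%:C *: delta x p).
have EE : expect p = p1 + p2.
  rewrite /p1 /p2 -(JD cG); try exact: (vcZ cG).
  congr J; apply/funext => x; by rewrite -scalerDl -rmorphD /= addrC subrK scale1r.
have pos1 : pos (uin p1).
  by apply: J_pos => [|x]; [exact: (vcZ cG)|rewrite uinZ; exact: posZ].
have pos2 : pos (uin p2).
  by apply: J_pos => [|x]; [exact: (vcZ cG)|rewrite uinZ; apply: posZ => //; rewrite subr_ge0].
exists (expect p); first exact: expect_fixed.
rewrite -nm_eq0 gt_eqF //; apply: (@lt_le_trans _ _ (nm p1)); last first.
  by rewrite -!nu_uin EE uinD; exact: pos_mono.
have cd : vc (fun x => (q x)%:C *: (delta x p - p)).
  by apply: (vcZ cG) => //; apply: (vcD) => //; exact: vc_cst.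
have e1 : p1 - (I q)%:C *: p = J (fun x => (q x)%:C *: (delta x p - p)).
  rewrite -(J_scale cG) // -scaleN1r -(JZ cG); last by apply: (vcZ cG) => //; exact: vc_cst.
  rewrite -(JD cG); [|exact: (vcZ cG)|].
    by congr J; apply/funext => x; rewrite scaleN1r scalerBr.
  apply: (vc_lip (L := fun a => - 1 *: a) ler01) => [b c|].
    by rewrite -scalerBr scaleN1r nmN mul1r.
  by apply: (vcZ cG) => //; exact: vc_cst.
have h1 : nm (p1 - (I q)%:C *: p) <= eta * I q.
  rewrite e1 -(IZ cG) //; apply: (nm_J_le cG) => [//||x].
    by apply: (rcM cG) => //; exact: rc_cst.
  rewrite nmZ cm_real ger0_norm // /q -mulrA [leRHS]mulrCA.
  by apply: ler_wpM2l; [rewrite invr_ge0 ltW|exact: bump_at_displ].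
have h2 := nm_le p1 ((I q)%:C *: p).
rewrite nmZ cm_real gtr0_norm // nmBC -/P in h2.
have h3 : eta * I q = I q * P / 2%:R by rewrite /eta mulrAC (mulrC P).
have h4 : 0 < I q * P by exact: mulr_gt0.
by move: h1 h2 h3 h4; lra.
Qed.

Definition gfin b : Prop := exists n (w : nat -> G -> R[i]) (x : nat -> A),
  forall g, delta g b = \sum_(i < n) w i g *: x i.

Variable B : set A.
Hypotheses (Balg : cstar_subalgebra B) (Binv : forall g b, B b -> B (delta g b)).

(* Smearing [b] with an approximate identity [u * u * u] of [C(G)], and the latter
   approximated by representative functions. *)
Lemma gfin_dense b (e : R) : B b -> 0 < e ->
  exists2 b', B b' /\ gfin b' & nm (b' - b) <= e.
Proof.
have /cstar_subalgebraP[cB [B0 BD] BZ BM Bs] := Balg.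
(* Three radii [r] for the support of [u * u * u], and one more for the approximation by a
   representative function. *)
move=> Bb e0; pose r := e / 4%:R; have r0 : 0 < r by rewrite divr_gt0.
pose u := bump_at b r; have cu : rc u by exact: rc_bump_at.
have u0 x : 0 <= u x by exact: bump_at_ge0.
have u1 : 0 < u 1%g by rewrite /u bump_at1.
pose k := conv u (conv u u); have cuu := rc_conv cG cu cu.
have ck : rc k by exact: (rc_conv cG cu cuu).
have uu0 x : 0 <= conv u u x by exact: conv_ge0.
have k0 x : 0 <= k x by exact: conv_ge0.
have Ik : 0 < I k.
  by apply: (I_gt0 cG) => //; apply: conv_gt0 => //; exact: conv_gt0.
have kd x : k x * displ b x <= (r + (r + r)) * k x.
  apply: conv_support => // [y z|y|y]; first exact: displ_mul.
    exact: bump_at_displ.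
  apply: conv_support => // [y' z|y'|y']; first exact: displ_mul.
    exact: bump_at_displ.
  exact: bump_at_displ.
have nb : 0 < nm b + 1 by rewrite ltr_wpDl ?nm_ge0.
have et0 : 0 < r * I k / (nm b + 1) by rewrite divr_gt0 // mulr_gt0.
have [f rf hf] := peter_weyl cG cu (@bump_at_symm b r) et0; rewrite -/k in hf.
have cf := repf_rc cG rf.
have ob := vc_orbit b.
pose bf := J (fun x => (f x)%:C *: delta x b).
have cfb : vc (fun x => (f x)%:C *: delta x b) by exact: (vcZ cG).
have ckb : vc (fun x => (k x)%:C *: b) by apply: (vcZ cG) => //; exact: vc_cst.
have e1 : bf - (I k)%:C *: b = J (fun x => (f x)%:C *: delta x b - (k x)%:C *: b).
  rewrite -(J_scale cG) // -scaleN1r -(JZ cG) // -(JD cG) //.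
    by congr J; apply/funext => x; rewrite scaleN1r.
  by apply: (vc_lip (L := fun a => - 1 *: a) ler01) => [a c|//]; rewrite -scalerBr scaleN1r nmN mul1r.
have h1 : nm (bf - (I k)%:C *: b) <= I k * e.
  rewrite e1; have -> : I k * e = I (fun x => r * I k + (r + (r + r)) * k x).
    rewrite (ID cG); [|exact: rc_cst|by apply: (rcM cG) => //; exact: rc_cst].
    by rewrite (I_cst cG) (IZ cG) // /r; field.
  apply: (nm_J_le cG) => [||x].
  - apply: (vcD) => //; apply: (vc_lip (L := fun a => - a) ler01) => // a c.
    by rewrite -opprD nmN mul1r.
  - by apply: rcD; [exact: rc_cst|apply: (rcM cG) => //; exact: rc_cst].
  have -> : (f x)%:C *: delta x b - (k x)%:C *: b =
      (f x - k x)%:C *: delta x b + (k x)%:C *: (delta x b - b).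
    by rewrite rmorphB scalerBl scalerBr addrA subrK.
  apply: le_trans (nmD _ _) _; rewrite !nmZ !cm_real nm_saut (ger0_norm (k0 x)).
  apply: lerD; last exact: kd.
  rewrite distrC; apply: le_trans (ler_wpM2r (nm_ge0 b) (hf x)) _.
  rewrite mulrAC ler_pdivrMr // ler_wpM2l ?lerDl //.
  by rewrite mulr_ge0 // ltW.
have Bbf : B bf.
  apply: (J_closed cG (Q := B) cfb) => //.
  - move=> a ha; move/closed_nmP: (cB); apply=> d d0.
    have [c Bc ca] := ha _ (divr_gt0 d0 (ltr0n R 2)); exists c => //.
    by rewrite nmBC; apply: le_lt_trans ca _; rewrite ltr_pdivrMr // ltr_pMr // ltr1n.
  - by move=> n a; exact: BZ.
  - by move=> x; apply: BZ; exact: Binv.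
exists ((I k)^-1%:C *: bf); last first.
  have -> : (I k)^-1%:C *: bf - b = (I k)^-1%:C *: (bf - (I k)%:C *: b).
    by rewrite scalerBr scalerA -rmorphM mulVf ?scale1r // gt_eqF.
  by rewrite nmZ cm_real gtr0_norm ?invr_gt0 // ler_pdivrMl.
split; first exact: BZ.
have [T [a [c [ca cc fE]]]] := rf.
have cx i : vc (fun x => (c i x)%:C *: delta x b) by exact: (vcZ cG).
pose x (i : T) := (I k)^-1%:C *: J (fun x => (c i x)%:C *: delta x b).
(* Invariance of the mean moves [g] into [f (g^-1 * h)], which the representative function [f]
   separates. *)
have hg g : delta g ((I k)^-1%:C *: bf) = \sum_i (a i g^-1%g)%:C *: x i.
  rewrite sautZ /bf -J_delta //.
  have -> : J (fun h => delta g ((f h)%:C *: delta h b)) =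
      J (fun h => (f (g^-1 * h)%g)%:C *: delta h b).
    rewrite -[RHS](J_mulgl cG g); last first.
      by apply: (vcZ cG) => //; exact: rc_mulgl.
    by congr J; apply/funext => h; rewrite sautZ mulKg deltaM.
  have -> : (fun h => (f (g^-1 * h)%g)%:C *: delta h b) =
      fun h => \sum_i (a i g^-1%g)%:C *: ((c i h)%:C *: delta h b).
    apply/funext => h; rewrite fE rmorph_sum scaler_suml; apply: eq_bigr => i _.
    by rewrite rmorphM scalerA.
  rewrite (J_sum cG); last first.
    move=> i; apply: (vc_lip (L := fun z => (a i g^-1%g)%:C *: z) (cm_ge0 (a i g^-1%g)%:C)) => // y z.
    by rewrite -scalerBr nmZ.
  rewrite scaler_sumr; apply: eq_bigr => i _.
  by rewrite (JZ cG) // !scalerA mulrC.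
exists #|T|, (fun i g => if insub i is Some j then (a (enum_val (j : 'I_#|T|)) g^-1%g)%:C else 0),
  (fun i => if insub i is Some j then x (enum_val (j : 'I_#|T|)) else 0).
move=> g; rewrite hg (reindex _ (onW_bij _ (enum_val_bij T))) /=.
by apply: eq_bigr => i _; rewrite valK.
Qed.

End Dynamics.

Lemma sum_bump (V : nmodType) n j (F : nat -> V) : (j < n.+1)%N ->
  \sum_(i < n.+1) F i = F j + \sum_(i < n) F (bump j i).
Proof. by move=> jn; rewrite (bigD1_ord (Ordinal jn)). Qed.

(** * The module [M], the algebra [V] and independence modulo [V] *)

Section CoefficientModule.
Variables (R : realType) (A : cstarAlgType R) (G : topologicalGroupType)
  (delta : {multiplicative G -> starAut A}) (S : set (starAut A)) (B : set A).
Implicit Types (a b c : A) (g h : G) (v : G -> R[i]) (F : G -> A).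

Local Notation anrm := (@nm R A).
Local Notation vc := (@ncont R G R[i] A anrm).

Hypotheses (cG : compact [set: G]) (cdelta : pointwise_norm_continuous delta)
  (Sgroup : subgroup S) (Sdelta : S `<=` aut_commuting delta) (Smin : acts_minimally S)
  (Balg : cstar_subalgebra B) (FB : fixed_by (range delta) `<=` B)
  (Binv : forall g b, B b -> B (delta g b)) (SB : forall s b, S s -> B b -> B (s b)).

Lemma exists_neq0 : exists a : A, a != 0.
Proof.
have : hereditary_invariant S setT by rewrite Smin.
move=> [_ h _]; apply: contrapT => h0; apply: h; apply/seteqP; split=> a // _ /=.
by apply: contrapT => /eqP a0; apply: h0; exists a.
Qed.

Lemma delta_comm s g a : S s -> s (delta g a) = delta g (s a).
Proof. by move=> /Sdelta/(_ g) h; rewrite -!saut_mulE h. Qed.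

Lemma commute_range s t : S s -> range delta t -> commute s t.
Proof. by move=> Ss [g _ <-]; exact: Sdelta. Qed.

Let F_neq0 : exists2 c, fixed_by (range delta) c & c != 0.
Proof. by apply: fixed_neq0 => //; exact: exists_neq0. Qed.

Inductive coeff : (G -> A) -> Prop :=
| Coeff0 : coeff (fun=> 0)
| CoeffD b a F : B b -> coeff F -> coeff (fun g => (delta g b * a)%g + F g).

Definition M F : Prop :=
  forall e : R, 0 < e -> exists2 F', coeff F' & forall g, nm (F g - F' g) <= e.

Lemma coeff_add F F' : coeff F -> coeff F' -> coeff (fun g => F g + F' g).
Proof.
move=> cF cF'; elim: cF => [|b a F1 Bb _ IH].
  by under [fun g => _]funext do rewrite add0r.
by under [fun g => _]funext do rewrite -addrA; exact: CoeffD.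
Qed.

Lemma M_coeff F : coeff F -> M F.
Proof. by move=> cF e e0; exists F => // g; rewrite subrr nm0 ltW. Qed.

Lemma M_gen b a : B b -> M (fun g => (delta g b * a)%g).
Proof.
move=> Bb; apply: M_coeff; have := CoeffD a Bb Coeff0; congr coeff.
by apply/funext => g; rewrite addr0.
Qed.

Lemma MD F F' : M F -> M F' -> M (fun g => F g + F' g).
Proof.
move=> hF hF' e e0; have e2 : 0 < e / 2%:R by rewrite divr_gt0.
have [F1 c1 h1] := hF _ e2; have [F2 c2 h2] := hF' _ e2.
exists (fun g => F1 g + F2 g); first exact: coeff_add.
move=> g; rewrite opprD addrACA [e]splitr; apply: le_trans (nmD _ _) _; exact: lerD.
Qed.

Lemma M_closed F :
  (forall e : R, 0 < e -> exists2 F', M F' & forall g, nm (F g - F' g) <= e) -> M F.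
Proof.
move=> hF e e0; have e2 : 0 < e / 2%:R by rewrite divr_gt0.
have [F1 m1 h1] := hF _ e2; have [F2 c2 h2] := m1 _ e2; exists F2 => // g.
apply: le_trans (nm_triangle (F1 g) _ _) _; rewrite [e]splitr; exact: lerD.
Qed.

(** Additive maps bounded uniformly in [g] pass through sums and uniform limits, so stability of [M]
    needs checking on generators only. *)
Lemma M_op (l : G -> A -> A) (C : R) F :
  (forall g a b, l g (a + b) = l g a + l g b) -> (forall g a, nm (l g a) <= C * nm a) ->
  (forall b a, B b -> M (fun g => l g (delta g b * a)%g)) ->
  M F -> M (fun g => l g (F g)).
Proof.
move=> lD lC lM hF; apply: M_closed => e e0.
have l0 g : l g 0 = 0 by apply: (addrI (l g 0)); rewrite -lD !addr0.
have lB g a b : l g (a - b) = l g a - l g b.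
  by apply/eqP; rewrite eq_sym subr_eq -lD subrK.
have C1 : 0 < `|C| + 1 by rewrite ltr_wpDl.
have [F' cF' hF'] := hF _ (divr_gt0 e0 C1); exists (fun g => l g (F' g)).
  elim: cF' => [|b a F1 Bb _ IH].
    by under [fun g => _]funext do rewrite l0; exact/M_coeff/Coeff0.
  by under [fun g => _]funext do rewrite lD; apply: MD => //; exact: lM.
move=> g; rewrite -lB; apply: le_trans (lC _ _) _.
apply: le_trans (_ : (`|C| + 1) * nm (F g - F' g) <= _).
  by rewrite ler_wpM2r ?nm_ge0 //; have := ler_norm C; lra.
by rewrite mulrC -ler_pdivlMr.
Qed.

Lemma MZ (k : R[i]) F : M F -> M (fun g => k *: F g).
Proof.
apply: (M_op (l := fun _ a => k *: a) (C := cm k)) => [g a b|g a|b a Bb].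
- exact: scalerDr.
- by rewrite nmZ.
- by under [fun g => _]funext do rewrite cscalerAr; exact: M_gen.
Qed.

Lemma MB F F' : M F -> M F' -> M (fun g => F g - F' g).
Proof.
by move=> hF hF'; under [fun g => _]funext do rewrite -scaleN1r; apply: MD => //; exact: MZ.
Qed.

Lemma MMr a F : M F -> M (fun g => (F g * a)%g).
Proof.
apply: (M_op (l := fun _ c => (c * a)%g) (C := nm a)) => [g b c|g b|b c Bb].
- exact: cmulDl.
- by rewrite mulrC nmM.
- by under [fun g => _]funext do rewrite -mulgA; exact: M_gen.
Qed.

Lemma MMl b F : B b -> M F -> M (fun g => (delta g b * F g)%g).
Proof.
have /cstar_subalgebraP[_ _ _ BM _] := Balg.
move=> Bb; apply: (M_op (l := fun g c => (delta g b * c)%g) (C := nm b)) => [g a c|g a|c a Bc].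
- exact: cmulDr.
- by rewrite -(nm_saut (delta g) b) nmM.
- by under [fun g => _]funext do rewrite mulgA -sautM; apply/M_gen/BM.
Qed.

Lemma MS s F : S s -> M F -> M (fun g => s (F g)).
Proof.
move=> Ss; apply: (M_op (l := fun _ => s) (C := 1)) => [g a b|g a|b a Bb].
- exact: sautD.
- by rewrite nm_saut mul1r.
- by under [fun g => _]funext do rewrite sautM delta_comm //; apply/M_gen/SB.
Qed.

Lemma M_continuous F : M F -> vc F.
Proof.
move=> hF x e e0; have e3 : 0 < e / 3%:R by rewrite divr_gt0.
have [F' cF' hF'] := hF _ e3.
have vF' : vc F'.
  elim: cF' => [|b a F1 Bb _ IH]; first exact: vc_cst.
  apply: (vcD) => //; apply: (vc_lip (L := fun c => (c * a)%g) (nm_ge0 a)); last exact: vc_orbit.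
  by move=> c d; rewrite -cmulBl mulrC nmM.
apply: filterS (vF' x _ e3) => y h.
apply: le_trans (nm_triangle (F' x) _ _) _; have := nm_triangle (F' y) (F' x) (F y).
by have := hF' x; have := hF' y; rewrite (nmBC (F y)); lra.
Qed.

(** The missing right factor is supplied by an approximate unit from [A^G]; being fixed by [G], it
    works uniformly in [g]. *)
Lemma M_delta b : B b -> M (fun g => delta g b).
Proof.
move=> Bb; apply: M_closed => e e0.
have [c Fc hc] := fixed_approx_unit Sgroup Smin commute_range F_neq0 (star b) e0.
have /fixed_byP Fs : fixed_by (range delta) (star c).
  by have /cstar_subalgebraP[_ _ _ _ Fs] := fixed_by_subalg (range delta); exact: Fs.
exists (fun g => (delta g b * star c)%g); first exact: M_gen.
move=> g; rewrite -(Fs g) -sautM -sautB nm_saut -nm_star starB starM starK; exact: hc.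
Qed.

Lemma M_cst a : M (fun=> a).
Proof.
apply: M_closed => e e0.
have [c Fc hc] := fixed_approx_unit Sgroup Smin commute_range F_neq0 a e0.
exists (fun g => (delta g c * a)%g); first exact/M_gen/FB.
by move=> g; move/fixed_byP: Fc => ->.
Qed.

Definition V v : Prop := forall a, M (fun g => v g *: a).

Lemma V_cst (k : R[i]) : V (fun=> k).
Proof. by move=> a; exact: M_cst. Qed.

Lemma VD v v' : V v -> V v' -> V (fun g => v g + v' g).
Proof. by move=> hv hv' a; under [fun g => _]funext do rewrite scalerDl; exact: MD. Qed.

Lemma VZ (k : R[i]) v : V v -> V (fun g => k * v g).
Proof. by move=> hv a; under [fun g => _]funext do rewrite -scalerA; exact: MZ. Qed.

Lemma V_sum n (v : nat -> G -> R[i]) : (forall i, (i < n)%N -> V (v i)) ->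
  V (fun g => \sum_(i < n) v i g).
Proof.
elim: n => [|n IH] hv.
  by under [fun g => _]funext do rewrite big_ord0; exact: V_cst.
under [fun g => _]funext do rewrite big_ord_recr.
by apply: VD; [apply: IH => i /ltnW; exact: hv|exact: hv].
Qed.

Lemma scale_bounded v a : a != 0 -> M (fun g => v g *: a) ->
  exists2 C : R, 0 < C & forall g, cm (v g) <= C.
Proof.
move=> a0 hv; have na : 0 < nm a by rewrite lt0r nm_eq0 a0 nm_ge0.
have [C hC] := ncont_bounded (good_norm_nm A) cG (M_continuous hv).
exists (C / nm a + 1) => [|g]; last first.
  apply: (@le_trans _ _ (C / nm a)); last by rewrite lerDl.
  by rewrite ler_pdivlMr // -nmZ; exact: hC.
by rewrite ltr_wpDl // divr_ge0 ?(ltW na) //; apply: le_trans (hC 1%g); exact: nm_ge0.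
Qed.

Lemma V_bounded v : V v -> exists2 C : R, 0 < C & forall g, cm (v g) <= C.
Proof. by move=> hv; have [a a0] := exists_neq0; exact: scale_bounded a0 (hv a). Qed.

Lemma VM v F : V v -> M F -> M (fun g => v g *: F g).
Proof.
move=> hv; have [C C0 hC] := V_bounded hv.
apply: (M_op (l := fun g c => v g *: c) (C := C)) => [g a b|g a|b a Bb].
- exact: scalerDr.
- by rewrite nmZ ler_wpM2r ?nm_ge0.
- by under [fun g => _]funext do rewrite cscalerAr; apply: MMl.
Qed.

Lemma V_closed v :
  (forall e : R, 0 < e -> exists2 v', V v' & forall g, cm (v g - v' g) <= e) -> V v.
Proof.
move=> hv a; apply: M_closed => e e0; have na : 0 < nm a + 1 by rewrite ltr_wpDl ?nm_ge0.
have [v' hv' vv'] := hv _ (divr_gt0 e0 na); exists (fun g => v' g *: a) => // g.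
rewrite -scalerBl nmZ; apply: le_trans (ler_wpM2r (nm_ge0 a) (vv' g)) _.
by rewrite mulrAC ler_pdivrMr // ler_wpM2l ?(ltW e0) // lerDl.
Qed.

Definition lin n (w : nat -> G -> R[i]) (x : nat -> A) : G -> A :=
  fun g => \sum_(i < n) w i g *: x i.

Definition indepV n (w : nat -> G -> R[i]) : Prop :=
  forall c : nat -> R[i], V (fun g => \sum_(i < n) c i * w i g) ->
  forall i, (i < n)%N -> c i = 0.

Lemma linD n w (x y : nat -> A) : M (lin n w x) -> M (lin n w y) ->
  M (lin n w (fun i => x i + y i)).
Proof.
move=> hx hy; have := MD hx hy; congr M; apply/funext => g.
by rewrite /lin -big_split; apply: eq_bigr => i _; rewrite scalerDr.
Qed.

Lemma linZ n w (k : R[i]) (x : nat -> A) : M (lin n w x) -> M (lin n w (fun i => k *: x i)).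
Proof.
move=> hx; have := MZ k hx; congr M; apply/funext => g.
by rewrite /lin scaler_sumr; apply: eq_bigr => i _; rewrite !scalerA mulrC.
Qed.

Lemma linMr n w a (x : nat -> A) : M (lin n w x) -> M (lin n w (fun i => (x i * a)%g)).
Proof.
move=> hx; have := MMr a hx; congr M; apply/funext => g.
by rewrite /lin csuml; apply: eq_bigr => i _; rewrite cscalerAl.
Qed.

Lemma linMl n w c (x : nat -> A) : fixed_by (range delta) c ->
  M (lin n w x) -> M (lin n w (fun i => (c * x i)%g)).
Proof.
move=> Fc hx; have := MMl (FB Fc) hx; congr M; apply/funext => g.
move/fixed_byP: Fc => ->.
by rewrite /lin csumr; apply: eq_bigr => i _; rewrite cscalerAr.
Qed.

Lemma linS n w s (x : nat -> A) : S s -> M (lin n w x) -> M (lin n w (fun i => s (x i))).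
Proof.
move=> Ss hx; have := MS Ss hx; congr M; apply/funext => g.
by rewrite /lin saut_sum; apply: eq_bigr => i _; rewrite sautZ.
Qed.

(** Induction on [n]. For one function, the [a] with [w 0 *: a] in [M] form a closed [S]-invariant
    right ideal; if it is nonzero it is [A], and [w 0] is in [V]. For more, [tail] treats a
    vanishing first coefficient, so that the second coefficient is determined by the first and
    [pair_trivial] applies. *)
Lemma indepV_zero n w (y : nat -> A) : indepV n w -> M (lin n w y) ->
  forall i, (i < n)%N -> y i = 0.
Proof.
elim: n w y => [//|n IH] w y hw hM; case: n IH hw hM => [|n] IH hw hM.
  case=> // _; apply/eqP; apply: contraT => y0; exfalso.
  have : V (w 0%N).
    have hw0 : M (fun g => w 0%N g *: y 0%N).
      by move: hM; congr M; apply/funext => g; rewrite /lin big_ord1.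
    have [C C0 hC] := scale_bounded y0 hw0.
    apply: (minimal_closed_ideal Sgroup Smin (I := [set a | M (fun g => w 0%N g *: a)])).
    - split=> [|a b ha hb|k a ha|a b ha] /=.
      + by under [fun g => _]funext do rewrite scaler0; exact: M_cst.
      + by under [fun g => _]funext do rewrite scalerDr; exact: MD.
      + by under [fun g => _]funext do rewrite scalerA mulrC -scalerA; exact: MZ.
      + by under [fun g => _]funext do rewrite cscalerAl; exact: MMr.
    - apply/closed_nmP => a ha; apply: M_closed => e e0.
      have [b hb ab] := ha _ (divr_gt0 e0 C0); exists (fun g => w 0%N g *: b) => // g.
      rewrite -scalerBr nmZ -(@mulfVK _ C _ e) ?gt_eqF // mulrC.
      by apply: ler_pM; rewrite ?nm_ge0 ?cm_ge0 // ltW.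
    - by move=> s a Ss ha /=; under [fun g => _]funext do rewrite -sautZ; exact: MS.
    - by exists (y 0%N).
  move=> hV; have := hw (fun=> 1).
  under [fun g => _]funext do rewrite big_ord1 mul1r.
  by move=> /(_ hV 0%N isT) /eqP; rewrite oner_eq0.
have tail z : M (lin n.+2 w z) -> z 0%N = 0 -> forall i, (i < n.+2)%N -> z i = 0.
  move=> hz z0 [//|i]; rewrite ltnS => hi.
  apply: (IH (fun i => w i.+1) (fun i => z i.+1)) hi; last first.
    move: hz; congr M; apply/funext => g.
    by rewrite /lin big_ord_recl z0 scaler0 add0r; apply: eq_bigr.
  move=> c hc j jn; apply: (hw (fun i => if i is i'.+1 then c i' else 0) _ j.+1) => //.
  move: hc; congr V; apply/funext => g.
  by rewrite [RHS]big_ord_recl mul0r add0r.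
apply: (tail) => //.
pose D p q := exists z, [/\ z 0%N = p, z 1%N = q & M (lin n.+2 w z)].
apply: (pair_trivial Sgroup Smin F_neq0 (D := D) _ _ _ _ _ _ _ (_ : D _ (y 1%N))); last by exists y.
- move=> p q p' q' [z [<- <- hz]] [z' [<- <- hz']].
  by exists (fun i => z i + z' i); split=> //; exact: linD.
- by move=> k p q [z [<- <- hz]]; exists (fun i => k *: z i); split=> //; exact: linZ.
- by move=> p q a [z [<- <- hz]]; exists (fun i => (z i * a)%g); split=> //; exact: linMr.
- by move=> c p q Fc [z [<- <- hz]]; exists (fun i => (c * z i)%g); split=> //; exact: linMl.
- by move=> s p q Ss [z [<- <- hz]]; exists (fun i => s (z i)); split=> //; exact: linS.
- by move=> q [z [z0 <- hz]]; exact: tail hz z0 1%N isT.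
move=> k p [z [z0 z1 hz]].
(* A second coefficient [k *: p] merges the first two functions into [w 0 + k w 1]; the shorter
   family is still independent modulo [V]. *)
pose w' i := if i is i'.+1 then w i'.+2 else fun g => w 0%N g + k * w 1%N g.
pose z' i := if i is i'.+1 then z i'.+2 else p.
apply: (IH w' z' _ _ 0%N) => //; last first.
  move: hz; congr M; apply/funext => g; rewrite /lin !big_ord_recl /= z0 z1.
  by rewrite addrA scalerA -scalerDl (mulrC k).
move=> c hc; pose c' i := if i is i'.+1 then (if i' is i''.+1 then c i''.+1 else k * c 0%N) else c 0%N.
have hc' : V (fun g => \sum_(i < n.+2) c' i * w i g).
  move: hc; congr V; apply/funext => g; rewrite !big_ord_recl /= addrA; congr (_ + _).
  ring.
by case=> [|i] hi; [exact: (hw c' hc' 0%N)|exact: (hw c' hc' i.+2)].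
Qed.

Lemma eliminate (U : lmodType R[i]) n (w : nat -> U) (c : nat -> R[i]) j : (j < n.+1)%N ->
  c j != 0 -> w j = (c j)^-1 *: (\sum_(i < n.+1) c i *: w i)
    + \sum_(i < n) (- (c j)^-1 * c (bump j i)) *: w (bump j i).
Proof.
move=> jn cj; rewrite (sum_bump (fun i => c i *: w i) jn) scalerDr scalerA mulVf // scale1r.
rewrite scaler_sumr -addrA -big_split big1 ?addr0 // => i _ /=.
by rewrite mulNr scaleNr scalerA subrr.
Qed.

Definition indep n (x : nat -> A) : Prop :=
  forall c : nat -> R[i], \sum_(i < n) c i *: x i = 0 -> forall i, (i < n)%N -> c i = 0.

Lemma dependent_pivot n (P : (nat -> R[i]) -> Prop) :
  ~ (forall c : nat -> R[i], P c -> forall i, (i < n)%N -> c i = 0) ->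
  exists (c : nat -> R[i]) j, [/\ P c, (j < n)%N & c j != 0].
Proof.
move=> h; apply: contrapT => h'; apply: h => c Pc i hi; apply/eqP; apply: contraT => ci.
by exfalso; apply: h'; exists c, i.
Qed.

Lemma lin_indep n w x : exists m w' x', indep m x' /\ lin n w x = lin m w' x'.
Proof.
elim: n w x => [|n IH] w x; first by exists 0%N, w, x.
have [hx|/dependent_pivot[c [j [hc jn cj]]]] := pselect (indep n.+1 x).
  by exists n.+1, w, x.
have := eliminate x jn cj; rewrite hc scaler0 add0r => xj.
have [m [w' [x' [hx' E]]]] := IH
  (fun i g => w (bump j i) g + (- (c j)^-1 * c (bump j i)) * w j g) (fun i => x (bump j i)).
exists m, w', x'; split=> //; rewrite -E; apply/funext => g.
rewrite /lin (sum_bump (fun i => w i g *: x i) jn) xj scaler_sumr -big_split.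
by apply: eq_bigr => i _ /=; rewrite scalerDl scalerA addrC (mulrC (w j g)).
Qed.

(** The [x i] being nonzero, [indepV_zero] gives a linear relation between the [w i] modulo [V].
    Eliminating [w j] by it leaves a shorter combination, with vectors [x (bump j i) + d i *: x j]
    that are still independent. *)
Lemma coef_V n w x : indep n x -> M (lin n w x) -> forall i, (i < n)%N -> V (w i).
Proof.
elim: n w x => [//|n IH] w x hx hM.
have [hw|/dependent_pivot[c [j [hc jn cj]]]] := pselect (indepV n.+1 w).
  have x0 := indepV_zero hw hM.
  have h : \sum_(i < n.+1) 1 *: x i = 0 by rewrite big1 // => i _; rewrite x0 ?scaler0.
  by have /eqP := hx (fun=> 1) h 0%N isT; rewrite oner_eq0.
pose d i := - (c j)^-1 * c (bump j i).
pose v g := (c j)^-1 * \sum_(i < n.+1) c i * w i g.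
have hv : V v by exact: VZ.
have wj g : w j g = v g + \sum_(i < n) d i * w (bump j i) g.
  exact: (eliminate (U := R[i]^o) (w^~ g) jn cj).
have hb i : (i < n)%N -> V (w (bump j i)).
  apply: (IH (fun i => w (bump j i)) (fun i => x (bump j i) + d i *: x j)) => [k hk|].
    pose k' i := if i == j then \sum_(l < n) k l * d l else k (unbump j i).
    have h : \sum_(i < n.+1) k' i *: x i = 0.
      rewrite (sum_bump (fun i => k' i *: x i) jn) {1}/k' eqxx scaler_suml -big_split /= -[RHS]hk.
      apply: eq_bigr => l _; rewrite /k' eq_sym (negbTE (neq_bump _ _)) bumpK.
      by rewrite scalerDr scalerA addrC.
    move=> l ln; have := hx k' h (bump j l).
    rewrite /k' eq_sym (negbTE (neq_bump _ _)) bumpK; apply.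
    by rewrite /bump -addnS -[n.+1]add1n leq_add // leq_b1.
  have := MB hM (hv (x j)); congr M; apply/funext => g.
  rewrite /lin (sum_bump (fun i => w i g *: x i) jn) wj scalerDl addrAC [X in X + _]addrAC subrr add0r.
  rewrite scaler_suml -big_split; apply: eq_bigr => l _ /=.
  by rewrite scalerDr !scalerA addrC (mulrC (d l)).
have hj : V (w j).
  rewrite (_ : w j = fun g => v g + \sum_(i < n) d i * w (bump j i) g); last exact/funext.
  by apply: VD => //; apply: (V_sum (v := fun i g => d i * w (bump j i) g)) => i hi; exact/VZ/hb.
move=> i hi; have [->//|ij] := eqVneq i j.
have iE : i = bump j (unbump j i) by rewrite unbumpKcond (negbTE ij).
rewrite iE; apply: hb; rewrite /unbump; have [ji|ji] := ltnP j i.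
  by rewrite subn1 -(ltnS _ n) prednK // (leq_trans _ ji).
have ij' : (i < j)%N by rewrite ltn_neqAle ij.
exact: leq_ltn_trans (leq_subr _ _) (leq_trans ij' jn).
Qed.

Definition VR (v : G -> R) : Prop := V (fun g => (v g)%:C).

Lemma V_ReIm v : V v -> V (fun g => (v g)^*) ->
  VR (fun g => Re (v g)) /\ VR (fun g => Im (v g)).
Proof.
move=> hv hc.
have hR : VR (fun g => Re (v g)).
  rewrite /VR; have := VZ 2%:R^-1 (VD hv hc); congr V; apply/funext => g.
  by rewrite mulrC ReJ_add.
split=> //; rewrite /VR.
have := VZ (- 'i%C) (VD hv (VZ (- 1) hR)); congr V; apply/funext => g.
by rewrite {1}[v g]complexE mulN1r addrAC subrr add0r mulrA mulNr mul_ii opprK mul1r.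
Qed.

(** For [G]-finite [b], the coefficients of [b] and their conjugates, which are the coefficients of
    [star b], belong to [V]; so their real and imaginary parts take the same values at [g] and [h].
    Density of the [G]-finite elements does the rest. *)
Lemma VR_separates g h : (forall v : G -> R, VR v -> v g = v h) ->
  forall b, B b -> delta g b = delta h b.
Proof.
have /cstar_subalgebraP[_ _ _ _ Bs] := Balg.
move=> sep; have fin b : B b -> gfin delta b -> delta g b = delta h b.
  move=> Bb [n [w [x E]]].
  have [m [w' [x' [hx' E']]]] := lin_indep n w x.
  have {}E k : delta k b = lin m w' x' k by rewrite -E' E.
  have hM : M (lin m w' x').
    by have := M_delta Bb; congr M; apply/funext.
  have hM' : M (lin m (fun i k => (w' i k)^* ) (fun i => star (x' i))).
    have := M_delta (Bs _ Bb); congr M; apply/funext => k.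
    rewrite saut_star E /lin; elim/big_rec2: _ => [|i y1 y2 _ <-]; first exact: star0.
    by rewrite starD starZ.
  have hs : indep m (fun i => star (x' i)).
    move=> c hc i im; apply/eqP; rewrite -conjC_eq0; apply/eqP.
    apply: (hx' (fun i => (c i)^* ) _ i im); apply: (can_inj (@starK _ _)).
    rewrite star0 -[RHS]hc; elim/big_rec2: _ => [|l y1 y2 _ <-]; first exact: star0.
    by rewrite starD starZ conjCK.
  rewrite !E; apply: eq_bigr => i _; congr (_ *: _).
  have [h1 h2] := V_ReIm (coef_V hx' hM (ltn_ord i)) (coef_V hs hM' (ltn_ord i)).
  by rewrite [LHS]complexE [RHS]complexE (sep _ h1) (sep _ h2).
move=> b Bb; apply: subr0_eq; apply/eqP; rewrite -nm_eq0 eq_le nm_ge0 andbT.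
apply/ler_addgt0Pr => e e0; rewrite add0r.
have [b' [Bb' fb'] bb'] := gfin_dense cG cdelta Balg Binv Bb (divr_gt0 e0 (ltr0n R 2)).
apply: le_trans (nm_triangle (delta g b') _ _) _; rewrite -sautB nm_saut nmBC.
by rewrite (fin b' Bb' fb') -sautB nm_saut; lra.
Qed.

End CoefficientModule.

(** * Stone-Weierstrass for vector-valued functions *)

Section StoneWeierstrass.
Variables (R : realType) (G : topologicalGroupType) (W : (G -> R) -> Prop).
Hypotheses (cG : compact [set: G]) (W_rc : forall v, W v -> rc v)
  (W_cst : forall c : R, W (fun=> c))
  (WD : forall v w, W v -> W w -> W (fun x => v x + w x))
  (WM : forall v w, W v -> W w -> W (fun x => v x * w x))
  (W_closed : forall v, (forall e : R, 0 < e ->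
    exists2 w, W w & forall x, `|v x - w x| <= e) -> W v).
Implicit Types (v w : G -> R) (x y g h : G) (e : R).

Lemma WZ (c : R) v : W v -> W (fun x => c * v x).
Proof. by move=> hv; exact: WM (W_cst c) hv. Qed.

Lemma WB v w : W v -> W w -> W (fun x => v x - w x).
Proof.
move=> hv hw; have := WD hv (WZ (- 1) hw); congr W.
by apply/funext => x; rewrite mulN1r.
Qed.

Lemma W_sum (s : seq G) (f : G -> G -> R) : (forall i, W (f i)) ->
  W (fun x => \sum_(i <- s) f i x).
Proof.
move=> hf; elim: s => [|i s IH].
  by under [fun x => _]funext do rewrite big_nil; exact: W_cst.
by under [fun x => _]funext do rewrite big_cons; exact: WD.
Qed.

Lemma W_prod (s : seq G) (f : G -> G -> R) : (forall i, W (f i)) ->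
  W (fun x => \prod_(i <- s) f i x).
Proof.
move=> hf; elim: s => [|i s IH].
  by under [fun x => _]funext do rewrite big_nil; exact: W_cst.
by under [fun x => _]funext do rewrite big_cons; exact: WM.
Qed.

(** With [t = 1 - v^2], the iteration [y |-> (t + y^2) / 2] increases to [1 - |v|], with a gap at
    most that of [sqrt_seq] at every point; the convergence is therefore uniform. *)
Lemma W_norm_le1 v : W v -> (forall x, `|v x| <= 1) -> W (fun x => `|v x|).
Proof.
move=> hv v1; pose t x := 1 - v x * v x; have ht : W t by exact: WB (W_cst 1) (WM hv hv).
pose y := fix y n := if n is m.+1 then fun x => 2%:R^-1 * (t x + y m x * y m x) else fun=> 0.
have hy n : W (y n) by elim: n => [|n IH] /=; [exact: W_cst|exact/WZ/WD/WM].
have hb n x : [/\ 0 <= y n x, y n x <= sqrt_seq R n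
    & 0 <= 1 - `|v x| - y n x <= 1 - sqrt_seq R n].
  have vv : v x * v x = `|v x| * `|v x| by rewrite -normrM ger0_norm // -expr2 sqr_ge0.
  have tx : t x = 1 - `|v x| * `|v x| by rewrite /t vv.
  have := normr_ge0 (v x); have := v1 x.
  move: `|v x| {vv} tx => r tx r1 r0; elim: n => [|n [y0 ys /andP[d0 d1]]] /=.
    by split=> //; rewrite !subr0; apply/andP; split; lra.
  rewrite tx; have /andP[s0 s1] := sqrt_seq_bounds R n.
  move: (y n x) (sqrt_seq R n) y0 ys d0 d1 s0 s1 => a b y0 ys d0 d1 s0 s1.
  by split; [nra|nra|apply/andP; split; nra].
apply: W_closed => e e0; have [N hN] := sqrt_seq_lim e0.
exists (fun x => 1 - y N x); first exact: WB (W_cst 1) (hy N).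
move=> x; have [_ _ /andP[d0 d1]] := hb N x; have := hN N (leqnn N).
by move: d0 d1; rewrite ler_norml; move: (y N x) (sqrt_seq R N) => *; apply/andP; split; lra.
Qed.

Lemma W_norm v : W v -> W (fun x => `|v x|).
Proof.
move=> hv; have [C C0 hC] := rc_bounded cG (W_rc hv).
have := WZ C (W_norm_le1 (WZ C^-1 hv) _); have -> : (fun x => C * `|C^-1 * v x|) = (fun x => `|v x|).
  apply/funext => x; rewrite normrM gtr0_norm ?invr_gt0 // mulrA mulfV ?mul1r //.
  by rewrite gt_eqF.
apply=> x; rewrite normrM gtr0_norm ?invr_gt0 // ler_pdivrMl // mulr1; exact: hC.
Qed.

Lemma W_max0 v : W v -> W (fun x => Num.max 0 (v x)).
Proof.
move=> hv; have := WZ 2%:R^-1 (WD hv (W_norm hv)); congr W; apply/funext => x.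
have [h|h] := leP 0 (v x); first by rewrite ger0_norm //; lra.
by rewrite ltr0_norm // subrr mulr0.
Qed.

(** For [C] a bound of [v], [1 / v] is the geometric series of ratio [z = 1 - v / C] divided by [C];
    by compactness [v] is bounded below, which keeps [z] away from 1. *)
Lemma W_inv v : W v -> (forall x, 0 < v x) -> W (fun x => (v x)^-1).
Proof.
move=> hv v0; have cv := W_rc hv.
have [C C0 hC] := rc_bounded cG cv; have [D D0 hD] := rc_bounded cG (rcV cv v0).
pose z x := 1 - C^-1 * v x; have hz : W z by exact/(WB (W_cst 1))/WZ.
pose p := fix p n := if n is m.+1 then fun x => p m x * z x + C^-1 else fun=> 0.
have hp n : W (p n).
  by elim: n => [|n IH] /=; [exact: W_cst|apply: WD => //; exact: WM].
have C0' : C != 0 by rewrite gt_eqF.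
have pE n x : (v x)^-1 - p n x = z x ^+ n * (v x)^-1.
  elim: n => [|n IH] /=; first by rewrite subr0 mul1r.
  rewrite exprS -mulrA -IH /z; have v0' : v x != 0 by rewrite gt_eqF.
  by field; rewrite C0' v0'.
pose q := 1 - (C * D)^-1.
have zq x : 0 <= z x <= q.
  have := hC x; rewrite gtr0_norm // => vC; have := hD x; rewrite gtr0_norm ?invr_gt0 // => vD.
  rewrite /z /q invfM subr_ge0 ler_pdivrMl // mulr1 vC lerD2l lerN2.
  rewrite ler_wpM2l ?invr_ge0 ?(ltW C0) //.
  by rewrite -[v x]invrK lef_pV2 // posrE invr_gt0.
have q1 : 0 <= q < 1.
  have /andP[h1 h2] := zq 1%g; rewrite (le_trans h1 h2) /q ltrBlDr ltrDl invr_gt0 mulr_gt0 //.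
apply: W_closed => e e0; have [N hN] := expr_small q1 (divr_gt0 e0 D0).
exists (p N) => // x; rewrite pE; have /andP[h1 h2] := zq x.
rewrite ger0_norm; last by rewrite mulr_ge0 ?exprn_ge0 // invr_ge0 ltW.
rewrite -(@mulfVK _ D _ e) ?gt_eqF //; apply: ler_pM.
- exact: exprn_ge0.
- by rewrite invr_ge0 ltW.
- by apply: le_trans (hN N (leqnn N)); rewrite lerXn2r // nnegrE // (le_trans h1).
by apply: le_trans (hD x); exact: ler_norm.
Qed.

Variables (A : cstarAlgType R) (F : G -> A).
Hypotheses (cF : @ncont R G R[i] A (@nm R A) F)
  (F_sep : forall g h, F g <> F h -> exists2 v, W v & v g <> v h).

(** If [F h] is far from [F g], an element of [W] separating [g] from [h], shifted, taken in
    absolute value and cut off, is positive at [g] and zero near [h]. The bump is a finite product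
    of such functions. *)
Lemma separating_bump g e : 0 < e -> exists v, [/\ W v, forall x, 0 <= v x, 0 < v g
  & forall x, e <= nm (F x - F g) -> v x = 0].
Proof.
move=> e0; pose good h (p : G -> R) := [/\ W p, forall x, 0 <= p x, 0 < p g
  & nbhs h [set x | e <= nm (F x - F g) -> p x = 0]].
have hp h : exists p, good h p.
  have [he|he] := leP e (nm (F h - F g)); last first.
    exists (fun=> 1); split=> //.
    have d0 : 0 < e - nm (F h - F g) by rewrite subr_gt0.
    have d2 := divr_gt0 d0 (ltr0n R 2); have := @cF h _ d2.
    apply: filterS => x /= hx ex; exfalso.
    have := nm_triangle (F h) (F x) (F g); rewrite (nmBC (F x) (F h)).
    by move: he ex hx; lra.
  have [v hv vgh] : exists2 v, W v & v g <> v h.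
    by apply: F_sep => gh; move: he; rewrite gh subrr nm0 leNgt e0.
  pose d := `|v g - v h|; have d0 : 0 < d by rewrite normr_gt0 subr_eq0; apply/eqP.
  have d2 : 0 < d / 2%:R by rewrite divr_gt0.
  exists (fun x => Num.max 0 (`|v x - v h| - d / 2%:R)); split.
  - by apply/W_max0/WB => //; apply/W_norm/WB.
  - by move=> x; rewrite le_max lexx.
  - by rewrite lt_max -/d; apply/orP; right; lra.
  apply: filterS (W_rc hv h d2) => x /= hx _; apply/max_idPl.
  by rewrite distrC; move: hx; lra.
have [p pgood] := choice hp.
have pnbhs h : nbhs h [set x | e <= nm (F x - F g) -> p h x = 0] by have [] := pgood h.
have [s hs] := finite_cover cG pnbhs.
exists (fun x => \prod_(h <- s) p h x); split.
- by apply: W_prod => h; have [] := pgood h.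
- by move=> x; apply: prodr_ge0 => h _; have [_ ] := pgood h.
- by apply: prodr_gt0 => h _; have [_ _] := pgood h.
move=> x hx; have [h hin hU] := hs x.
by rewrite (big_rem h) //= hU // mul0r.
Qed.

(** Normalized bumps are a partition of unity inside [W]. Coefficients in [W] in front of values of
    [F] are what a module over [W] such as [M] can absorb. *)
Lemma stone_weierstrass e : 0 < e -> exists (s : seq G) (v : G -> G -> R),
  (forall g, W (v g)) /\ forall x, nm (F x - \sum_(g <- s) (v g x)%:C *: F g) <= e.
Proof.
move=> e0; have [v hv] := choice (fun g => separating_bump g e0).
have [|s hs] := @finite_cover G (fun g => [set x | 0 < v g x]) cG.
  move=> g; have [Wv _ vg _] := hv g.
  have d2 := divr_gt0 vg (ltr0n R 2); apply: filterS (W_rc Wv g d2) => x /=.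
  by rewrite ler_norml => /andP[_]; move: vg; lra.
have v0 g x : 0 <= v g x by have [] := hv g.
pose D x := \sum_(g <- s) v g x.
have D0 x : 0 < D x.
  have [g gs gx] := hs x; rewrite /D (big_rem g) //=; apply: ltr_wpDr gx.
  exact: sumr_ge0.
have WD' : W D by apply: W_sum => g; have [] := hv g.
exists s, (fun g x => v g x * (D x)^-1); split.
  by move=> g; apply: WM; [have [] := hv g|exact: W_inv].
move=> x; have su : \sum_(g <- s) v g x * (D x)^-1 = 1.
  by rewrite -mulr_suml -/(D x) divff // gt_eqF.
have -> : F x - \sum_(g <- s) (v g x * (D x)^-1)%:C *: F g =
    \sum_(g <- s) (v g x * (D x)^-1)%:C *: (F x - F g).
  under [RHS]eq_bigr do rewrite scalerBr.
  by rewrite sumrB -scaler_suml -rmorph_sum su scale1r.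
apply: le_trans (nm_sum _ _ _) _.
rewrite -[leRHS]mul1r -su mulr_suml; apply: ler_sum => g _.
have q0 : 0 <= v g x * (D x)^-1 by rewrite mulr_ge0 // invr_ge0 ltW.
rewrite nmZ cm_real ger0_norm //.
have [h|h] := leP e (nm (F x - F g)); last by rewrite ler_wpM2l // ltW.
by have [_ _ _ ->] := hv g; rewrite // !mul0r.
Qed.

End StoneWeierstrass.

(** * Recovering [B] from [M], and the correspondence *)

Section Correspondence.
Variables (R : realType) (A : cstarAlgType R) (G : topologicalGroupType)
  (delta : {multiplicative G -> starAut A}) (S : set (starAut A)) (B : set A).
Implicit Types (a b c : A) (g h : G).

Hypotheses (cG : compact [set: G]) (cdelta : pointwise_norm_continuous delta)
  (Sgroup : subgroup S) (Sdelta : S `<=` aut_commuting delta) (Smin : acts_minimally S)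
  (Balg : cstar_subalgebra B) (FB : fixed_by (range delta) `<=` B)
  (Binv : forall g b, B b -> B (delta g b)) (SB : forall s b, S s -> B b -> B (s b)).

Local Notation VR := (VR delta B).
Local Notation M := (M delta B).

Lemma VR_rc v : VR v -> rc v.
Proof.
move=> hv; have [a a0] := exists_neq0 Smin.
have na : 0 < nm a by rewrite lt0r nm_eq0 a0 nm_ge0.
have hc := M_continuous cdelta (hv a).
move=> x e e0; have := hc x _ (mulr_gt0 e0 na); apply: filterS => y.
by rewrite -scalerBl -rmorphB nmZ cm_real ler_pM2r.
Qed.

Lemma M_of_separated F : @ncont R G R[i] A (@nm R A) F ->
  (forall g h, (forall b, B b -> delta g b = delta h b) -> F g = F h) -> M F.
Proof.
move=> cF hF; apply: M_closed => e e0.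
have [||||||s [v [hv sv]]] := @stone_weierstrass R G VR cG _ _ _ _ _ A F cF _ e e0.
- exact: VR_rc.
- move=> c; rewrite /VR; exact: (V_cst cG cdelta Sgroup Sdelta Smin FB).
- move=> v w hv hw; rewrite /VR; have := VD hv hw; congr V.
  by apply/funext => g; rewrite rmorphD.
- move=> v w hv hw a; have := VM cG cdelta Smin Balg hv (hw a); congr M.
  by apply/funext => g; rewrite scalerA rmorphM.
- move=> v hv; apply: V_closed => d d0; have [w hw vw] := hv d d0.
  by exists (fun g => (w g)%:C) => // g; rewrite -rmorphB cm_real.
- move=> g h gh; apply: contrapT => sep; apply: gh; apply: hF.
  apply: (VR_separates cG cdelta Sgroup Sdelta Smin Balg FB Binv SB) => v hv.
  by apply: contrapT => vgh; apply: sep; exists v.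
exists (fun x => \sum_(g <- s) (v g x)%:C *: F g) => //.
elim: s {sv} => [|g s IH].
  by under [fun x => _]funext do rewrite big_nil; exact/M_coeff/Coeff0.
under [fun x => _]funext do rewrite big_cons.
by apply: MD => //; exact: hv.
Qed.

Lemma fixed_fixing_sub a : fixed_algebra delta (fixing_subgroup delta B) a -> B a.
Proof.
have /cstar_subalgebraP[cB [B0 BD] BZ BM Bs] := Balg.
move=> Na; have F0 := fixed_neq0 cG cdelta (exists_neq0 Smin).
have Bac c : fixed_by (range delta) c -> B (a * c)%g.
  move=> /fixed_byP Fc; move/closed_nmP: (cB); apply=> e e0.
  have hM : M (fun g => (delta g a * c)%g).
    apply: M_of_separated.
      apply: (vc_lip (L := fun b => (b * c)%g) (nm_ge0 c)); last exact: vc_orbit.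
      by move=> x y; rewrite -cmulBl mulrC nmM.
    move=> g h gh; congr (_ * c)%g.
    (* If [g] and [h] agree on [B], then [g^-1 * h] is in [G^B] and so fixes [a]. *)
    have : fixing_subgroup delta B (g^-1 * h)%g.
      by move=> b Bb; rewrite deltaM -gh // deltaVK.
    by move/Na => Nh; rewrite -[in LHS]Nh -deltaM mulVKg.
  have [F' cF' hF'] := hM _ (divr_gt0 e0 (ltr0n R 2)).
  (* [psi] turns [delta g b * y] into [b * delta x y], whose mean over [x] is [b] times an element
     of [A^G], hence in [B]; it turns [delta g a * c] into the constant [a * c]. *)
  pose psi F x := delta x (F (x^-1)%g).
  have [vF BF] : @ncont R G R[i] A (@nm R A) (psi F') /\ B (J (psi F')).
    elim: cF' => [|b y F1 Bb _ [vF1 BF1]].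
      rewrite (_ : psi _ = fun=> 0); last by apply/funext => x; exact: saut0.
      by split; [exact: vc_cst|rewrite (J_cst cG)].
    have -> : psi (fun g => (delta g b * y)%g + F1 g) = fun x => (b * delta x y)%g + psi F1 x.
      by apply/funext => x; rewrite /psi sautD sautM -deltaM mulgV delta1.
    have vy := vc_orbit cdelta y.
    have nb z : nm (b * z)%g <= nm b * nm z by exact: nmM.
    have vby : @ncont R G R[i] A (@nm R A) (fun x => (b * delta x y)%g).
      apply: (vc_lip (L := fun z => (b * z)%g) (nm_ge0 b)) => // p q.
      by rewrite -cmulBr.
    split; first exact: vcD.
    rewrite (JD cG) // (J_lin cG (L := fun z => (b * z)%g) (nm_ge0 b)) //.
    - apply: (BD) => //; apply: BM => //; apply: FB.
      exact: (expect_fixed cG cdelta).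
    - by move=> p q; exact: cmulDr.
    - by move=> k p; rewrite cscalerAr.
  exists (J (psi F')) => //.
  have -> : (a * c)%g - J (psi F') = J (fun x => (a * c)%g - psi F' x).
    rewrite -{1}(J_cst cG (a * c)%g) -scaleN1r -(JZ cG) // -(JD cG); [|exact: vc_cst|].
      by congr J; apply/funext => x; rewrite scaleN1r.
    by apply: (vc_lip (L := fun z => - 1 *: z) ler01) => // p q; rewrite -scalerBr scaleN1r nmN mul1r.
  apply: (@le_lt_trans _ _ (e / 2%:R)); last by rewrite ltr_pdivrMr // ltr_pMr // ltr1n.
  apply: (J_le cG) => [|x].
    apply: vcD; first exact: vc_cst.
    by apply: (vc_lip (L := fun z => - z) ler01) => // p q; rewrite -opprD nmN mul1r.
  have -> : (a * c)%g = delta x (delta (x^-1)%g a * c)%g.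
    by rewrite sautM -deltaM mulgV delta1 Fc.
  by rewrite /psi -sautB nm_saut.
move/closed_nmP: (cB); apply=> e e0.
have ST s t : S s -> range delta t -> commute s t.
  by move=> Ss [g _ <-]; exact: Sdelta.
(* A left approximate unit for [star a] becomes, by the involution, a right one for [a]. *)
have [c Fc hc] := fixed_approx_unit Sgroup Smin ST F0 (star a) (divr_gt0 e0 (ltr0n R 2)).
have /cstar_subalgebraP[_ _ _ _ Fs] := fixed_by_subalg (range delta).
exists (a * star c)%g; first by apply: Bac; exact: Fs.
rewrite -nm_star starB starM starK; apply: le_lt_trans hc _.
by rewrite ltr_pdivrMr // ltr_pMr // ltr1n.
Qed.

End Correspondence.

Lemma globally_invariant_range (R : realType) (A : cstarAlgType R) (G : topologicalGroupType)
    (delta : {multiplicative G -> starAut A}) (B : set A) :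
  (forall g b, B b -> B (delta g b)) -> globally_invariant (range delta) B.
Proof.
move=> hB _ [g _ <-]; apply/seteqP; split=> [_ [b Bb <-]|b Bb]; first exact: hB.
by exists (delta (g^-1)%g b); [exact: hB|rewrite -deltaM mulgV delta1].
Qed.

Theorem theorem14 (R : realType) (A : cstarAlgType R)
    (G : topologicalGroupType) (delta : {multiplicative G -> starAut A})
    (S : set (starAut A)) :
  compact [set: G] -> hausdorff_space G ->
  pointwise_norm_continuous delta ->
  subgroup S -> S `<=` aut_commuting delta ->
  acts_minimally S ->
  (forall B : set A,
     cstar_subalgebra B ->
     fixed_algebra delta setT `<=` B ->
     globally_invariant (range delta) B ->
     globally_invariant S B ->
     B = fixed_algebra delta (fixing_subgroup delta B)) /\
  (forall G0 : set G,
     closed G0 -> normal_subgroup G0 ->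
     [/\ cstar_subalgebra (fixed_algebra delta G0),
         fixed_algebra delta setT `<=` fixed_algebra delta G0,
         globally_invariant (range delta) (fixed_algebra delta G0)
       & globally_invariant S (fixed_algebra delta G0)]).
Proof.
move=> cG _ cdelta Sgroup Sdelta Smin; split=> [B Balg FB Binv SB|G0 cG0 [sG0 nG0]].
  have FB' : fixed_by (range delta) `<=` B.
    by move=> a /fixed_byP Fa; apply: FB => g _; exact: Fa.
  have Binv' g b : B b -> B (delta g b).
    by move=> Bb; rewrite -(Binv (delta g)); [exists b|exists g].
  have SB' s b : S s -> B b -> B (s b) by move: SB; rewrite globally_invariantP //; apply.
  apply/seteqP; split=> [b Bb g hg|a]; first exact: hg.
  exact: (fixed_fixing_sub cG cdelta Sgroup Sdelta Smin Balg FB' Binv' SB').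
have FE : fixed_algebra delta G0 = fixed_by [set delta g | g in G0].
  apply/seteqP; split=> a ha; first by move=> _ [g Gg <-]; exact: ha.
  by move=> g Gg; apply: ha; exists g.
split.
- by rewrite FE; exact: fixed_by_subalg.
- by move=> a ha g _; exact: ha.
(* Normality: [delta k (delta g a) = delta g (delta (k ^ g) a)], and [k ^ g] is in [G0]. *)
- apply: globally_invariant_range => g a ha k Gk.
  rewrite -deltaM (_ : (k * g)%g = (g * (k ^ g))%g); last by rewrite conjgE mulVKg.
  by rewrite deltaM ha //; exact: nG0.
apply/globally_invariantP => // s a Ss ha g Gg.
by rewrite -(delta_comm Sdelta) // ha.
Qed.
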